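(* Let $k\ge1$ be an integer. Then: (i) for every integer $d\ge1$ there is $N$ such that for all $n\ge N$ the Jensen polynomial $J^{d,n-1}(X):=\sum_{j=0}^{d}\binom{d}{j}\Delta_k(n-1+j)X^j$ has only real roots (i.e. $\Delta_k(n)$ satisfies the Turán inequality of order $d$ at $n$); (ii) for every integer $m\ge1$ there is $N$ such that for all $n\ge N$, $$L_m(\Delta_k(n)):=\frac12\sum_{i=0}^{2m}(-1)^{i+m}\binom{2m}{i}\Delta_k(n+i)\Delta_k(n+2m-i)\ge 0.$$
   Context: For an integer $k\ge1$, $\Delta_k(n)$ is defined by $\sum_{n\ge0}\Delta_k(n)q^n=\prod_{m\ge1}\frac{(1-q^{2m})(1-q^{(2k+1)m})}{(1-q^m)^3(1-q^{(4k+2)m})}$. *)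

(* Defs.v *)
From mathcomp Require Import all_boot all_order all_algebra all_field.
Set Implicit Arguments. Unset Strict Implicit. Unset Printing Implicit Defensive.
Import Order.TTheory GRing.Theory Num.Theory.
Local Open Scope ring_scope.

Definition fps := nat -> int.

Definition fps_mul (f g : fps) : fps :=
  fun n => \sum_(i < n.+1) f i * g (n - i)%N.

Definition fps_one : fps := fun n => (n == 0%N)%:R.

Definition one_minus_qpow (a : nat) : fps :=
  fun n => (n == 0%N)%:R - (n == a)%:R.

(* 1 / (1 - q^a) = sum_j q^(a j)  (for a >= 1) *)
Definition inv_one_minus_qpow (a : nat) : fps :=
  fun n => (a %| n)%:R.

Definition Delta_factor (k m : nat) : fps :=
  fps_mul (one_minus_qpow (2 * m))
  (fps_mul (one_minus_qpow ((2 * k + 1) * m))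
  (fps_mul (inv_one_minus_qpow m)
  (fps_mul (inv_one_minus_qpow m)
  (fps_mul (inv_one_minus_qpow m)
           (inv_one_minus_qpow ((4 * k + 2) * m)))))).

Definition Delta_partial (k M : nat) : fps :=
  \big[fps_mul/fps_one]_(1 <= m < M.+1) Delta_factor k m.

(* Since the m-th factor is 1 + O(q^m), the coefficient of q^n in the
   infinite product equals that of the partial product over m = 1..n. *)
Definition Delta (k n : nat) : int := Delta_partial k n n.

Definition jensen_poly (k d n : nat) : {poly algC} :=
  \sum_(j < d.+1) (('C(d, j))%:R * (Delta k (n.-1 + j)%N)%:~R) *: 'X^j.

Definition L_Delta (k m n : nat) : rat :=
  (1 / 2) * \sum_(i < (2 * m).+1)
     ((-1) ^+ (i + m)%N * ('C(2 * m, i))%:R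
      * (Delta k (n + i)%N)%:~R * (Delta k (n + 2 * m - i)%N)%:~R).

(* Main.v *)
(** Since [prod (1 - q^(2m)) / (1 - q^m) = prod 1 / (1 - q^(2m-1))], and likewise with [q^(2k+1)] for
    [q], the generating function of [Delta_k] is [prod (1 - q^m)^(-c_m)] with [c_m = 3] if [m] is odd
    and not divisible by [2k+1], and [c_m = 2] otherwise. So [Delta_k(n) r^n] is, up to a constant, the
    probability that a sum of independent variables [m * geometric(r^m)], [c_m] of them for each [m],
    equals [n].

    Choose [r = exp(-t)] with the mean of this sum equal to [n], and let [sigma^2] be its variance,
    which is of order [t^(-3)]. The [j]-th backward difference of [Delta_k(n+i) r^i] in [i] is the
    integral of the characteristic function against [(1 - exp(-i theta))^j exp(-i n theta)]. The
    characteristic function is close to that of the Gaussian for [|theta| <= 6t], with error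
    [O(theta^3 t^(-4)) exp(-c theta^2 t^(-3))], and exponentially small in [1/t] elsewhere. Hence the [j]-th difference, scaled
    by [sigma^j], tends to the [j]-th derivative at 0 of [exp(-x^2/2)], for every [j].

    (i) After the substitution [X = -r (1 - u / sigma)] the Jensen polynomial therefore tends to the
    Hermite polynomial of degree [d] in [u], which alternates in sign at [d+1] points; so does the
    Jensen polynomial at [d+1] rational points, and a real polynomial of degree [d] with that many
    alternations has no nonreal root. (ii) By the umbral identity
    [(Y - X)^(2m) = ((1 - X) - (1 - Y))^(2m)], [L_m] is the same quadratic expression in the
    differences, and its limit is a sum of positive terms. *)

Require Import Defs.
From Stdlib Require Import Reals Lra Lia List ZArith Ranalysis5.
From Stdlib Require Import FunctionalExtensionality IndefiniteDescription.
From Coquelicot Require Import Coquelicot.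

Module Analytic.
Import ListNotations.
Local Open Scope R_scope.

(** * Characteristic function of the geometric law *)

(** No infinite product is formed. For each [n] only the parts up to some [M >= n] are kept, which
    leaves the coefficients up to [M] unchanged. Every estimate therefore has to be uniform in [M],
    and the lower bounds rest on the parts up to about [1/t], all present once [M * t >= 1].
    Differences are the right quantities because an approximation of the coefficients themselves
    with relative error [O(sqrt t)] says nothing about combinations that cancel down to size
    [sigma^(-d)]. The factor [(1 - exp(-i theta))^j] supplies this smallness exactly, before
    anything is approximated, so one third-order comparison with the Gaussian serves every [j]. The
    Gaussian integral is never evaluated: all limits are taken relative to the zeroth moment of the
    Gaussian on [[-PI, PI]], and integration by parts gives the higher moments. The analysis takes
    place in [R], the roots in [algC]. Signs pass from one to the other only through rational
    numbers, which is why the sample points of the Jensen polynomial have to be rational. *)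

Definition cis (x : R) : C := (cos x, sin x).

Lemma cis_add (x y : R) : cis (x + y) = (cis x * cis y)%C.
Proof.
  unfold cis, Cmult; cbn [fst snd]. rewrite cos_plus, sin_plus. f_equal; ring.
Qed.

Lemma cis_0 : cis 0 = 1%C.
Proof. unfold cis. now rewrite cos_0, sin_0. Qed.

Lemma Cmod_sqr (z : C) : Cmod z ^ 2 = fst z ^ 2 + snd z ^ 2.
Proof.
  unfold Cmod. rewrite pow2_sqrt; [ring|].
  assert (H := pow2_ge_0 (fst z)); assert (H' := pow2_ge_0 (snd z)); lra.
Qed.

Lemma Cmod_cis (x : R) : Cmod (cis x) = 1.
Proof.
  assert (H := Cmod_sqr (cis x)). assert (H1 := sin2_cos2 x). unfold Rsqr in H1.
  cbn [cis fst snd] in H. assert (H2 := Cmod_ge_0 (cis x)). nra.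
Qed.

Lemma Cmod_le_Rabs_plus (z : C) : Cmod z <= Rabs (fst z) + Rabs (snd z).
Proof.
  assert (H := Cmod_sqr z). assert (H0 := Cmod_ge_0 z).
  assert (H1 := Rabs_pos (fst z)). assert (H2 := Rabs_pos (snd z)).
  rewrite <- (pow2_abs (fst z)), <- (pow2_abs (snd z)) in H. nra.
Qed.

Lemma Rabs_Re_le_Cmod (z : C) : Rabs (Re z) <= Cmod z.
Proof.
  assert (H := Rmax_Cmod z). unfold Re.
  apply Rle_trans with (2 := H). apply Rmax_l.
Qed.

Lemma Rabs_sin_le (x : R) : Rabs (sin x) <= Rabs x.
Proof.
  assert (P : forall y, 0 <= y -> Rabs (sin y) <= y).
  { intros y [Hy | <-].
    - destruct (Rle_lt_dec y 1) as [H1|H1].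
      + rewrite Rabs_pos_eq. left; now apply sin_lt_x.
        apply sin_ge_0; [lra|]. assert (H := PI2_1); lra.
      + assert (H := SIN_bound y). apply Rabs_le. lra.
    - rewrite sin_0, Rabs_R0. lra. }
  destruct (Rle_lt_dec 0 x) as [H|H].
  - rewrite (Rabs_pos_eq x) by easy. now apply P.
  - rewrite <- (Rabs_Ropp (sin x)), <- sin_neg, (Rabs_left x) by easy. apply P; lra.
Qed.

Lemma sin_ge_cubic (x : R) : 0 <= x <= 4 -> x - x ^ 3 / 6 <= sin x.
Proof.
  intros [H1 H2]. destruct (pre_sin_bound x 0 H1 H2) as [H _].
  unfold sin_approx, sin_term in H. simpl in H. lra.
Qed.

Lemma Rabs_sin_sub_le (x : R) : Rabs (sin x - x) <= Rabs x ^ 3.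
Proof.
  assert (P : forall y, 0 <= y -> Rabs (sin y - y) <= y ^ 3).
  { intros y Hy. destruct (Rle_lt_dec y 2) as [H1|H1].
    - assert (H2 := sin_ge_cubic y ltac:(lra)). assert (H3 := Rabs_sin_le y).
      rewrite (Rabs_pos_eq y) in H3 by easy. assert (H4 := Rle_abs (sin y)).
      assert (0 <= y ^ 3) by now apply pow_le.
      rewrite Rabs_minus_sym, Rabs_pos_eq; lra.
    - assert (H3 := Rabs_sin_le y). rewrite (Rabs_pos_eq y) in H3 by easy.
      assert (H4 := Rabs_triang (sin y) (- y)).
      rewrite Rabs_Ropp, (Rabs_pos_eq y) in H4 by easy.
      unfold Rminus. nra. }
  destruct (Rle_lt_dec 0 x) as [H|H].
  - rewrite (Rabs_pos_eq x) by easy. now apply P.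
  - rewrite (Rabs_left x) by easy. rewrite <- (Rabs_Ropp (sin x - x)).
    replace (- (sin x - x)) with (sin (- x) - - x) by (rewrite sin_neg; ring).
    apply P; lra.
Qed.

Lemma one_sub_cos (x : R) : 1 - cos x = 2 * sin (x / 2) ^ 2.
Proof. replace x with (2 * (x / 2)) at 1 by field. rewrite cos_2a_sin. ring. Qed.

Lemma Rabs_cos_taylor_le (x : R) : Rabs (cos x - 1 + x ^ 2 / 2) <= Rabs x ^ 3.
Proof.
  assert (E := one_sub_cos x).
  assert (H1 := Rabs_sin_sub_le (x / 2)). assert (H2 := Rabs_sin_le (x / 2)).
  assert (Ea : Rabs (x / 2) = Rabs x / 2).
  { unfold Rdiv. rewrite Rabs_mult. f_equal. apply Rabs_pos_eq; lra. }
  rewrite Ea in *. assert (Hx := Rabs_pos x).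
  assert (Ep := pow2_abs x). set (p := Rabs x) in *.
  assert (Es := pow2_abs (sin (x / 2))). set (q := Rabs (sin (x / 2))) in *.
  assert (Hq : 0 <= q) by apply Rabs_pos.
  assert (Hpq : p / 2 - q <= (p / 2) ^ 3).
  { apply Rle_trans with (2 := H1). rewrite <- Ea. unfold q. rewrite Rabs_minus_sym.
    apply Rabs_triang_inv. }
  replace (cos x - 1 + x ^ 2 / 2) with (2 * ((p / 2 - q) * (p / 2 + q))) by nra.
  assert (0 <= (p / 2 - q) * (p / 2 + q)) by (apply Rmult_le_pos; lra).
  rewrite Rabs_pos_eq by lra.
  destruct (Rle_lt_dec p 1).
  - apply Rle_trans with (2 * ((p / 2) ^ 3 * p)).
    apply Rmult_le_compat_l; [lra|]. apply Rmult_le_compat; lra.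
    assert (0 <= p ^ 3) by now apply pow_le. nra.
  - assert (p ^ 2 <= p ^ 3) by nra. nra.
Qed.

Lemma Cmod_cis_sub_1 (x : R) : Cmod (cis x - 1) <= Rabs x.
Proof.
  assert (H := Cmod_sqr (cis x - 1)%C). cbn in H.
  assert (E := one_sub_cos x). assert (E1 := sin2_cos2 x). unfold Rsqr in E1.
  assert (H2 := Rabs_sin_le (x / 2)).
  assert (Ea : Rabs (x / 2) = Rabs x / 2).
  { unfold Rdiv. rewrite Rabs_mult. f_equal. apply Rabs_pos_eq; lra. }
  rewrite Ea in *. assert (Hx := Rabs_pos x). assert (Hq := Rabs_pos (sin (x / 2))).
  assert (Es := pow2_abs (sin (x / 2))).
  assert (H0 := Cmod_ge_0 (cis x - 1)%C).
  nra.
Qed.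

Lemma Cmod_cis_taylor_le (x : R) :
  Cmod (cis x - ((1 - x ^ 2 / 2)%R, x))%C <= 2 * Rabs x ^ 3.
Proof.
  eapply Rle_trans; [apply Cmod_le_Rabs_plus|]. cbn [cis fst snd Cminus Cplus Copp].
  assert (H1 := Rabs_cos_taylor_le x). assert (H2 := Rabs_sin_sub_le x).
  replace (cos x + - (1 - x ^ 2 / 2)) with (cos x - 1 + x ^ 2 / 2) by ring.
  unfold Rminus in H2. lra.
Qed.

Lemma exp_neg_bounds (y : R) : 0 <= y -> 1 - y <= exp (- y) <= 1 - y + y ^ 2.
Proof.
  intros Hy. split. { assert (H := exp_ineq1_le (- y)). lra. }
  assert (H := exp_ineq1_le y). assert (H1 : exp (- y) * exp y = 1).
  { rewrite <- exp_plus. replace (- y + y) with 0 by ring. apply exp_0. }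
  assert (H2 := exp_pos (- y)). assert (0 <= y ^ 3) by now apply pow_le.
  assert (exp (- y) * (1 + y) <= 1) by nra.
  apply Rmult_le_reg_r with (1 + y); [lra|]. nra.
Qed.

(** [geom_cf rho phi] is the characteristic function at [phi] of the geometric law of ratio [rho]. *)
Definition geom_cf (rho phi : R) : C := (RtoC (1 - rho) / (1 - rho * cis phi))%C.

Lemma geom_den_sqr (rho phi : R) :
  Cmod (1 - rho * cis phi)%C ^ 2 = (1 - rho) ^ 2 + 2 * rho * (1 - cos phi).
Proof.
  rewrite Cmod_sqr. cbn. assert (H := sin2_cos2 phi). unfold Rsqr in H. nra.
Qed.

Lemma geom_den_neq_0 (rho phi : R) : 0 <= rho < 1 -> (1 - rho * cis phi)%C <> 0%C.
Proof.
  intros H E. assert (H1 := geom_den_sqr rho phi). rewrite E, Cmod_0 in H1.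
  assert (H2 := COS_bound phi). nra.
Qed.

Lemma Cmod_geom_cf_sqr (rho phi : R) : 0 <= rho < 1 ->
  Cmod (geom_cf rho phi) ^ 2 = / (1 + 2 * rho * (1 - cos phi) / (1 - rho) ^ 2).
Proof.
  intros H. unfold geom_cf. rewrite Cmod_div by now apply geom_den_neq_0.
  rewrite Cmod_R, Rabs_pos_eq by lra. unfold Rdiv.
  rewrite Rpow_mult_distr, pow_inv, geom_den_sqr. assert (H2 := COS_bound phi).
  field. repeat split; nra.
Qed.

(** The squared modulus is [/ (1 + z)], and for [w >= 0] the inequality [/ (1 + w) <= 1 - w / 3]
    holds precisely when [w <= 2]. Taking the square root turns 3 into 6. *)
Lemma Cmod_geom_cf_le_exp (rho phi w : R) : 0 <= rho < 1 -> 0 <= w <= 2 ->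
  w <= 2 * rho * (1 - cos phi) / (1 - rho) ^ 2 -> Cmod (geom_cf rho phi) <= exp (- (w / 6)).
Proof.
  intros H Hw Hz. assert (E := Cmod_geom_cf_sqr rho phi H).
  set (z := 2 * rho * (1 - cos phi) / (1 - rho) ^ 2) in *.
  assert (H0 := Cmod_ge_0 (geom_cf rho phi)).
  assert (H1 : Cmod (geom_cf rho phi) ^ 2 <= exp (- (w / 6)) ^ 2).
  { rewrite E. apply Rle_trans with (/ (1 + w)). apply Rinv_le_contravar; lra.
    replace (exp (- (w / 6)) ^ 2) with (exp (- (w / 3))).
    - apply Rle_trans with (1 + - (w / 3)). 2: apply exp_ineq1_le.
      apply Rmult_le_reg_r with (1 + w); [lra|]. rewrite Rinv_l by lra. nra.
    - simpl. rewrite Rmult_1_r, <- exp_plus. f_equal. field. }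
  assert (H2 := exp_pos (- (w / 6))). nra.
Qed.

Lemma Cmod_geom_cf_le_1 (rho phi : R) : 0 <= rho < 1 -> Cmod (geom_cf rho phi) <= 1.
Proof.
  intros H. rewrite <- exp_0. replace 0 with (- (0 / 6)) by field.
  apply Cmod_geom_cf_le_exp; [easy|lra|]. assert (H2 := COS_bound phi).
  apply Rmult_le_pos; [nra|]. apply Rlt_le, Rinv_0_lt_compat. nra.
Qed.

(* Third order Taylor comparison with the Gaussian of the same mean [x = rho / (1 - rho)] and
   variance [x (1 + x)]. *)
Lemma geom_cf_gauss (rho phi : R) : 0 <= rho < 1 ->
  Cmod (geom_cf rho phi * cis (- (rho / (1 - rho) * phi))
        - RtoC (exp (- (rho / (1 - rho) ^ 2 * phi ^ 2 / 2))))%C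
  <= 6 * (rho / (1 - rho) ^ 3) * Rabs phi ^ 3.
Proof.
  intros H. set (x := rho / (1 - rho)).
  assert (Hx : 0 <= x). { apply Rmult_le_pos; [lra|]. left; apply Rinv_0_lt_compat; lra. }
  assert (E1 : rho / (1 - rho) ^ 2 = x * (1 + x)) by (unfold x; field; lra).
  assert (E2 : rho / (1 - rho) ^ 3 = x * (1 + x) ^ 2) by (unfold x; field; lra).
  rewrite E1, E2. set (y := x * (1 + x) * phi ^ 2 / 2).
  (* [geom_cf rho phi] is the inverse of [D], and [Cmod D >= 1]. The difference is therefore at most
     the modulus of the numerator [N] below, and no small denominator remains. *)
  set (D := (1 - RtoC x * (cis phi - 1))%C).
  assert (Hr1 : RtoC (1 - rho) <> 0%C).
  { intros E. apply RtoC_inj in E. lra. }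
  assert (HD : (D * RtoC (1 - rho))%C = (1 - rho * cis phi)%C).
  { unfold D. unfold x. apply injective_projections; cbn; field; lra. }
  assert (Hd := geom_den_neq_0 rho phi H).
  assert (HD0 : D <> 0%C). { intros E. rewrite E, Cmult_0_l in HD. now apply Hd. }
  assert (HuD : geom_cf rho phi = (/ D)%C).
  { unfold geom_cf. rewrite <- HD. field. now split. }
  assert (HDm : 1 <= Cmod D).
  { assert (Z := Cmod_geom_cf_le_1 rho phi H). rewrite HuD, Cmod_inv in Z by easy.
    assert (0 < Cmod D) by now apply Cmod_gt_0.
    apply Rmult_le_reg_l with (/ Cmod D). now apply Rinv_0_lt_compat.
    rewrite Rinv_l by lra. lra. }
  rewrite HuD.
  set (N := (cis (- (x * phi)) - RtoC (exp (- y)) * D)%C).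
  replace (/ D * cis (- (x * phi)) - RtoC (exp (- y)))%C with (N / D)%C by (unfold N; field; easy).
  rewrite Cmod_div by easy.
  apply Rle_trans with (Cmod N).
  { apply Rmult_le_reg_r with (Cmod D); [lra|]. unfold Rdiv. rewrite Rmult_assoc, Rinv_l by lra.
    assert (Z := Cmod_ge_0 N). nra. }
  assert (Hp := Rabs_pos phi). assert (Ep := pow2_abs phi). 
  assert (Hy : 0 <= y). { unfold y. assert (Z := pow2_ge_0 phi). apply Rmult_le_pos; [|lra]. apply Rmult_le_pos; [nra|easy]. }
  destruct (exp_neg_bounds y Hy) as [Hexp1 Hexp2]. assert (Hexp0 := exp_pos (- y)).
  assert (Hexp3 : exp (- y) <= 1). { rewrite <- exp_0. apply Rlt_le in Hexp0. destruct Hy as [Hy|<-]. left; apply exp_increasing; lra. right; f_equal; ring. }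
  assert (Ea : Rabs (- (x * phi)) = x * Rabs phi).
  { rewrite Rabs_Ropp, Rabs_mult, (Rabs_pos_eq x); easy. }
  assert (Ey : y = x * (1 + x) * Rabs phi ^ 2 / 2) by (unfold y; rewrite Ep; easy).
  (* In the first case everything is expanded to second order. In the other,
     [A = (1 + x) |phi| > 1], and the claimed bound [6 x |phi| A^2] exceeds the crude bounds on the
     separate terms. *)
  destruct (Rle_lt_dec ((1 + x) * Rabs phi) 1) as [HA|HA].
  - set (e1 := (cis (- (x * phi)) - ((1 - (- (x * phi)) ^ 2 / 2)%R, (- (x * phi))%R))%C).
    set (e2 := exp (- y) - (1 - y)).
    set (e3 := (cis phi - ((1 - phi ^ 2 / 2)%R, phi))%C).
    assert (He1 : Cmod e1 <= 2 * (x * Rabs phi) ^ 3). { rewrite <- Ea. apply Cmod_cis_taylor_le. }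
    assert (He3 : Cmod e3 <= 2 * Rabs phi ^ 3) by apply Cmod_cis_taylor_le.
    assert (He2 : Rabs e2 <= y ^ 2). { unfold e2. apply Rabs_le. split; [|lra]. assert (0 <= y ^ 2) by apply pow2_ge_0. lra. }
    (* Here [D = 1 + w - x * e3]. In [N] the terms of degree at most two cancel because mean and
       variance agree, so each summand in [EN] is of order three or more. *)
    set (w := (x * phi ^ 2 / 2, - (x * phi)) : C).
    assert (Hw : Cmod w <= x * Rabs phi ^ 2 / 2 + x * Rabs phi).
    { eapply Rle_trans; [apply Cmod_le_Rabs_plus|]. unfold w. cbn [fst snd]. rewrite Ea.
      rewrite Ep, (Rabs_pos_eq (x * phi ^ 2 / 2)). lra.
      assert (Z := pow2_ge_0 phi). apply Rmult_le_pos; [nra|lra]. }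
    assert (EN : N = (e1 + RtoC (exp (- y) * x) * e3 + RtoC y * w - RtoC e2 * (1 + w))%C).
    { unfold N, D, e1, e2, e3, w, y. apply injective_projections; cbn; field. }
    rewrite EN.
    set (p := Rabs phi) in *.
    assert (Hxp : x * p <= 1) by nra. assert (Hp1 : p <= 1) by nra.
    assert (Hxp0 : 0 <= x * p) by now apply Rmult_le_pos.
    assert (T1 : Cmod (RtoC (exp (- y) * x) * e3) <= x * (2 * p ^ 3)).
    { rewrite Cmod_mult, Cmod_R, Rabs_pos_eq by nra. apply Rmult_le_compat; try nra. apply Cmod_ge_0. }
    assert (Hw2 : Cmod w <= 3 / 2 * (x * p)). { apply Rle_trans with (1 := Hw). nra. }
    assert (T2 : Cmod (RtoC y * w) <= y * (3 / 2 * (x * p))).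
    { rewrite Cmod_mult, Cmod_R, Rabs_pos_eq by easy. now apply Rmult_le_compat_l. }
    assert (T3 : Cmod (RtoC e2 * (1 + w)) <= y ^ 2 * (5 / 2)).
    { rewrite Cmod_mult, Cmod_R. apply Rmult_le_compat; try easy. apply Rabs_pos. apply Cmod_ge_0.
      eapply Rle_trans; [apply Cmod_triangle|]. rewrite Cmod_1. lra. }
    assert (TT : Cmod (e1 + RtoC (exp (- y) * x) * e3 + RtoC y * w - RtoC e2 * (1 + w)) <=
       Cmod e1 + Cmod (RtoC (exp (- y) * x) * e3) + Cmod (RtoC y * w) + Cmod (RtoC e2 * (1 + w))).
    { unfold Cminus. eapply Rle_trans; [apply Cmod_triangle|]. rewrite Cmod_opp. apply Rplus_le_compat_r.
      eapply Rle_trans; [apply Cmod_triangle|]. apply Rplus_le_compat_r. apply Cmod_triangle. }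
    eapply Rle_trans; [exact TT|].
    set (Q := x * (1 + x) ^ 2 * p ^ 3).
    assert (Hp3 : 0 <= p ^ 3) by now apply pow_le.
    assert (B1 : (x * p) ^ 3 <= Q).
    { unfold Q. replace ((x * p) ^ 3) with (x * x ^ 2 * p ^ 3) by ring.
      apply Rmult_le_compat_r; [easy|]. apply Rmult_le_compat_l; nra. }
    assert (B2 : x * p ^ 3 <= Q).
    { unfold Q. apply Rmult_le_compat_r; [easy|]. rewrite <- (Rmult_1_r x) at 1. apply Rmult_le_compat_l; nra. }
    assert (B3 : y * (x * p) <= Q / 2).
    { rewrite Ey. unfold Q. replace (x * (1 + x) * p ^ 2 / 2 * (x * p)) with (x * (1 + x) * x * p ^ 3 / 2) by field.
      apply Rmult_le_compat_r; [lra|]. apply Rmult_le_compat_r; [easy|]. nra. }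
    assert (B4 : y ^ 2 <= Q / 4).
    { rewrite Ey. unfold Q. replace ((x * (1 + x) * p ^ 2 / 2) ^ 2) with (x * (1 + x) ^ 2 * p ^ 3 * (x * p) / 4) by field.
      assert (0 <= Q) by (unfold Q; apply Rmult_le_pos; [nra|easy]). fold Q. nra. }
    assert (0 <= Q) by nra.
    replace (6 * (x * (1 + x) ^ 2) * p ^ 3) with (6 * Q) by (unfold Q; ring). lra.
  - assert (EN : N = ((cis (- (x * phi)) - 1) + RtoC (1 - exp (- y)) + RtoC (exp (- y) * x) * (cis phi - 1))%C).
    { unfold N, D. rewrite RtoC_minus, RtoC_mult. ring. }
    rewrite EN. eapply Rle_trans; [apply Cmod_triangle|].
    eapply Rle_trans; [apply Rplus_le_compat_r, Cmod_triangle|].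
    rewrite Cmod_mult, !Cmod_R, (Rabs_pos_eq (1 - exp (- y))), (Rabs_pos_eq (exp (- y) * x)) by nra.
    assert (H1 := Cmod_cis_sub_1 (- (x * phi))). rewrite Ea in H1.
    assert (H2 := Cmod_cis_sub_1 phi).
    set (p := Rabs phi) in *.
    assert (H3 : exp (- y) * x * Cmod (cis phi - 1) <= x * p).
    { apply Rmult_le_compat; try nra. apply Cmod_ge_0. }
    set (A := (1 + x) * p) in *.
    assert (EQ : 6 * (x * (1 + x) ^ 2) * p ^ 3 = 6 * (x * p * (A * A))) by (unfold A; ring).
    rewrite EQ.
    assert (Hxp0 : 0 <= x * p) by now apply Rmult_le_pos.
    assert (y = x * p * A / 2) by (rewrite Ey; unfold A; field).
    assert (x * p * 1 <= x * p * (A * A)) by (apply Rmult_le_compat_l; nra).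
    assert (x * p * A <= x * p * (A * A)) by (apply Rmult_le_compat_l; nra).
    lra.
Qed.

(** * Coefficients of the product as Fourier integrals *)

Fixpoint prodC (f : nat -> C) (L : list nat) : C :=
  match L with [] => 1%C | m :: L' => (f m * prodC f L')%C end.

Fixpoint sumL (f : nat -> R) (L : list nat) : R :=
  match L with [] => 0 | m :: L' => f m + sumL f L' end.

Fixpoint prodR (f : nat -> R) (L : list nat) : R :=
  match L with [] => 1 | m :: L' => f m * prodR f L' end.

Definition Ccont (f : R -> C) : Prop :=
  forall x, continuous (fun y => Re (f y)) x /\ continuous (fun y => Im (f y)) x.

Lemma Ccont_const (c : C) : Ccont (fun _ => c).
Proof. split; apply continuous_const. Qed.

Lemma Ccont_mult (f g : R -> C) : Ccont f -> Ccont g -> Ccont (fun x => f x * g x)%C.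
Proof.
  intros Hf Hg x. destruct (Hf x), (Hg x). split; cbn.
  - apply (continuous_minus (V := R_NormedModule)); now apply (continuous_mult (K := R_AbsRing)).
  - apply (continuous_plus (V := R_NormedModule)); now apply (continuous_mult (K := R_AbsRing)).
Qed.

Lemma Ccont_minus (f g : R -> C) : Ccont f -> Ccont g -> Ccont (fun x => f x - g x)%C.
Proof.
  intros Hf Hg x. destruct (Hf x), (Hg x).
  split; cbn; now apply (continuous_minus (V := R_NormedModule)).
Qed.

Lemma Ccont_pow (f : R -> C) (n : nat) : Ccont f -> Ccont (fun x => f x ^ n)%C.
Proof.
  intros Hf. induction n; cbn. apply Ccont_const. now apply Ccont_mult.
Qed.

Lemma Ccont_cis (a : R) : Ccont (fun x => cis (a * x)).
Proof.
  split; cbn; apply (ex_derive_continuous (K := R_AbsRing) (V := R_NormedModule)); auto_derive; easy.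
Qed.

Lemma Ccont_geom_cf (rho a : R) : 0 <= rho < 1 -> Ccont (fun x => geom_cf rho (a * x)).
Proof.
  intros H x. assert (D := geom_den_sqr rho (a * x)).
  rewrite Cmod_sqr in D. cbn in D. assert (B := COS_bound (a * x)).
  split; cbn; apply (ex_derive_continuous (K := R_AbsRing) (V := R_NormedModule)); auto_derive;
    repeat split; nra.
Qed.

Lemma Ccont_prodC (f : nat -> R -> C) (L : list nat) :
  (forall m, In m L -> Ccont (f m)) -> Ccont (fun x => prodC (fun m => f m x) L).
Proof.
  induction L as [|m L IH]; intros H; cbn. apply Ccont_const.
  apply Ccont_mult; [apply H; now left|]. apply IH. intros; apply H; now right.
Qed.

Lemma Ccont_ex_RInt (f : R -> C) (a b : R) : Ccont f -> ex_RInt (fun x => Re (f x)) a b.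
Proof. intros H. apply (ex_RInt_continuous (V := R_CompleteNormedModule)). intros; apply H. Qed.

Definition parts_cf (r : R) (L : list nat) (theta : R) : C :=
  prodC (fun m => geom_cf (r ^ m) (INR m * theta)) L.

Lemma pow_lt_1_pos (r : R) (m : nat) : 0 < r < 1 -> (1 <= m)%nat -> 0 < r ^ m < 1.
Proof.
  intros H Hm. split; [apply pow_lt; lra|]. apply pow_lt_1_compat; [lra|lia].
Qed.

Definition all_pos (L : list nat) : Prop := forall m, In m L -> (1 <= m)%nat.

Lemma Ccont_parts_cf (r : R) (L : list nat) : 0 < r < 1 -> all_pos L -> Ccont (parts_cf r L).
Proof.
  intros Hr HL. apply (Ccont_prodC (fun m x => geom_cf (r ^ m) (INR m * x))).
  intros m Hm. apply Ccont_geom_cf. assert (Z := pow_lt_1_pos r m Hr (HL m Hm)). lra.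
Qed.

Lemma Cmod_prodC_le_1 (f : nat -> C) (L : list nat) :
  (forall m, In m L -> Cmod (f m) <= 1) -> Cmod (prodC f L) <= 1.
Proof.
  induction L as [|m L IH]; intros H; cbn. rewrite Cmod_1; lra.
  rewrite Cmod_mult. assert (H1 := H m (or_introl eq_refl)).
  assert (H2 : Cmod (prodC f L) <= 1) by (apply IH; intros; apply H; now right).
  assert (Z1 := Cmod_ge_0 (f m)). assert (Z2 := Cmod_ge_0 (prodC f L)). nra.
Qed.

Lemma Cmod_parts_cf_le_1 (r : R) (L : list nat) (x : R) :
  0 < r < 1 -> all_pos L -> Cmod (parts_cf r L x) <= 1.
Proof.
  intros Hr HL. apply Cmod_prodC_le_1. intros m Hm. apply Cmod_geom_cf_le_1.
  assert (Z := pow_lt_1_pos r m Hr (HL m Hm)). lra.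
Qed.

(** [series_of L a]: [a] is the coefficient sequence of the product of the [1 / (1 - q^m)], [m] in [L]. *)
Inductive series_of : list nat -> (nat -> R) -> Prop :=
| series_nil a : a 0%nat = 1 -> (forall n, a (S n) = 0) -> series_of [] a
| series_cons m L a b : series_of L a ->
    (forall n, b n = a n + if Nat.leb m n then b (n - m)%nat else 0) -> series_of (m :: L) b.

(** Real parts suffice since the coefficients are real. The index lies in [Z] because the recursion
    of [fourier_step] moves it below 0, where the coefficients have to be shown to vanish. *)
Definition fourier (f : R -> C) (k : Z) : R :=
  RInt (fun x => Re (f x * cis (- IZR k * x))%C) (- PI) PI.

Lemma Ccont_fourier (f : R -> C) (k : Z) : Ccont f -> Ccont (fun x => f x * cis (- IZR k * x))%C.
Proof. intros H. apply Ccont_mult; [easy|apply Ccont_cis]. Qed.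

Lemma fourier_one (k : Z) : fourier (fun _ => 1%C) k = if Z.eqb k 0 then 2 * PI else 0.
Proof.
  unfold fourier. destruct (Z.eqb_spec k 0) as [->|Hk].
  - erewrite RInt_ext. rewrite RInt_const. unfold scal; cbn; unfold mult; cbn.
    instantiate (1 := 1). ring.
    intros x _. cbn. rewrite Ropp_0, Rmult_0_l, cos_0, sin_0. ring.
  - assert (Hk' : IZR k <> 0). { intros E. apply Hk. now apply eq_IZR. }
    apply is_RInt_unique.
    assert (E : 0 = minus (sin (IZR k * PI) / IZR k) (sin (IZR k * - PI) / IZR k)).
    { unfold minus, plus, opp; cbn. replace (IZR k * - PI) with (- (IZR k * PI)) by ring.
      rewrite sin_neg, (sin_eq_0_1 (IZR k * PI)) by now exists k. field; easy. }
    rewrite E.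
    apply (is_RInt_derive (V := R_CompleteNormedModule) (fun x => sin (IZR k * x) / IZR k)).
    + intros x _. cbn. auto_derive; [easy|].
      replace (- IZR k * x) with (- (IZR k * x)) by ring. rewrite cos_neg, sin_neg. field; easy.
    + intros x _. exact (proj1 (Ccont_fourier (fun _ => 1%C) k (Ccont_const 1%C) x)).
Qed.

Lemma fourier_bound (f : R -> C) (k : Z) :
  Ccont f -> (forall x, Cmod (f x) <= 1) -> Rabs (fourier f k) <= 2 * PI.
Proof.
  intros Hc H. assert (HP := PI_RGT_0). unfold fourier.
  replace (2 * PI) with ((PI - - PI) * 1) by ring.
  apply abs_RInt_le_const; [lra| |].
  - apply (Ccont_ex_RInt (fun x => f x * cis (- IZR k * x))%C). now apply Ccont_fourier.
  - intros t _. eapply Rle_trans; [apply Rabs_Re_le_Cmod|].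
    rewrite Cmod_mult, Cmod_cis, Rmult_1_r. apply H.
Qed.

(** From [h x * (1 - rho * cis (m x)) = (1 - rho) * f x]: a factor [cis (m x)] under the integral
    lowers the Fourier index by [m]. This is the recursion of [series_cons] in weighted form. *)
Lemma fourier_step (f : R -> C) (rho : R) (m : nat) (k : Z) : Ccont f -> 0 <= rho < 1 ->
  let h := fun x => (geom_cf rho (INR m * x) * f x)%C in
  fourier h k = (1 - rho) * fourier f k + rho * fourier h (k - Z.of_nat m).
Proof.
  intros Hf Hr h. assert (Hh : Ccont h). { apply Ccont_mult; [now apply Ccont_geom_cf|easy]. }
  unfold fourier.
  assert (E1 := Ccont_ex_RInt _ (- PI) PI (Ccont_fourier f k Hf)).
  assert (E2 := Ccont_ex_RInt _ (- PI) PI (Ccont_fourier h (k - Z.of_nat m) Hh)).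
  rewrite <- (RInt_scal (V := R_CompleteNormedModule)) by easy.
  rewrite <- (RInt_scal (V := R_CompleteNormedModule)) by easy.
  rewrite <- (RInt_plus (V := R_CompleteNormedModule)).
  2,3 : now apply (ex_RInt_scal (V := R_CompleteNormedModule)).
  apply RInt_ext. intros x _. unfold plus, scal; cbn -[Re Cmult h]; unfold mult; cbn -[Re Cmult h].
  assert (D := geom_den_neq_0 rho (INR m * x) Hr).
  assert (Eh : h x = (RtoC rho * cis (INR m * x) * h x + RtoC (1 - rho) * f x)%C).
  { unfold h, geom_cf. field_simplify_eq; [|easy]. rewrite RtoC_minus. ring. }
  assert (Ec : cis (- IZR (k - Z.of_nat m) * x) = (cis (- IZR k * x) * cis (INR m * x))%C).
  { rewrite <- cis_add. f_equal. rewrite minus_IZR, <- INR_IZR_INZ. ring. }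
  rewrite Ec. transitivity (Re (RtoC (1 - rho) * (f x * cis (- IZR k * x)) +
     RtoC rho * (h x * (cis (- IZR k * x) * cis (INR m * x))))%C).
  - f_equal. rewrite Eh at 1. ring.
  - cbn. ring.
Qed.

Theorem fourier_parts_cf (r : R) (L : list nat) (a : nat -> R) :
  0 < r < 1 -> all_pos L -> series_of L a -> forall k : Z,
  fourier (parts_cf r L) k =
    if Z.ltb k 0 then 0
    else 2 * PI * prodR (fun m => 1 - r ^ m) L * (a (Z.to_nat k) * r ^ Z.to_nat k).
Proof.
  intros Hr HL HS. induction HS as [a H0 H1|m L a b HS IH Hb]; intros k.
  - cbn [prodR]. unfold parts_cf; cbn [prodC]. rewrite fourier_one.
    destruct (Z.eqb_spec k 0) as [->|Hk]; cbn.
    + rewrite H0. ring.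
    + destruct (Z.ltb_spec k 0) as [Hk'|Hk']; [easy|].
      destruct (Z.to_nat k) eqn:E; [lia|]. rewrite H1. ring.
  - assert (Hm : (1 <= m)%nat) by (apply HL; now left).
    assert (HL' : all_pos L) by (intros ? ?; apply HL; now right).
    specialize (IH HL'). assert (Hrho := pow_lt_1_pos r m Hr Hm).
    assert (Hc := Ccont_parts_cf r L Hr HL').
    assert (St : forall k, fourier (parts_cf r (m :: L)) k =
       (1 - r ^ m) * fourier (parts_cf r L) k + r ^ m * fourier (parts_cf r (m :: L)) (k - Z.of_nat m)).
    { intros k'. apply (fourier_step (parts_cf r L) (r ^ m) m k' Hc). lra. }
    (* No negative frequencies: [j] applications of the recursion multiply a coefficient bounded by
       [2 * PI] by [(r ^ m) ^ j], which tends to 0. The strong induction on [n] below starts from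
       this. *)
    assert (Neg : forall k, (k < 0)%Z -> fourier (parts_cf r (m :: L)) k = 0).
    { intros k' Hk'.
      assert (It : forall j k', (k' < 0)%Z -> fourier (parts_cf r (m :: L)) k' =
         (r ^ m) ^ j * fourier (parts_cf r (m :: L)) (k' - Z.of_nat (j * m))).
      { induction j as [|j IHj]; intros k'' Hk''. cbn. rewrite Z.sub_0_r. ring.
        rewrite St, IH. destruct (Z.ltb_spec k'' 0); [|lia]. rewrite IHj by lia.
        replace (k'' - Z.of_nat m - Z.of_nat (j * m))%Z with (k'' - Z.of_nat (S j * m))%Z by lia.
        cbn [pow]. ring. }
      apply Rabs_eq_0. apply Rle_antisym; [|apply Rabs_pos].
      assert (HP := PI_RGT_0).
      apply le_epsilon. intros eps Heps. rewrite Rplus_0_l.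
      destruct (pow_lt_1_zero (r ^ m) ltac:(rewrite Rabs_pos_eq; lra) (eps / (2 * PI))) as [N HN].
      { apply Rdiv_lt_0_compat; lra. }
      rewrite (It N) by easy. rewrite Rabs_mult. specialize (HN N (le_n N)).
      assert (B := fourier_bound (parts_cf r (m :: L)) (k' - Z.of_nat (N * m))
        (Ccont_parts_cf r _ Hr HL) (fun x => Cmod_parts_cf_le_1 r _ x Hr HL)).
      apply Rle_trans with (eps / (2 * PI) * (2 * PI)).
      - apply Rmult_le_compat; try apply Rabs_pos; lra.
      - right. field. lra. }
    destruct (Z.ltb_spec k 0) as [Hk|Hk]; [now apply Neg|].
    rewrite <- (Z2Nat.id k) at 1 by easy. generalize (Z.to_nat k). clear k Hk.
    intros n. induction n as [n IHn] using lt_wf_ind.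
    rewrite St, IH, Hb. destruct (Z.ltb_spec (Z.of_nat n) 0); [lia|]. rewrite Nat2Z.id.
    cbn [prodR]. destruct (Nat.leb_spec m n) as [Hmn|Hmn].
    + rewrite <- Nat2Z.inj_sub by easy. rewrite IHn by lia. cbn [prodR].
      replace (r ^ n) with (r ^ m * r ^ (n - m)). ring. rewrite <- pow_add. f_equal. lia.
    + rewrite Neg by lia. ring.
Qed.

Fixpoint bdiff (b : nat -> R) (j n : nat) : R :=
  match j with O => b n | S j' => bdiff b j' n - bdiff b j' (S n) end.

(** Raising [n] by one multiplies the integrand by [cis (- x)], so each difference contributes one
    factor [1 - cis (- x)]. *)
Theorem bdiff_fourier (r : R) (L : list nat) (a : nat -> R) :
  0 < r < 1 -> all_pos L -> series_of L a -> forall j n,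
  2 * PI * prodR (fun m => 1 - r ^ m) L * bdiff (fun i => a i * r ^ i) j n =
  RInt (fun x => Re (parts_cf r L x * cis (- INR n * x) * (1 - cis (- x)) ^ j)%C) (- PI) PI.
Proof.
  intros Hr HL HS. assert (HC := Ccont_parts_cf r L Hr HL).
  assert (Hcis : Ccont (fun x => 1 - cis (- x))%C).
  { apply Ccont_minus; [apply Ccont_const|]. intros x. generalize (Ccont_cis (-1) x).
    intros [H1 H2]. split.
    - eapply continuous_ext; [|exact H1]. intros y; cbn. f_equal. ring.
    - eapply continuous_ext; [|exact H2]. intros y; cbn. f_equal. ring. }
  assert (HI : forall j n, ex_RInt (fun x => Re (parts_cf r L x * cis (- INR n * x) * (1 - cis (- x)) ^ j)%C) (- PI) PI).
  { intros j n. apply (Ccont_ex_RInt (fun x => parts_cf r L x * cis (- INR n * x) * (1 - cis (- x)) ^ j)%C).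
    apply Ccont_mult; [|now apply (Ccont_pow (fun x => 1 - cis (- x))%C)]. apply Ccont_mult; [easy|apply Ccont_cis]. }
  induction j as [|j IH]; intros n.
  - assert (F := fourier_parts_cf r L a Hr HL HS (Z.of_nat n)).
    destruct (Z.ltb_spec (Z.of_nat n) 0); [lia|]. rewrite Nat2Z.id in F. cbn [bdiff].
    rewrite <- F. apply RInt_ext. intros x _. rewrite <- INR_IZR_INZ. cbn [Cpow]. now rewrite Cmult_1_r.
  - cbn [bdiff]. rewrite Rmult_minus_distr_l, !IH.
    rewrite <- (RInt_minus (V := R_CompleteNormedModule)) by apply HI.
    apply RInt_ext. intros x _.
    assert (E : cis (- INR (S n) * x) = (cis (- INR n * x) * cis (- x))%C).
    { rewrite <- cis_add. f_equal. rewrite S_INR. ring. }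
    rewrite E. unfold minus, plus, opp; cbn -[Re Cmult Cpow cis Cminus].
    transitivity (Re (parts_cf r L x * cis (- INR n * x) * (1 - cis (- x)) ^ j
      - parts_cf r L x * (cis (- INR n * x) * cis (- x)) * (1 - cis (- x)) ^ j)%C).
    easy. f_equal. cbn [Cpow]. ring.
Qed.

(** * Bounds for the characteristic function *)

Fixpoint parts (c : nat -> nat) (M : nat) : list nat :=
  match M with O => [] | S M' => repeat (S M') (c (S M')) ++ parts c M' end.

Fixpoint psum (f : nat -> R) (K : nat) : R :=
  match K with O => 0 | S K' => f (S K') + psum f K' end.

Lemma sumL_app (f : nat -> R) (L L' : list nat) : sumL f (L ++ L') = sumL f L + sumL f L'.
Proof. induction L; cbn; [ring|]. rewrite IHL; ring. Qed.

Lemma sumL_repeat (f : nat -> R) (m k : nat) : sumL f (repeat m k) = INR k * f m.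
Proof.
  induction k. cbn; ring. cbn [repeat sumL]. rewrite IHk, S_INR. ring.
Qed.

Lemma sumL_le (f g : nat -> R) (L : list nat) :
  (forall m, In m L -> f m <= g m) -> sumL f L <= sumL g L.
Proof.
  induction L; intros H; cbn; [lra|]. apply Rplus_le_compat. apply H; now left.
  apply IHL; intros; apply H; now right.
Qed.

Lemma sumL_nonneg (f : nat -> R) (L : list nat) : (forall m, 0 <= f m) -> 0 <= sumL f L.
Proof. intros H. induction L as [|m L IH]; cbn; [lra|]. specialize (H m). lra. Qed.

Lemma sumL_scal (f : nat -> R) (k : R) (L : list nat) :
  sumL (fun m => k * f m) L = k * sumL f L.
Proof. induction L; cbn; [ring|]. rewrite IHL; ring. Qed.

Lemma sumL_ext (f g : nat -> R) (L : list nat) :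
  (forall m, f m = g m) -> sumL f L = sumL g L.
Proof. intros H. induction L; cbn; [easy|]. now rewrite H, IHL. Qed.

Lemma parts_pos (c : nat -> nat) (M : nat) : all_pos (parts c M).
Proof.
  induction M; intros m H; cbn in H; [easy|]. apply in_app_or in H as [H|H].
  apply repeat_spec in H. lia. now apply IHM.
Qed.

Lemma sumL_parts_ge (c : nat -> nat) (M K : nat) (f : nat -> R) :
  (forall m, (1 <= m)%nat -> (1 <= c m)%nat) -> (forall m, 0 <= f m) -> (K <= M)%nat ->
  psum f K <= sumL f (parts c M).
Proof.
  intros Hc Hf HK.
  assert (H1 : forall M, psum f M <= sumL f (parts c M)).
  { intros N. induction N as [|N IH]. cbn; lra. cbn [psum parts]. rewrite sumL_app, sumL_repeat.
    apply Rplus_le_compat; [|easy]. rewrite <- (Rmult_1_l (f (S N))) at 1.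
    apply Rmult_le_compat_r; [easy|]. apply (le_INR 1). apply Hc. lia. }
  apply Rle_trans with (2 := H1 M). clear H1. induction HK as [|M HK IH]; [lra|].
  cbn. specialize (Hf (S M)). lra.
Qed.

Lemma sumL_parts_geom (c : nat -> nat) (B M : nat) (f : nat -> R) (A x : R) :
  (forall m, (c m <= B)%nat) -> 0 <= A -> 0 < x < 1 ->
  (forall m, (1 <= m)%nat -> f m <= A * x ^ m) ->
  sumL f (parts c M) <= INR B * A * (x / (1 - x)).
Proof.
  intros Hc HA Hx Hf.
  assert (H : sumL f (parts c M) <= INR B * A * ((x - x ^ S M) / (1 - x))).
  { induction M as [|M IH]. cbn. replace ((x - x * 1) / (1 - x)) with 0 by (field; lra). lra.
    cbn [parts]. rewrite sumL_app, sumL_repeat.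
    assert (H1 : INR (c (S M)) * f (S M) <= INR B * (A * x ^ S M)).
    { assert (H2 := Hf (S M) ltac:(lia)). assert (0 <= A * x ^ S M).
      { apply Rmult_le_pos; [easy|]. apply pow_le; lra. }
      apply Rle_trans with (INR (c (S M)) * (A * x ^ S M)).
      apply Rmult_le_compat_l; [apply pos_INR|easy].
      apply Rmult_le_compat_r; [easy|]. apply le_INR, Hc. }
    replace (INR B * A * ((x - x ^ S (S M)) / (1 - x))) with
      (INR B * (A * x ^ S M) + INR B * A * ((x - x ^ S M) / (1 - x))). lra.
    cbn [pow]. field. lra. }
  apply Rle_trans with (1 := H). apply Rmult_le_compat_l. apply Rmult_le_pos; [apply pos_INR|easy].
  apply Rmult_le_compat_r. left; apply Rinv_0_lt_compat; lra.
  assert (0 <= x ^ S M) by (apply pow_le; lra). lra.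
Qed.

(** For [m] times a geometric variable of ratio [r^m], the case [p = 1] is the mean, [p = 2] the
    variance, and [p = 3] the size of the error in [geom_cf_gauss]. *)
Definition mom (r : R) (p m : nat) : R := INR m ^ p * (r ^ m / (1 - r ^ m) ^ p).

Lemma exp_pow (x : R) (n : nat) : exp x ^ n = exp (INR n * x).
Proof.
  induction n. cbn. now rewrite Rmult_0_l, exp_0. rewrite S_INR. cbn [pow]. rewrite IHn, <- exp_plus.
  f_equal. ring.
Qed.

Lemma exp_neg_lt_1 (y : R) : 0 < y -> 0 < exp (- y) < 1.
Proof. intros H. split. apply exp_pos. rewrite <- exp_0. apply exp_increasing; lra. Qed.

Lemma exp_le (x y : R) : x <= y -> exp x <= exp y.
Proof. intros [H| ->]. left; now apply exp_increasing. lra. Qed.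

(** Follows from [y / 4 <= exp (y / 4) - 1] and [exp (- y) <= exp (- (y / 4))]. The rate 1/4 is
    chosen so that a cube of this bound, times [exp (- y)], still decays like [exp (- (y / 4))];
    hence the restriction [p <= 3] in [mom_le]. *)
Lemma div_one_sub_exp_le (y : R) : 0 < y -> y / (1 - exp (- y)) <= 4 * exp (y / 4).
Proof.
  intros Hy. destruct (exp_neg_lt_1 y Hy) as [H0 H1].
  destruct (exp_neg_lt_1 (y / 4) ltac:(lra)) as [H2 H3].
  assert (H4 : exp (- y) <= exp (- (y / 4))) by (apply exp_le; lra).
  assert (H5 := exp_ineq1_le (y / 4)).
  assert (E : exp (y / 4) * exp (- (y / 4)) = 1).
  { rewrite <- exp_plus. replace (y / 4 + - (y / 4)) with 0 by ring. apply exp_0. }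
  apply Rmult_le_reg_r with (1 - exp (- y)); [lra|].
  unfold Rdiv at 1. rewrite Rmult_assoc, Rinv_l by lra.
  assert (H6 := exp_pos (y / 4)). nra.
Qed.

Lemma mom_le (t : R) (p m : nat) : 0 < t -> (p <= 3)%nat -> (1 <= m)%nat ->
  mom (exp (- t)) p m <= (4 / t) ^ p * exp (- (t / 4)) ^ m.
Proof.
  intros Ht Hp Hm. unfold mom. rewrite !exp_pow.
  assert (Hm' : 1 <= INR m) by now apply (le_INR 1).
  set (y := INR m * t). assert (Hy : 0 < y) by (unfold y; nra).
  replace (INR m * - t) with (- y) by (unfold y; ring).
  replace (INR m * - (t / 4)) with (- (y / 4)) by (unfold y; field).
  assert (H := div_one_sub_exp_le y Hy). destruct (exp_neg_lt_1 y Hy) as [H0 H1].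
  replace (INR m ^ p * (exp (- y) / (1 - exp (- y)) ^ p)) with
    ((/ t) ^ p * (y / (1 - exp (- y))) ^ p * exp (- y)).
  2: { unfold Rdiv. rewrite !Rpow_mult_distr, !pow_inv. unfold y at 1. rewrite Rpow_mult_distr. field.
       split; apply pow_nonzero; lra. }
  apply Rle_trans with ((/ t) ^ p * (4 * exp (y / 4)) ^ p * exp (- y)).
  { apply Rmult_le_compat_r; [lra|]. apply Rmult_le_compat_l.
    apply pow_le. left; now apply Rinv_0_lt_compat. apply pow_incr. split; [|easy].
    apply Rmult_le_pos; [lra|]. left; apply Rinv_0_lt_compat; lra. }
  unfold Rdiv at 2. rewrite !Rpow_mult_distr, exp_pow.
  replace ((/ t) ^ p * (4 ^ p * exp (INR p * (y / 4))) * exp (- y)) with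
    (4 ^ p * (/ t) ^ p * (exp (INR p * (y / 4)) * exp (- y))) by ring.
  apply Rmult_le_compat_l. apply Rmult_le_pos; apply pow_le; [lra|]. left; now apply Rinv_0_lt_compat.
  rewrite <- exp_plus. apply exp_le. assert (Hp' : INR p <= 3) by (apply (le_INR p 3) in Hp; simpl in Hp; lra). nra.
Qed.

Lemma mom_nonneg (r : R) (p m : nat) : 0 < r < 1 -> 0 <= mom r p m.
Proof.
  intros Hr. unfold mom. apply Rmult_le_pos. apply pow_le, pos_INR.
  assert (0 < r ^ m) by (apply pow_lt; lra).
  assert (r ^ m <= 1). { rewrite <- (pow1 m). apply pow_incr; lra. }
  apply Rmult_le_pos; [lra|].
  (* A zero denominator means [m = 0]; the claim then rests on the convention [/ 0 = 0]. *)
  destruct (Req_dec (1 - r ^ m) 0) as [E|E].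
  - rewrite E. destruct p. cbn; lra. rewrite pow_ne_zero by easy. rewrite Rinv_0. lra.
  - left. apply Rinv_0_lt_compat, pow_lt. lra.
Qed.

(** The summands are dominated by [(4 / t)^p] times powers of [exp (- (t / 4))], whose geometric
    series is at most [4 / t]. This gives the orders [t^(-2)] for the mean, [t^(-3)] for the
    variance and [t^(-4)] for the third-order error. *)
Lemma sum_mom_le (c : nat -> nat) (B M p : nat) (t : R) :
  (forall m, (c m <= B)%nat) -> 0 < t -> (p <= 3)%nat ->
  sumL (mom (exp (- t)) p) (parts c M) <= INR B * (4 / t) ^ S p.
Proof.
  intros Hc Ht Hp. destruct (exp_neg_lt_1 (t / 4) ltac:(lra)) as [H0 H1].
  assert (Hpow : 0 <= (4 / t) ^ p).
  { apply pow_le. apply Rmult_le_pos; [lra|]. left; now apply Rinv_0_lt_compat. }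
  eapply Rle_trans.
  { apply (sumL_parts_geom c B M _ ((4 / t) ^ p) (exp (- (t / 4)))); try easy.
    intros m Hm. now apply mom_le. }
  rewrite Rmult_assoc. apply Rmult_le_compat_l; [apply pos_INR|].
  cbn [pow]. rewrite Rmult_comm. apply Rmult_le_compat_r; [easy|].
  assert (H2 := exp_ineq1_le (t / 4)).
  assert (E : exp (t / 4) * exp (- (t / 4)) = 1).
  { rewrite <- exp_plus. replace (t / 4 + - (t / 4)) with 0 by ring. apply exp_0. }
  apply Rmult_le_reg_r with (1 - exp (- (t / 4))); [lra|].
  unfold Rdiv at 1. rewrite Rmult_assoc, Rinv_l by lra. rewrite Rmult_1_r.
  apply Rmult_le_reg_l with t; [easy|].
  replace (t * (4 / t * (1 - exp (- (t / 4))))) with (4 * (1 - exp (- (t / 4)))) by (field; lra).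
  nra.
Qed.

Lemma exp_m1_ge : / 3 <= exp (- 1).
Proof.
  replace (- 1) with (- (1)) by ring. rewrite exp_Ropp. apply Rinv_le_contravar. apply exp_pos. apply exp_le_3.
Qed.

(** For [m t <= 1], [exp (- m t) >= exp (-1) >= 1/3] and [1 - exp (- m t) <= m t]. All lower bounds
    on the variance and on the decay of the characteristic function come from such parts. *)
Lemma geom_var_ge (t : R) (m : nat) : 0 < t -> (1 <= m)%nat -> INR m * t <= 1 ->
  / (3 * (INR m * t) ^ 2) <= exp (- t) ^ m / (1 - exp (- t) ^ m) ^ 2.
Proof.
  intros Ht Hm H. rewrite exp_pow. assert (Hm' : 1 <= INR m) by now apply (le_INR 1).
  replace (INR m * - t) with (- (INR m * t)) by ring. set (y := INR m * t) in *.
  assert (Hy : 0 < y) by (unfold y; nra).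
  destruct (exp_neg_lt_1 y Hy) as [H0 H1]. destruct (exp_neg_bounds y ltac:(lra)) as [H2 _].
  assert (H3 : / 3 <= exp (- y)). { apply Rle_trans with (1 := exp_m1_ge). apply exp_le; lra. }
  rewrite Rinv_mult. apply Rmult_le_compat; [lra| |easy|].
  - left. apply Rinv_0_lt_compat. nra.
  - apply Rinv_le_contravar; [nra|]. apply pow_incr. lra.
Qed.

Lemma mom2_ge (t : R) (m : nat) : 0 < t -> (1 <= m)%nat -> INR m * t <= 1 ->
  / (3 * t ^ 2) <= mom (exp (- t)) 2 m.
Proof.
  intros Ht Hm H. unfold mom. assert (H1 := geom_var_ge t m Ht Hm H).
  assert (Hm' : 1 <= INR m) by now apply (le_INR 1).
  apply Rle_trans with (INR m ^ 2 * / (3 * (INR m * t) ^ 2)).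
  - right. field. nra.
  - apply Rmult_le_compat_l; [nra|easy].
Qed.

Lemma psum_const_le (f : nat -> R) (a : R) (K : nat) :
  (forall m, (1 <= m <= K)%nat -> a <= f m) -> INR K * a <= psum f K.
Proof.
  induction K; intros H. cbn; lra. cbn [psum]. rewrite S_INR.
  assert (a <= f (S K)) by (apply H; lia). assert (INR K * a <= psum f K) by (apply IHK; intros; apply H; lia).
  lra.
Qed.

Lemma nfloor_inv (a t : R) : 0 < t -> 0 < a -> exists K : nat, INR K * t <= a /\ a / t - 1 <= INR K.
Proof.
  intros Ht Ha. destruct (nfloor_ex (a / t)) as [K [H1 H2]].
  { apply Rmult_le_pos; [lra|]. left; now apply Rinv_0_lt_compat. }
  exists K. split; [|lra]. apply Rmult_le_reg_r with (/ t). now apply Rinv_0_lt_compat.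
  rewrite Rmult_assoc, Rinv_r by lra. unfold Rdiv in H1. lra.
Qed.

Lemma le_M_of_inv (K M : nat) (t : R) : 0 < t -> 1 <= INR M * t -> INR K * t <= 1 -> (K <= M)%nat.
Proof.
  intros Ht HM HK. apply INR_le. apply Rmult_le_reg_r with t; lra.
Qed.

(** About [1 / t] parts satisfy [m t <= 1], and each contributes at least [1 / (3 t^2)]; rounding
    their number down to an integer costs the factor 2. *)
Lemma sum_mom2_ge (c : nat -> nat) (M : nat) (t : R) :
  (forall m, (1 <= m)%nat -> (1 <= c m)%nat) -> 0 < t <= / 8 -> 1 <= INR M * t ->
  / (6 * t ^ 3) <= sumL (mom (exp (- t)) 2) (parts c M).
Proof.
  intros Hc Ht HM. destruct (nfloor_inv 1 t ltac:(lra) ltac:(lra)) as [K [H1 H2]].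
  assert (HKM := le_M_of_inv K M t ltac:(lra) HM H1).
  apply Rle_trans with (psum (mom (exp (- t)) 2) K).
  2: { apply sumL_parts_ge; try easy. intros m. apply mom_nonneg. apply exp_neg_lt_1; lra. }
  apply Rle_trans with (INR K * / (3 * t ^ 2)).
  2: { apply psum_const_le. intros m Hm. apply mom2_ge; [lra|lia|].
       assert (INR m <= INR K) by (apply le_INR; lia). nra. }
  assert (H3 : / (2 * t) <= INR K).
  { apply Rle_trans with (2 := H2). apply Rmult_le_reg_r with (2 * t); [lra|].
    rewrite Rinv_l by lra. replace ((1 / t - 1) * (2 * t)) with (2 - 2 * t) by (field; lra). lra. }
  replace (/ (6 * t ^ 3)) with (/ (2 * t) * / (3 * t ^ 2)) by (field; lra).
  apply Rmult_le_compat_r; [|easy]. left; apply Rinv_0_lt_compat; nra.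
Qed.

(** Factors are exchanged one at a time. In each hybrid product the factor being exchanged lends no
    decay, and its exponent is at most [E]: this is the loss [exp E]. *)
Lemma prodC_telescope (v g : nat -> C) (e : nat -> R) (E : R) (L : list nat) :
  (forall m, In m L -> Cmod (v m) <= exp (- e m) /\ Cmod (g m) <= exp (- e m) /\ 0 <= e m <= E) ->
  0 <= E ->
  Cmod (prodC v L) <= exp (- sumL e L) /\
  Cmod (prodC v L - prodC g L) <= sumL (fun m => Cmod (v m - g m)) L * exp (E - sumL e L).
Proof.
  intros H HE. induction L as [|m L IH].
  - cbn [prodC sumL]. rewrite Cmod_1, Ropp_0, exp_0. split; [lra|].
    replace (1 - 1)%C with (RtoC 0) by ring. rewrite Cmod_0. lra.
  - destruct IH as [IH1 IH2]; [intros; apply H; now right|].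
    destruct (H m (or_introl eq_refl)) as [Hv [Hg He]]. cbn [prodC sumL].
    set (A := prodC v L) in *. set (G := prodC g L) in *. set (S := sumL e L) in *.
    set (D := sumL (fun m => Cmod (v m - g m)) L) in *.
    split.
    + rewrite Cmod_mult. replace (- (e m + S)) with (- e m + - S) by ring. rewrite exp_plus.
      apply Rmult_le_compat; try apply Cmod_ge_0; easy.
    + replace (v m * A - g m * G)%C with ((v m - g m) * A + g m * (A - G))%C by ring.
      eapply Rle_trans; [apply Cmod_triangle|]. rewrite !Cmod_mult.
      rewrite Rmult_plus_distr_r. apply Rplus_le_compat.
      * apply Rmult_le_compat_l; [apply Cmod_ge_0|]. apply Rle_trans with (1 := IH1). apply exp_le. lra.
      * apply Rle_trans with (exp (- e m) * (D * exp (E - S))).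
        apply Rmult_le_compat; try apply Cmod_ge_0; easy.
        right. replace (E - (e m + S)) with (- e m + (E - S)) by ring. rewrite exp_plus. ring.
Qed.

Lemma prodC_mult (f g : nat -> C) (L : list nat) :
  prodC (fun m => f m * g m)%C L = (prodC f L * prodC g L)%C.
Proof. induction L; cbn. ring. rewrite IHL. ring. Qed.

Lemma prodC_cis (f : nat -> R) (L : list nat) : prodC (fun m => cis (f m)) L = cis (sumL f L).
Proof. induction L; cbn. now rewrite cis_0. now rewrite IHL, cis_add. Qed.

Lemma prodC_exp (f : nat -> R) (L : list nat) :
  prodC (fun m => RtoC (exp (f m))) L = RtoC (exp (sumL f L)).
Proof. induction L; cbn. now rewrite exp_0. now rewrite IHL, exp_plus, RtoC_mult. Qed.

Lemma one_sub_cos_ge (y : R) : Rabs y <= 3 -> y ^ 2 / 8 <= 1 - cos y.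
Proof.
  intros Hy. rewrite one_sub_cos. rewrite <- (pow2_abs y).
  assert (E : sin (y / 2) ^ 2 = sin (Rabs y / 2) ^ 2).
  { unfold Rabs. destruct (Rcase_abs y); [|easy]. replace (- y / 2) with (- (y / 2)) by field.
    rewrite sin_neg. ring. }
  rewrite E. assert (Hp := Rabs_pos y). set (p := Rabs y) in *.
  assert (H := sin_ge_cubic (p / 2) ltac:(lra)).
  assert (p / 4 <= sin (p / 2)). { apply Rle_trans with (2 := H). nra. }
  nra.
Qed.

(** Decay is credited only to parts up to [K]; for larger ones the trivial bound 1, that is exponent
    0, is enough. *)
Definition small_exponent (K : nat) (e0 : R) (m : nat) : R := if Nat.leb m K then e0 else 0.

Lemma psum_small_exponent (K : nat) (e0 : R) : INR K * e0 <= psum (small_exponent K e0) K.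
Proof.
  apply psum_const_le. intros m Hm. unfold small_exponent.
  destruct (Nat.leb_spec m K); [lra|lia].
Qed.

Definition shifted_cf (r : R) (L : list nat) (n : nat) (x : R) : C := (parts_cf r L x * cis (- INR n * x))%C.

Lemma shifted_cf_gauss (c : nat -> nat) (B M n : nat) (t x : R) :
  (forall m, (1 <= m)%nat -> (1 <= c m)%nat) -> (forall m, (c m <= B)%nat) ->
  0 < t <= / 8 -> 1 <= INR M * t ->
  INR n = sumL (mom (exp (- t)) 1) (parts c M) -> Rabs x <= 6 * t ->
  Cmod (shifted_cf (exp (- t)) (parts c M) n x
        - RtoC (exp (- (sumL (mom (exp (- t)) 2) (parts c M) * x ^ 2 / 2))))%C
  <= INR B * 4608 / t ^ 4 * Rabs x ^ 3 * exp (- (x ^ 2 / (432 * t ^ 3))).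
Proof.
  intros Hc HB Ht HM Hn Hx. set (r := exp (- t)) in *. set (L := parts c M) in *.
  assert (Hr : 0 < r < 1) by (apply exp_neg_lt_1; lra).
  (* Each factor is centred at its own mean. By [Hn] the means add up to [n], so the shifts multiply
     to [cis (- INR n * x)]. *)
  set (v := fun m => (geom_cf (r ^ m) (INR m * x) * cis (- (r ^ m / (1 - r ^ m) * (INR m * x))))%C).
  set (g := fun m => RtoC (exp (- (r ^ m / (1 - r ^ m) ^ 2 * (INR m * x) ^ 2 / 2)))).
  assert (Ev : shifted_cf r L n x = prodC v L).
  { unfold shifted_cf, v. rewrite prodC_mult, prodC_cis. unfold parts_cf. do 2 f_equal.
    rewrite Hn. rewrite (Rmult_comm (- _)). rewrite <- Ropp_mult_distr_r, Ropp_mult_distr_l, <- sumL_scal.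
    apply sumL_ext. intros m. unfold mom. rewrite !pow_1. ring. }
  assert (Eg : RtoC (exp (- (sumL (mom r 2) L * x ^ 2 / 2))) = prodC g L).
  { unfold g. rewrite (prodC_exp (fun m => - (r ^ m / (1 - r ^ m) ^ 2 * (INR m * x) ^ 2 / 2))). do 2 f_equal.
    transitivity ((- (x ^ 2 / 2)) * sumL (mom r 2) L). field. rewrite <- sumL_scal.
    apply sumL_ext. intros m. unfold mom, Rdiv. ring. }
  rewrite Ev, Eg.
  (* For parts up to [K], about [1 / (2 t)], the assumption [|x| <= 6 t] gives [m |x| <= 3], the
     range of [one_sub_cos_ge]. *)
  destruct (nfloor_inv (/ 2) t ltac:(lra) ltac:(lra)) as [K [H1 H2]].
  assert (HKM := le_M_of_inv K M t ltac:(lra) HM ltac:(lra)).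
  (* By [geom_var_ge], [r^m / (1 - r^m)^2 * (m x)^2] is at least [x^2 / (3 t^2) = 36 * e0]. The
     constant 108 makes [6 * e0 <= 2] for [|x| <= 6 t], as [Cmod_geom_cf_le_exp] requires. *)
  set (e0 := x ^ 2 / (108 * t ^ 2)).
  assert (Ht2 : 0 < t ^ 2) by nra.
  assert (Hx2 : x ^ 2 <= 36 * t ^ 2). { rewrite <- (pow2_abs x). assert (Z := Rabs_pos x). nra. }
  assert (Hx0 := pow2_ge_0 x).
  assert (He0 : 0 <= e0). { apply Rmult_le_pos; [easy|]. left; apply Rinv_0_lt_compat; lra. }
  assert (Ee0 : e0 * (108 * t ^ 2) = x ^ 2) by (unfold e0; field; lra).
  assert (He1 : e0 <= / 3) by nra.
  destruct (prodC_telescope v g (small_exponent K e0) (/ 3) L) as [_ T]; [|lra|].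
  { intros m Hm. assert (Hm1 := parts_pos c M m Hm).
    assert (Hm1' : 1 <= INR m) by now apply (le_INR 1).
    assert (Hrm := pow_lt_1_pos r m Hr Hm1).
    assert (Hv1 : Cmod (v m) = Cmod (geom_cf (r ^ m) (INR m * x))).
    { unfold v. rewrite Cmod_mult, Cmod_cis. ring. }
    assert (Hg1 : Cmod (g m) = exp (- (r ^ m / (1 - r ^ m) ^ 2 * (INR m * x) ^ 2 / 2))).
    { unfold g. rewrite Cmod_R, Rabs_pos_eq; [easy|]. left; apply exp_pos. }
    rewrite Hv1, Hg1. unfold small_exponent. destruct (Nat.leb_spec m K) as [Hle|Hgt].
    - assert (Hmt : INR m * t <= / 2). { assert (INR m <= INR K) by now apply le_INR. nra. }
      assert (Hvar := geom_var_ge t m ltac:(lra) Hm1 ltac:(lra)). fold r in Hvar.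
      assert (Hmm : 0 < (INR m * t) ^ 2) by (apply pow_lt; nra).
      assert (Evar : / (3 * (INR m * t) ^ 2) * (INR m * x) ^ 2 = 36 * e0).
      { unfold e0. field. split; nra. }
      assert (Hmx0 := pow2_ge_0 (INR m * x)).
      assert (Hvx : 36 * e0 <= r ^ m / (1 - r ^ m) ^ 2 * (INR m * x) ^ 2).
      { rewrite <- Evar. now apply Rmult_le_compat_r. }
      split; [|split; [|lra]].
      + replace e0 with (6 * e0 / 6) by field. apply Cmod_geom_cf_le_exp; [lra|lra|].
        assert (Hcos : (INR m * x) ^ 2 / 8 <= 1 - cos (INR m * x)).
        { apply one_sub_cos_ge. rewrite Rabs_mult, (Rabs_pos_eq (INR m)) by lra.
          apply Rle_trans with (INR m * (6 * t)). apply Rmult_le_compat_l; lra. lra. }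
        replace (2 * r ^ m * (1 - cos (INR m * x)) / (1 - r ^ m) ^ 2) with
          (2 * (r ^ m / (1 - r ^ m) ^ 2 * (1 - cos (INR m * x)))) by (field; lra).
        assert (Hpos : 0 <= r ^ m / (1 - r ^ m) ^ 2).
        { apply Rmult_le_pos; [lra|]. left; apply Rinv_0_lt_compat, pow_lt; lra. }
        apply Rle_trans with (2 * (r ^ m / (1 - r ^ m) ^ 2 * ((INR m * x) ^ 2 / 8))).
        * lra.
        * apply Rmult_le_compat_l; [lra|]. now apply Rmult_le_compat_l.
      + apply exp_le. lra.
    - rewrite Ropp_0, exp_0. split; [|split; [|lra]]. apply Cmod_geom_cf_le_1; lra.
      assert (0 <= r ^ m / (1 - r ^ m) ^ 2 * (INR m * x) ^ 2);
        [|apply Rle_trans with (exp 0); [apply exp_le; lra|rewrite exp_0; lra]].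
      apply Rmult_le_pos; [|apply pow2_ge_0]. apply Rmult_le_pos; [lra|].
      left; apply Rinv_0_lt_compat, pow_lt; lra. }
  apply Rle_trans with (1 := T).
  assert (Hx3 : 0 <= Rabs x ^ 3) by (apply pow_le, Rabs_pos).
  assert (HD : sumL (fun m => Cmod (v m - g m)) L <= INR B * 1536 / t ^ 4 * Rabs x ^ 3).
  { apply Rle_trans with (sumL (fun m => (6 * Rabs x ^ 3) * mom r 3 m) L).
    - apply sumL_le. intros m Hm. assert (Hm1 := parts_pos c M m Hm).
      assert (Hrm := pow_lt_1_pos r m Hr Hm1).
      assert (U := geom_cf_gauss (r ^ m) (INR m * x) ltac:(lra)).
      apply Rle_trans with (1 := U). right. unfold mom.
      rewrite Rabs_mult, (Rabs_pos_eq (INR m)) by apply pos_INR. rewrite Rpow_mult_distr. ring.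
    - rewrite sumL_scal. assert (S3 := sum_mom_le c B M 3 t HB ltac:(lra) (le_n 3)).
      fold r L in S3. apply Rle_trans with (6 * Rabs x ^ 3 * (INR B * (4 / t) ^ 4)).
      apply Rmult_le_compat_l; [lra|easy]. right. field. lra. }
  (* [K >= 1 / (4 t)] turns [K * e0] into at least [x^2 / (432 t^3)], and the loss [exp (1/3)] is
     rounded up to 3. With [6 * 4^4 = 1536] from the third-order errors this yields the constant
     4608. *)
  assert (HE : exp (/ 3 - sumL (small_exponent K e0) L) <= 3 * exp (- (x ^ 2 / (432 * t ^ 3)))).
  { apply Rle_trans with (exp (1 + - (x ^ 2 / (432 * t ^ 3)))).
    - apply exp_le.
      assert (P1 := psum_small_exponent K e0).
      assert (P2 := sumL_parts_ge c M K (small_exponent K e0) Hc).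
      assert (P3 : psum (small_exponent K e0) K <= sumL (small_exponent K e0) L).
      { apply P2; [|easy]. intros m. unfold small_exponent. destruct (Nat.leb m K); lra. }
      assert (P4 : / (4 * t) <= INR K).
      { apply Rle_trans with (2 := H2). apply Rmult_le_reg_r with (4 * t); [lra|].
        rewrite Rinv_l by lra. replace ((/ 2 / t - 1) * (4 * t)) with (2 - 4 * t) by (field; lra). lra. }
      assert (P5 : x ^ 2 / (432 * t ^ 3) = / (4 * t) * e0) by (unfold e0; field; lra).
      rewrite P5. assert (/ (4 * t) * e0 <= INR K * e0) by now apply Rmult_le_compat_r. lra.
    - rewrite exp_plus. apply Rmult_le_compat_r. left; apply exp_pos. apply exp_le_3. }
  replace (INR B * 4608 / t ^ 4 * Rabs x ^ 3 * exp (- (x ^ 2 / (432 * t ^ 3)))) with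
    (INR B * 1536 / t ^ 4 * Rabs x ^ 3 * (3 * exp (- (x ^ 2 / (432 * t ^ 3))))) by (field; lra).
  apply Rmult_le_compat; [| |easy|easy].
  - apply sumL_nonneg. intros m. apply Cmod_ge_0.
  - left; apply exp_pos.
Qed.

(** The products [2 sin (x/2) cos (m x)] equal [sin (m x + x/2) - sin (m x - x/2)] and telescope. *)
Lemma dirichlet_kernel (x : R) (K : nat) :
  2 * sin (x / 2) * psum (fun m => cos (INR m * x)) K = sin (INR K * x + x / 2) - sin (x / 2).
Proof.
  induction K. cbn. rewrite Rmult_0_l, Rplus_0_l. ring.
  cbn [psum]. rewrite Rmult_plus_distr_l, IHK, S_INR.
  replace (INR K * x + x / 2) with ((INR K + 1) * x - x / 2) by field.
  rewrite sin_minus, sin_plus. ring.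
Qed.

Lemma psum_one_sub (f : nat -> R) (K : nat) : psum (fun m => (1 - f m) / 9) K = (INR K - psum f K) / 9.
Proof. induction K. cbn. field. cbn [psum]. rewrite IHK, S_INR. field. Qed.

(** Among the first [K] parts, about [1 / t] of them, the phases [m x] cannot all stay near
    multiples of [2 PI]: the Dirichlet kernel bounds the sum of the [cos (m x)] by [1 / (2 t)], so
    the numbers [1 - cos (m x)] add up to a multiple of [1 / t]. *)
Lemma shifted_cf_tail (c : nat -> nat) (M n : nat) (t x : R) :
  (forall m, (1 <= m)%nat -> (1 <= c m)%nat) ->
  0 < t <= / 8 -> 1 <= INR M * t -> 6 * t <= Rabs x <= PI ->
  Cmod (shifted_cf (exp (- t)) (parts c M) n x) <= exp (- / (36 * t)).
Proof.
  intros Hc Ht HM Hx. unfold shifted_cf. rewrite Cmod_mult, Cmod_cis, Rmult_1_r.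
  set (r := exp (- t)). set (L := parts c M).
  assert (Hr : 0 < r < 1) by (apply exp_neg_lt_1; lra).
  destruct (nfloor_inv 1 t ltac:(lra) ltac:(lra)) as [K [H1 H2]].
  assert (HKM := le_M_of_inv K M t ltac:(lra) HM ltac:(lra)).
  (* The exponent is [w / 6] for [w = 2/3 * (1 - cos)], which stays below 2; the weight comes from
     the lower bound 1/3 on [r^m / (1 - r^m)^2] when [m t <= 1]. *)
  set (e := fun m => if Nat.leb m K then (1 - cos (INR m * Rabs x)) / 9 else 0).
  assert (He : forall m, 0 <= e m <= 1).
  { intros m. unfold e. assert (Z := COS_bound (INR m * Rabs x)). destruct (Nat.leb m K); lra. }
  set (v := fun m => geom_cf (r ^ m) (INR m * x)).
  (* Only the modulus bound is wanted here, so the comparison product is 0. *)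
  destruct (prodC_telescope v (fun _ => 0%C) e 1 L) as [T _]; [|lra|].
  { intros m Hm. assert (Hm1 := parts_pos c M m Hm).
    assert (Hm1' : 1 <= INR m) by now apply (le_INR 1).
    assert (Hrm := pow_lt_1_pos r m Hr Hm1).
    split; [|split; [|apply He]]. 2: { rewrite Cmod_0. left; apply exp_pos. }
    unfold e, v. destruct (Nat.leb_spec m K) as [Hle|Hgt].
    2: { rewrite Ropp_0, exp_0. apply Cmod_geom_cf_le_1. lra. }
    assert (Ecos : cos (INR m * Rabs x) = cos (INR m * x)).
    { unfold Rabs. destruct (Rcase_abs x); [|easy]. rewrite <- (cos_neg (INR m * x)). f_equal. ring. }
    rewrite Ecos. assert (Z := COS_bound (INR m * x)).
    replace ((1 - cos (INR m * x)) / 9) with (2 / 3 * (1 - cos (INR m * x)) / 6) by field.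
    apply Cmod_geom_cf_le_exp; [lra|lra|].
    assert (Hmt : INR m * t <= 1). { assert (INR m <= INR K) by now apply le_INR. nra. }
    assert (Hvar := geom_var_ge t m ltac:(lra) Hm1 Hmt). fold r in Hvar.
    assert (Hvar' : / 3 <= r ^ m / (1 - r ^ m) ^ 2).
    { apply Rle_trans with (2 := Hvar). apply Rinv_le_contravar. 
      assert (0 < (INR m * t) ^ 2) by (apply pow_lt; nra). lra.
      assert (0 < INR m * t) by nra. nra. }
    replace (2 * r ^ m * (1 - cos (INR m * x)) / (1 - r ^ m) ^ 2) with
          (r ^ m / (1 - r ^ m) ^ 2 * (2 * (1 - cos (INR m * x)))) by (field; lra).
    replace (2 / 3 * (1 - cos (INR m * x))) with (/ 3 * (2 * (1 - cos (INR m * x)))) by field.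
    apply Rmult_le_compat_r; lra. }
  apply Rle_trans with (1 := T). apply exp_le. apply Ropp_le_contravar.
  apply Rle_trans with (psum e K).
  2: { apply sumL_parts_ge; try easy. apply He. }
  assert (Ee : psum e K = (INR K - psum (fun m => cos (INR m * Rabs x)) K) / 9).
  { rewrite <- psum_one_sub. assert (G : forall J, (J <= K)%nat -> psum e J = psum (fun m => (1 - cos (INR m * Rabs x)) / 9) J).
    { induction J as [|J IH]; intros HJ; [easy|]. cbn [psum]. rewrite IH by lia. f_equal.
      unfold e. destruct (Nat.leb_spec (S J) K); [easy|lia]. }
    now apply G. }
  rewrite Ee. assert (D := dirichlet_kernel (Rabs x) K).
  set (S := psum (fun m => cos (INR m * Rabs x)) K) in *.
  assert (HPI := PI_4).
  (* For [p = |x| / 2] between [3 t] and 2, [p - p^3 / 6 >= p / 3 >= t]. This is the origin of the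
     threshold [6 t]. *)
  assert (Hs : t <= sin (Rabs x / 2)).
  { assert (H3 := sin_ge_cubic (Rabs x / 2) ltac:(lra)). apply Rle_trans with (2 := H3).
    assert (Hp : 0 <= Rabs x / 2 <= 2) by lra. set (p := Rabs x / 2) in *. assert (3 * t <= p) by (unfold p; lra).
    nra. }
  assert (HS : S <= / (2 * t)).
  { assert (Z := SIN_bound (INR K * Rabs x + Rabs x / 2)).
    assert (H3 : 2 * sin (Rabs x / 2) * S <= 1) by lra.
    destruct (Rle_lt_dec S 0) as [H4|H4].
    - apply Rle_trans with (1 := H4). left; apply Rinv_0_lt_compat; lra.
    - apply Rmult_le_reg_l with (2 * t); [lra|]. rewrite Rinv_r by lra. nra. }
  assert (E1 : 1 / t = 2 * / (2 * t)) by (field; lra).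
  assert (E2 : / (36 * t) = / (2 * t) / 18) by (field; lra).
  assert (4 <= / (2 * t)).
  { replace 4 with (/ (2 * / 8)) by field. apply Rinv_le_contravar; lra. }
  lra.
Qed.

(** * Gaussian approximation of the integrand *)

(** The majorant is chosen for its elementary antiderivative [atan]. It holds because
    [1 + y <= A * exp (c * y / q)], raised to the power [q = p + 1], leaves one factor [1 + y] to
    spare. *)
Lemma pow_exp_le (p : nat) (c : R) : 0 < c ->
  exists K, 0 < K /\ forall s, Rabs s ^ p * exp (- (c * s ^ 2)) <= K / (1 + s ^ 2).
Proof.
  intros Hc. set (q := INR (S p)). assert (Hq : 0 < q) by apply lt_0_INR, Nat.lt_0_succ.
  set (A := 1 + q / c). assert (HA : 0 < q / c) by now apply Rdiv_lt_0_compat.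
  assert (HA1 : 1 < A) by (unfold A; lra).
  exists (A ^ S p). split; [apply pow_lt; lra|]. intros s.
  assert (Hs := pow2_ge_0 s). set (y := s ^ 2) in *.
  assert (Hsy : Rabs s <= 1 + y).
  { assert (E := pow2_abs s). fold y in E. assert (Z := Rabs_pos s). nra. }
  apply Rmult_le_reg_r with (1 + y); [lra|].
  unfold Rdiv at 1. rewrite Rmult_assoc, (Rmult_assoc _ (/ (1 + y))), Rinv_l by lra. rewrite Rmult_1_r.
  assert (H1 : 1 + y <= A * (1 + c * y / q)).
  { unfold A. replace ((1 + q / c) * (1 + c * y / q)) with (1 + y + (q / c + c * y / q)) by (field; lra).
    assert (0 <= c * y / q). { apply Rmult_le_pos; [nra|]. left; now apply Rinv_0_lt_compat. } lra. }
  assert (H2 : 1 + c * y / q <= exp (c * y / q)) by apply exp_ineq1_le.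
  assert (H3 : (1 + y) ^ S p <= A ^ S p * exp (c * y)).
  { replace (exp (c * y)) with (exp (c * y / q) ^ S p).
    - rewrite <- Rpow_mult_distr. apply pow_incr. split; [lra|]. apply Rle_trans with (1 := H1).
      apply Rmult_le_compat_l; lra.
    - rewrite exp_pow. f_equal. fold q. field. lra. }
  assert (H4 : Rabs s ^ p <= (1 + y) ^ p). { apply pow_incr. split; [apply Rabs_pos|easy]. }
  assert (H5 : exp (- (c * y)) * exp (c * y) = 1).
  { rewrite <- exp_plus, Rplus_opp_l. apply exp_0. }
  assert (H6 := exp_pos (- (c * y))).
  apply Rle_trans with ((1 + y) ^ p * (exp (- (c * y)) * (1 + y))).
  - apply Rmult_le_compat_r; [nra|easy].
  - replace ((1 + y) ^ p * (exp (- (c * y)) * (1 + y))) with ((1 + y) ^ S p * exp (- (c * y))) by (cbn [pow]; ring).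
    apply Rle_trans with (A ^ S p * exp (c * y) * exp (- (c * y))).
    apply Rmult_le_compat_r; lra. right. rewrite Rmult_assoc, (Rmult_comm (exp (c * y))), H5. ring.
Qed.

Lemma Cpow_sub_le (z w : C) (p d : R) (j : nat) : Cmod z <= p -> Cmod w <= p ->
  Cmod (z - w) <= p * d -> Cmod (z ^ j - w ^ j) <= INR j * d * p ^ j.
Proof.
  intros Hz Hw Hd. assert (Hp : 0 <= p) by (apply Rle_trans with (2 := Hz), Cmod_ge_0).
  induction j as [|j IH].
  - cbn [Cpow]. replace (1 - 1)%C with (RtoC 0) by ring. rewrite Cmod_0. cbn. lra.
  - cbn [Cpow]. replace (z * z ^ j - w * w ^ j)%C with ((z - w) * z ^ j + w * (z ^ j - w ^ j))%C by ring.
    eapply Rle_trans; [apply Cmod_triangle|]. rewrite !Cmod_mult, Cmod_pow, S_INR. cbn [pow].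
    replace ((INR j + 1) * d * (p * p ^ j)) with (p * d * p ^ j + p * (INR j * d * p ^ j)) by ring.
    apply Rplus_le_compat; apply Rmult_le_compat; try apply Cmod_ge_0; try easy.
    apply pow_le, Cmod_ge_0. apply pow_incr. split; [apply Cmod_ge_0|easy].
Qed.

Lemma Cmod_one_sub_cis (x : R) : Cmod (1 - cis (- x)) <= Rabs x.
Proof.
  replace (1 - cis (- x))%C with (- (cis (- x) - 1))%C by ring.
  rewrite Cmod_opp, <- (Rabs_Ropp x). apply Cmod_cis_sub_1.
Qed.

Lemma one_sub_cis_taylor (x : R) : Cmod (1 - cis (- x) - Ci * x) <= Rabs x * (3 * Rabs x).
Proof.
  replace (1 - cis (- x) - Ci * x)%C with ((1 - cos x)%R, (sin x - x)%R).
  2: { unfold cis. rewrite cos_neg, sin_neg. apply injective_projections; cbn; ring. }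
  eapply Rle_trans; [apply Cmod_le_Rabs_plus|]. cbn [fst snd].
  assert (E := one_sub_cos x). assert (H := Rabs_sin_le (x / 2)).
  assert (Ea : Rabs (x / 2) = Rabs x / 2).
  { unfold Rdiv. rewrite Rabs_mult. f_equal. apply Rabs_pos_eq; lra. }
  rewrite Ea in H. assert (Es := pow2_abs (sin (x / 2))). assert (Hq := Rabs_pos (sin (x / 2))).
  assert (Hp := Rabs_pos x).
  assert (H1 : Rabs (1 - cos x) <= Rabs x ^ 2 / 2).
  { rewrite Rabs_pos_eq; [|assert (Z := COS_bound x); lra]. nra. }
  assert (H2 : Rabs (sin x - x) <= 2 * Rabs x ^ 2).
  { destruct (Rle_lt_dec (Rabs x) 1) as [H3|H3].
    - apply Rle_trans with (1 := Rabs_sin_sub_le x). nra.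
    - assert (H4 := Rabs_triang (sin x) (- x)). rewrite Rabs_Ropp in H4.
      assert (H5 := Rabs_sin_le x). unfold Rminus. nra. }
  nra.
Qed.

(* [tau^2] is the [t] of the introduction; with [tau] as the parameter, [sigma] is of order [tau^(-3)]
   and no fractional powers occur. *)
Record saddle (c : nat -> nat) (B M n : nat) (tau : R) : Prop := Saddle {
  sd_mult_ge : forall m, (1 <= m)%nat -> (1 <= c m)%nat;
  sd_mult_le : forall m, (c m <= B)%nat;
  sd_pos : 0 < tau;
  sd_small : tau ^ 2 <= / 8;
  sd_M : 1 <= INR M * tau ^ 2;
  sd_mean : INR n = sumL (mom (exp (- tau ^ 2)) 1) (parts c M) }.

Definition variance (c : nat -> nat) (M : nat) (tau : R) : R :=
  sumL (mom (exp (- tau ^ 2)) 2) (parts c M).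

Lemma var_bounds c B M n tau : saddle c B M n tau ->
  / (6 * tau ^ 6) <= variance c M tau <= INR B * 64 / tau ^ 6.
Proof.
  intros [H1 H2 H3 H4 H5 H6]. assert (0 < tau ^ 2) by now apply pow_lt. split.
  - assert (G := sum_mom2_ge c M (tau ^ 2) H1 ltac:(lra) H5).
    replace ((tau ^ 2) ^ 3) with (tau ^ 6) in G by ring. exact G.
  - assert (G := sum_mom_le c B M 2 (tau ^ 2) H2 ltac:(lra) ltac:(lia)).
    apply Rle_trans with (1 := G). right. field. lra.
Qed.

Definition gauss (S2 x : R) : R := exp (- (S2 * x ^ 2 / 2)).

Lemma shifted_cf_pow_gauss_le (r : R) (L : list nat) (n j : nat) (S2 x : R) :
  Rabs (Re (shifted_cf r L n x * (1 - cis (- x)) ^ j) - Re ((Ci * x) ^ j) * gauss S2 x) <=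
  Cmod (shifted_cf r L n x - RtoC (gauss S2 x)) * Rabs x ^ j
  + gauss S2 x * (INR j * (3 * Rabs x) * Rabs x ^ j).
Proof.
  set (Z := (1 - cis (- x))%C). set (W := (Ci * x)%C). set (P := shifted_cf r L n x). set (G := gauss S2 x).
  assert (HG : 0 < G) by apply exp_pos.
  replace (Re (P * Z ^ j) - Re (W ^ j) * G) with (Re ((P - RtoC G) * Z ^ j + RtoC G * (Z ^ j - W ^ j))%C).
  2: { replace ((P - RtoC G) * Z ^ j + RtoC G * (Z ^ j - W ^ j))%C with (P * Z ^ j - RtoC G * W ^ j)%C by ring.
       generalize (P * Z ^ j)%C (W ^ j)%C. intros u v. clearbody G.
       unfold Cminus, Cplus, Copp, Cmult, Re, RtoC. cbn [fst snd]. ring. }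
  eapply Rle_trans; [apply Rabs_Re_le_Cmod|]. eapply Rle_trans; [apply Cmod_triangle|].
  rewrite !Cmod_mult, Cmod_pow, Cmod_R, (Rabs_pos_eq G) by lra.
  apply Rplus_le_compat.
  - apply Rmult_le_compat_l; [apply Cmod_ge_0|]. apply pow_incr. split; [apply Cmod_ge_0|apply Cmod_one_sub_cis].
  - apply Rmult_le_compat_l; [lra|]. apply Cpow_sub_le. apply Cmod_one_sub_cis.
    + unfold W. rewrite Cmod_mult, Cmod_Ci, Cmod_R. lra.
    + apply one_sub_cis_taylor.
Qed.

Lemma Re_Ci_pow (x : R) (j : nat) : Re ((Ci * x) ^ j) = Re (Ci ^ j) * x ^ j.
Proof.
  rewrite Cpow_mult_l, <- RtoC_pow. unfold Cmult, Re, RtoC. cbn [fst snd]. ring.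
Qed.

Lemma Rabs_Re_Ci_pow (j : nat) : Rabs (Re (Ci ^ j)) <= 1.
Proof.
  eapply Rle_trans; [apply Rabs_Re_le_Cmod|]. rewrite Cmod_pow, Cmod_Ci, pow1. lra.
Qed.

Lemma integrand_approx (B j : nat) : exists K, 0 < K /\
  forall c M n tau, saddle c B M n tau -> forall x, Rabs x <= PI ->
  Rabs (Re (shifted_cf (exp (- tau ^ 2)) (parts c M) n x * (1 - cis (- x)) ^ j)
        - Re ((Ci * x) ^ j) * gauss (variance c M tau) x)
  <= K * tau ^ (3 * j + 1) / (1 + (x / tau ^ 3) ^ 2).
Proof.
  (* In the scale [x = tau^3 s] each error must be [tau] times the natural size [tau^(3j)]. The
     power [j + 3] serves the Gaussian comparison, [j + 1] the replacement of [1 - cis (- x)] by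
     [i x] as well as the Gaussian tail. The power [3j + 7] bounds [exp (- / (36 tau^2))]; six of
     its factors [tau] pay for [1 + s^2 <= 17 / tau^6], valid since [|x| <= 4]. *)
  destruct (pow_exp_le (j + 3) (/ 432) ltac:(lra)) as [K1 [HK1 B1]].
  destruct (pow_exp_le (j + 1) (/ 432) ltac:(lra)) as [K2 [HK2 B2]].
  destruct (pow_exp_le (3 * j + 7) (/ 36) ltac:(lra)) as [K3 [HK3 B3]].
  set (A := INR B * 4608). assert (HA : 0 <= A). { assert (Z := pos_INR B). unfold A; lra. }
  assert (Hj := pos_INR j). assert (H4j : 0 < 4 ^ j) by (apply pow_lt; lra).
  exists (A * K1 + 3 * INR j * K2 + 17 * 4 ^ j * K3 + K2). split; [nra|].
  intros c M n tau HS x Hx. assert (HV := var_bounds _ _ _ _ _ HS).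
  destruct HS as [H1 H2 H3 H4 H5 H6].
  assert (Ht2 : 0 < tau ^ 2) by now apply pow_lt.
  assert (Ht3 : 0 < tau ^ 3) by now apply pow_lt.
  assert (Ht4 : 0 < tau ^ 4) by now apply pow_lt.
  assert (Ht6 : 0 < tau ^ 6) by now apply pow_lt.
  assert (Ht1 : tau <= 1) by nra.
  set (V := variance c M tau) in *. set (s := x / tau ^ 3).
  assert (Ex : Rabs x = tau ^ 3 * Rabs s).
  { unfold s, Rdiv. rewrite Rabs_mult, (Rabs_pos_eq (/ tau ^ 3)). field. lra.
    left; now apply Rinv_0_lt_compat. }
  assert (Ex2 : x ^ 2 = tau ^ 6 * s ^ 2) by (unfold s; field; lra).
  clearbody s.
  assert (Ej : (tau ^ 3 * Rabs s) ^ j = tau ^ (3 * j) * Rabs s ^ j).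
  { now rewrite Rpow_mult_distr, <- pow_mult. }
  assert (Hs2 := pow2_ge_0 s). assert (Hden : 0 < / (1 + s ^ 2)) by (apply Rinv_0_lt_compat; lra).
  assert (HGle : gauss V x <= exp (- (/ 432 * s ^ 2))).
  { apply exp_le. assert (Z : / (6 * tau ^ 6) * x ^ 2 <= V * x ^ 2).
    { apply Rmult_le_compat_r; [apply pow2_ge_0|easy]. }
    rewrite Ex2 in *. replace (/ (6 * tau ^ 6) * (tau ^ 6 * s ^ 2)) with (s ^ 2 / 6) in Z by (field; lra). lra. }
  assert (Htj : 0 < tau ^ (3 * j + 1)) by now apply pow_lt.
  assert (HB2 : 0 <= K2 / (1 + s ^ 2)) by (apply Rmult_le_pos; lra).
  assert (HB1 : 0 <= K1 / (1 + s ^ 2)) by (apply Rmult_le_pos; lra).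
  specialize (B1 s). specialize (B2 s). specialize (B3 (/ tau)).
  set (D := / (1 + s ^ 2)) in *.
  destruct (Rle_lt_dec (Rabs x) (6 * tau ^ 2)) as [Hmid|Htail].
  - eapply Rle_trans; [apply shifted_cf_pow_gauss_le|].
    assert (HP := shifted_cf_gauss c B M n (tau ^ 2) x H1 H2 ltac:(lra) H5 H6 Hmid).
    fold (variance c M tau) in HP. fold V in HP. fold (gauss V x) in HP.
    assert (Hxj : 0 <= Rabs x ^ j) by apply pow_le, Rabs_pos.
    replace (exp (- (x ^ 2 / (432 * (tau ^ 2) ^ 3)))) with (exp (- (/ 432 * s ^ 2))) in HP.
    2: { f_equal. f_equal. rewrite Ex2. field. lra. }
    apply Rle_trans with (A * (tau ^ (3 * j + 1) * (K1 * D)) + 3 * INR j * (tau ^ (3 * j + 1) * (K2 * D))).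
    + apply Rplus_le_compat.
      * eapply Rle_trans; [apply Rmult_le_compat_r; [easy|apply HP]|].
        fold A. rewrite Ex.
        replace (A / (tau ^ 2) ^ 4 * (tau ^ 3 * Rabs s) ^ 3 * exp (- (/ 432 * s ^ 2)) * (tau ^ 3 * Rabs s) ^ j)
          with (A * (tau ^ (3 * j + 1) * (Rabs s ^ (j + 3) * exp (- (/ 432 * s ^ 2))))).
        -- apply Rmult_le_compat_l; [easy|]. apply Rmult_le_compat_l; [lra|]. exact B1.
        -- rewrite Ej, !pow_add. field. lra.
      * apply Rle_trans with (exp (- (/ 432 * s ^ 2)) * (INR j * (3 * Rabs x) * Rabs x ^ j)).
        -- apply Rmult_le_compat_r; [|easy]. apply Rmult_le_pos; [|easy].
           assert (Z := Rabs_pos x). nra.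
        -- rewrite Ex. replace (exp (- (/ 432 * s ^ 2)) * (INR j * (3 * (tau ^ 3 * Rabs s)) * (tau ^ 3 * Rabs s) ^ j))
           with (3 * INR j * (tau ^ (3 * j + 1) * (tau ^ 2 * (Rabs s ^ (j + 1) * exp (- (/ 432 * s ^ 2)))))).
           ++ apply Rmult_le_compat_l; [nra|]. apply Rmult_le_compat_l; [lra|].
              rewrite <- (Rmult_1_l (K2 * D)). apply Rmult_le_compat; [lra| |nra|exact B2].
              apply Rmult_le_pos; [apply pow_le, Rabs_pos|left; apply exp_pos].
           ++ rewrite Ej, !pow_add. ring.
    + unfold Rdiv. fold D. assert (0 <= tau ^ (3 * j + 1) * D) by nra.
      assert (0 <= 17 * 4 ^ j * K3 + K2) by nra.
      replace ((A * K1 + 3 * INR j * K2 + 17 * 4 ^ j * K3 + K2) * tau ^ (3 * j + 1) * D) with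
        (A * (tau ^ (3 * j + 1) * (K1 * D)) + 3 * INR j * (tau ^ (3 * j + 1) * (K2 * D)) +
         (17 * 4 ^ j * K3 + K2) * (tau ^ (3 * j + 1) * D)) by ring.
      nra.
  - assert (HP := shifted_cf_tail c M n (tau ^ 2) x H1 ltac:(lra) H5 ltac:(lra)).
    assert (HPI := PI_4).
    assert (T1 : Rabs (Re (shifted_cf (exp (- tau ^ 2)) (parts c M) n x * (1 - cis (- x)) ^ j)) <=
                 17 * 4 ^ j * K3 * tau ^ (3 * j + 1) * D).
    { eapply Rle_trans; [apply Rabs_Re_le_Cmod|]. rewrite Cmod_mult, Cmod_pow.
      assert (Z1 : Cmod (1 - cis (- x)) ^ j <= 4 ^ j).
      { apply pow_incr. split; [apply Cmod_ge_0|]. assert (Z := Cmod_one_sub_cis x). lra. }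
      assert (Z2 : exp (- / (36 * tau ^ 2)) <= K3 * tau ^ (3 * j + 7)).
      { replace (- / (36 * tau ^ 2)) with (- (/ 36 * (/ tau) ^ 2)) by (field; lra).
        assert (Hti : 0 < / tau) by now apply Rinv_0_lt_compat.
        rewrite (Rabs_pos_eq (/ tau)) in B3 by lra.
        assert (Z3 : K3 / (1 + (/ tau) ^ 2) <= K3).
        { assert (0 <= (/ tau) ^ 2) by apply pow2_ge_0.
          apply Rmult_le_reg_r with (1 + (/ tau) ^ 2); [lra|]. unfold Rdiv. rewrite Rmult_assoc, Rinv_l by lra. nra. }
        apply Rmult_le_reg_l with ((/ tau) ^ (3 * j + 7)); [now apply pow_lt|].
        apply Rle_trans with (1 := B3). apply Rle_trans with (1 := Z3).
        right. rewrite pow_inv. field. apply pow_nonzero; lra. }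
      assert (Z3 : 1 <= 17 / tau ^ 6 * D).
      { unfold D. assert (Z : s ^ 2 <= 16 / tau ^ 6).
        { apply Rmult_le_reg_l with (tau ^ 6); [easy|]. rewrite <- Ex2. rewrite <- (pow2_abs x).
          replace (tau ^ 6 * (16 / tau ^ 6)) with 16 by (field; lra). assert (Z := Rabs_pos x). nra. }
        assert (Z' : 1 <= / tau ^ 6).
        { rewrite <- Rinv_1. apply Rinv_le_contravar; [easy|]. rewrite <- (pow1 6). apply pow_incr. lra. }
        apply Rmult_le_reg_r with (1 + s ^ 2); [lra|]. rewrite Rmult_assoc, Rinv_l by lra.
        unfold Rdiv in *. lra. }
      apply Rle_trans with (K3 * tau ^ (3 * j + 7) * 4 ^ j).
      - apply Rmult_le_compat; try apply Cmod_ge_0; [apply pow_le, Cmod_ge_0| |easy].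
        apply Rle_trans with (2 := Z2). exact HP.
      - apply Rle_trans with (K3 * tau ^ (3 * j + 7) * 4 ^ j * (17 / tau ^ 6 * D)).
        + rewrite <- (Rmult_1_r (_ * 4 ^ j)) at 1. apply Rmult_le_compat_l; [|easy].
          apply Rmult_le_pos; [|lra]. apply Rmult_le_pos; [lra|]. apply pow_le; lra.
        + right. replace (3 * j + 7)%nat with (3 * j + 1 + 6)%nat by lia. rewrite (pow_add tau (3 * j + 1) 6). field. lra. }
    assert (T2 : Rabs (Re ((Ci * x) ^ j) * gauss V x) <= K2 * tau ^ (3 * j + 1) * D).
    { rewrite Re_Ci_pow, !Rabs_mult, (Rabs_pos_eq (gauss V x)) by (left; apply exp_pos).
      rewrite <- RPow_abs.
      assert (Hxj : 0 <= Rabs x ^ j) by apply pow_le, Rabs_pos.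
      assert (Z := Rabs_Re_Ci_pow j). assert (Z0 := Rabs_pos (Re (Ci ^ j))).
      apply Rle_trans with (1 * Rabs x ^ j * exp (- (/ 432 * s ^ 2))).
      { apply Rmult_le_compat; [nra|left; apply exp_pos| |easy]. now apply Rmult_le_compat_r. }
      (* Outside the central range [tau |s| = |x| / tau^2 > 1], so inserting this factor is free and
         provides the extra [tau]. *)
      rewrite Ex in *. assert (Hts : 1 <= tau * Rabs s).
      { apply Rmult_le_reg_l with (tau ^ 2); [easy|]. 
        replace (tau ^ 2 * (tau * Rabs s)) with (tau ^ 3 * Rabs s) by ring. lra. }
      apply Rle_trans with ((tau * Rabs s) * (tau ^ 3 * Rabs s) ^ j * exp (- (/ 432 * s ^ 2))).
      - apply Rmult_le_compat_r; [left; apply exp_pos|]. now apply Rmult_le_compat_r.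
      - replace (tau * Rabs s * (tau ^ 3 * Rabs s) ^ j * exp (- (/ 432 * s ^ 2))) with
          (tau ^ (3 * j + 1) * (Rabs s ^ (j + 1) * exp (- (/ 432 * s ^ 2)))).
        + rewrite (Rmult_comm K2), Rmult_assoc. apply Rmult_le_compat_l; [lra|exact B2].
        + rewrite Ej, !pow_add. ring. }
    unfold Rminus. eapply Rle_trans; [apply Rabs_triang|]. rewrite Rabs_Ropp.
    unfold Rdiv. fold D.
    assert (0 <= tau ^ (3 * j + 1) * D) by nra. assert (0 <= A * K1 + 3 * INR j * K2) by nra.
    replace ((A * K1 + 3 * INR j * K2 + 17 * 4 ^ j * K3 + K2) * tau ^ (3 * j + 1) * D) with
      ((A * K1 + 3 * INR j * K2) * (tau ^ (3 * j + 1) * D) + 17 * 4 ^ j * K3 * tau ^ (3 * j + 1) * D + K2 * tau ^ (3 * j + 1) * D) by ring.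
    nra.
Qed.

(** * Gaussian moments and scaled differences *)

Definition gmoment (V : R) (j : nat) : R := RInt (fun x => x ^ j * gauss V x) (- PI) PI.

Lemma continuous_gauss (V : R) (j : nat) (x : R) : continuous (fun x => x ^ j * gauss V x) x.
Proof.
  apply (ex_derive_continuous (K := R_AbsRing) (V := R_NormedModule)). unfold gauss. auto_derive. easy.
Qed.

Lemma ex_RInt_gauss (V : R) (j : nat) (a b : R) : ex_RInt (fun x => x ^ j * gauss V x) a b.
Proof. apply (ex_RInt_continuous (V := R_CompleteNormedModule)). intros z _. apply continuous_gauss. Qed.

Lemma RInt_cauchy_le (K a : R) : 0 <= K -> 0 < a ->
  ex_RInt (fun x => K / (1 + (x / a) ^ 2)) (- PI) PI /\
  RInt (fun x => K / (1 + (x / a) ^ 2)) (- PI) PI <= 4 * K * a.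
Proof.
  intros HK Ha. assert (HI : is_RInt (fun x => K / (1 + (x / a) ^ 2)) (- PI) PI
    (minus (K * a * atan (PI / a)) (K * a * atan (- PI / a)))).
  { apply (is_RInt_derive (V := R_CompleteNormedModule) (fun x => K * a * atan (x / a))).
    - intros x _. auto_derive; [easy|]. assert (Z := pow2_ge_0 (x / a)). field.
      split; [lra|]. assert (0 < a ^ 2) by nra. assert (Z' := pow2_ge_0 x). nra.
    - intros x _. apply (ex_derive_continuous (K := R_AbsRing) (V := R_NormedModule)). auto_derive.
      repeat split; try easy. assert (Z := pow2_ge_0 (x / a)). unfold Rdiv in Z. cbn [pow] in Z. lra. }
  split; [eexists; apply HI|].
  rewrite (is_RInt_unique _ _ _ _ HI). unfold minus, plus, opp; cbn.
  assert (B1 := atan_bound (PI / a)). assert (B2 := atan_bound (- PI / a)). assert (HP := PI_4).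
  assert (0 <= K * a) by nra. nra.
Qed.

Lemma ex_RInt_shifted_cf_pow (r : R) (L : list nat) (n j : nat) (a b : R) : 0 < r < 1 -> all_pos L ->
  ex_RInt (fun x => Re (shifted_cf r L n x * (1 - cis (- x)) ^ j)%C) a b.
Proof.
  intros Hr HL. apply (Ccont_ex_RInt (fun x => shifted_cf r L n x * (1 - cis (- x)) ^ j)%C).
  apply Ccont_mult.
  - apply (Ccont_mult (parts_cf r L) (fun x => cis (- INR n * x))). now apply Ccont_parts_cf. apply Ccont_cis.
  - apply (Ccont_pow (fun x => 1 - cis (- x))%C). apply Ccont_minus; [apply Ccont_const|].
    intros x. generalize (Ccont_cis (-1) x).
    intros [H1 H2]. split.
    + eapply continuous_ext; [|exact H1]. intros y; cbn. f_equal. ring.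
    + eapply continuous_ext; [|exact H2]. intros y; cbn. f_equal. ring.
Qed.

Lemma integral_approx (B j : nat) : exists K, 0 < K /\
  forall c M n tau, saddle c B M n tau ->
  Rabs (RInt (fun x => Re (shifted_cf (exp (- tau ^ 2)) (parts c M) n x * (1 - cis (- x)) ^ j)%C) (- PI) PI
        - Re (Ci ^ j) * gmoment (variance c M tau) j) <= K * tau ^ (3 * j + 4).
Proof.
  destruct (integrand_approx B j) as [K [HK H]]. exists (4 * K). split; [lra|].
  intros c M n tau HS. specialize (H c M n tau HS).
  assert (Ht := sd_pos _ _ _ _ _ HS). assert (HP := PI_RGT_0).
  set (V := variance c M tau) in *. set (r := exp (- tau ^ 2)) in *.
  assert (Hr : 0 < r < 1) by (apply exp_neg_lt_1, pow_lt, Ht).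
  set (F := fun x => Re (shifted_cf r (parts c M) n x * (1 - cis (- x)) ^ j)%C).
  assert (HF : ex_RInt F (- PI) PI) by (apply ex_RInt_shifted_cf_pow; [easy|apply parts_pos]).
  set (G := fun x => scal (Re (Ci ^ j)) (x ^ j * gauss V x)).
  assert (HG : ex_RInt G (- PI) PI) by (apply (ex_RInt_scal (V := R_CompleteNormedModule)), ex_RInt_gauss).
  assert (EG : Re (Ci ^ j) * gmoment V j = RInt G (- PI) PI).
  { unfold G. rewrite (RInt_scal (V := R_CompleteNormedModule)) by apply ex_RInt_gauss. easy. }
  rewrite EG. change (RInt F (- PI) PI - RInt G (- PI) PI) with (minus (RInt F (- PI) PI) (RInt G (- PI) PI)).
  rewrite <- (RInt_minus (V := R_CompleteNormedModule)) by easy.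
  assert (Ht3 : 0 < tau ^ 3) by now apply pow_lt.
  assert (Htj : 0 < tau ^ (3 * j + 1)) by now apply pow_lt.
  destruct (RInt_cauchy_le (K * tau ^ (3 * j + 1)) (tau ^ 3)) as [C1 C2]; [nra|easy|].
  assert (HFG : ex_RInt (fun x => minus (F x) (G x)) (- PI) PI) by now apply (ex_RInt_minus (V := R_CompleteNormedModule)).
  eapply Rle_trans; [apply abs_RInt_le; [lra|easy]|].
  eapply Rle_trans.
  { apply RInt_le; [lra| |exact C1|]. now apply ex_RInt_norm in HFG.
    intros x Hx. specialize (H x ltac:(apply Rabs_le; lra)).
    unfold F, G, minus, plus, opp, scal; cbn -[Re Cpow Cmult pow]. unfold mult; cbn -[Re Cpow Cmult pow].
    rewrite Re_Ci_pow, Rmult_assoc in H. exact H. }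
  apply Rle_trans with (1 := C2). right.
  replace (3 * j + 4)%nat with (3 * j + 1 + 3)%nat by lia. rewrite (pow_add tau (3 * j + 1) 3). ring.
Qed.

(** Integration by parts of [x^(j+1)] against the Gaussian. The interval is finite, so boundary
    terms remain; they are exponentially small and are absorbed in [gmoment_limit]. *)
Lemma gmoment_rec (V : R) (j : nat) :
  V * gmoment V (S (S j)) = INR (S j) * gmoment V j
    - (PI ^ S j * gauss V PI - (- PI) ^ S j * gauss V PI).
Proof.
  assert (HI : is_RInt (fun x => INR (S j) * (x ^ j * gauss V x) - V * (x ^ S (S j) * gauss V x)) (- PI) PI
    (minus (PI ^ S j * gauss V PI) ((- PI) ^ S j * gauss V (- PI)))).
  { apply (is_RInt_derive (V := R_CompleteNormedModule) (fun x => x ^ S j * gauss V x)).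
    - intros x _. unfold gauss. auto_derive; [easy|]. change (match j with O => 1 | S _ => INR j + 1 end) with (INR (S j)).
      replace (- (V * (x * (x * 1)) * / 2)) with (- (V * x ^ 2 / 2)) by field.
      cbn [pow]. field.
    - intros x _. apply (ex_derive_continuous (K := R_AbsRing) (V := R_NormedModule)).
      unfold gauss. auto_derive. easy. }
  apply (is_RInt_unique (V := R_CompleteNormedModule)) in HI. unfold gmoment.
  assert (E : RInt (fun x => INR (S j) * (x ^ j * gauss V x) - V * (x ^ S (S j) * gauss V x)) (- PI) PI =
    INR (S j) * RInt (fun x => x ^ j * gauss V x) (- PI) PI - V * RInt (fun x => x ^ S (S j) * gauss V x) (- PI) PI).
  { transitivity (minus (scal (INR (S j)) (RInt (fun x => x ^ j * gauss V x) (- PI) PI))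
       (scal V (RInt (fun x => x ^ S (S j) * gauss V x) (- PI) PI))); [|easy].
    rewrite <- !(RInt_scal (V := R_CompleteNormedModule)) by apply ex_RInt_gauss.
    rewrite <- (RInt_minus (V := R_CompleteNormedModule)). easy.
    all: apply (ex_RInt_scal (V := R_CompleteNormedModule)), ex_RInt_gauss. }
  assert (EV : gauss V (- PI) = gauss V PI) by (unfold gauss; now replace ((- PI) ^ 2) with (PI ^ 2) by ring).
  rewrite E, EV in HI. change (minus ?a ?b) with (a - b) in HI. lra.
Qed.

(* [hnum j] is the [j]-th derivative at 0 of [exp (- x^2 / 2)]. *)
Fixpoint hnum (j : nat) : R :=
  match j with O => 1 | S O => 0 | S (S i) => - INR (S i) * hnum i end.

Lemma nat_ind2 (P : nat -> Prop) :
  P 0%nat -> P 1%nat -> (forall j, P j -> P (S (S j))) -> forall j, P j.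
Proof.
  intros H0 H1 HS j. assert (P j /\ P (S j)) as [? _]; [|easy]. induction j; [easy|]. split; [easy|].
  now apply HS.
Qed.

(** After scaling, [gmoment_rec] becomes the recursion of [hnum] up to boundary terms at
    [X = s * PI], which is at least [tau^(-3)]. The zeroth moment stays as an unevaluated unit; odd
    orders vanish already through [Re (Ci ^ j)]. *)
Lemma gmoment_limit (B j : nat) : exists K, 0 < K /\
  forall c M n tau, saddle c B M n tau ->
  let s := sqrt (variance c M tau) in
  Rabs (s ^ S j * (Re (Ci ^ j) * gmoment (s ^ 2) j) - hnum j * (s * gmoment (s ^ 2) 0)) <= K * tau.
Proof.
  induction j as [| |j IH] using nat_ind2.
  - exists 1. split; [lra|]. intros c M n tau HS s. assert (Ht := sd_pos _ _ _ _ _ HS).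
    replace (s ^ 1 * (Re (Ci ^ 0) * gmoment (s ^ 2) 0) - hnum 0 * (s * gmoment (s ^ 2) 0)) with 0.
    rewrite Rabs_R0. lra. cbn. ring.
  - exists 1. split; [lra|]. intros c M n tau HS s. assert (Ht := sd_pos _ _ _ _ _ HS).
    replace (s ^ 2 * (Re (Ci ^ 1) * gmoment (s ^ 2) 1) - hnum 1 * (s * gmoment (s ^ 2) 0)) with 0.
    rewrite Rabs_R0. lra. cbn. ring.
  - destruct IH as [K [HK IH]].
    destruct (pow_exp_le (j + 2) (/ 2) ltac:(lra)) as [K1 [HK1 B1]].
    assert (HJ := pos_INR (S j)).
    exists (INR (S j) * K + 2 * K1). split; [nra|].
    intros c M n tau HS s. specialize (IH c M n tau HS). fold s in IH. cbv zeta in IH.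
    assert (HV := var_bounds _ _ _ _ _ HS). assert (Ht := sd_pos _ _ _ _ _ HS).
    assert (Hs := sd_small _ _ _ _ _ HS).
    assert (Ht3 : 0 < tau ^ 3) by now apply pow_lt.
    assert (Ht6 : 0 < tau ^ 6) by now apply pow_lt.
    assert (Hi6 : 0 < / (6 * tau ^ 6)) by (apply Rinv_0_lt_compat; lra).
    assert (Hs0 : 0 <= s) by apply sqrt_pos.
    assert (Es : s ^ 2 = variance c M tau) by (apply pow2_sqrt; lra).
    set (X := s * PI). assert (HX : / tau ^ 3 <= X).
    { assert (HP := PI2_3_2). assert (Z : (/ tau ^ 3) ^ 2 <= X ^ 2).
      { unfold X. rewrite Rpow_mult_distr, Es.
        replace ((/ tau ^ 3) ^ 2) with (/ (6 * tau ^ 6) * 6) by (field; lra).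
        apply Rmult_le_compat; [lra|lra|easy|nra]. }
      assert (0 <= X). { unfold X. apply Rmult_le_pos; lra. }
      assert (0 < / tau ^ 3) by now apply Rinv_0_lt_compat. nra. }
    assert (Ht1 : tau <= 1) by nra.
    assert (Hti : 1 <= / tau ^ 3).
    { rewrite <- Rinv_1. apply Rinv_le_contravar; [easy|]. rewrite <- (pow1 3). apply pow_incr. lra. }
    assert (Egauss : gauss (s ^ 2) PI = exp (- (/ 2 * X ^ 2))).
    { unfold gauss, X. f_equal. field. }
    assert (HB : X ^ S j * gauss (s ^ 2) PI <= K1 * tau).
    { specialize (B1 X). rewrite (Rabs_pos_eq X) in B1 by lra. rewrite Egauss.
      set (G := exp (- (/ 2 * X ^ 2))) in *. assert (HG : 0 < G) by apply exp_pos.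
      assert (H2 : K1 / (1 + X ^ 2) <= K1).
      { apply Rmult_le_reg_r with (1 + X ^ 2); [nra|]. unfold Rdiv. rewrite Rmult_assoc, Rinv_l by nra. nra. }
      assert (H3 : X * (X ^ S j * G) <= K1).
      { apply Rle_trans with (2 := H2). apply Rle_trans with (2 := B1). right.
        replace (j + 2)%nat with (S (S j)) by lia. cbn [pow]. ring. }
      assert (H4 : 0 <= X ^ S j * G). { apply Rmult_le_pos; [|lra]. apply pow_le; lra. }
      assert (H5 : / tau <= X).
      { apply Rle_trans with (2 := HX). apply Rinv_le_contravar; [easy|].
        assert (tau * tau ^ 2 <= tau * 1) by (apply Rmult_le_compat_l; lra). cbn in *. lra. }
      apply Rmult_le_reg_l with (/ tau); [now apply Rinv_0_lt_compat|].
      replace (/ tau * (K1 * tau)) with K1 by (field; lra).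
      apply Rle_trans with (2 := H3). now apply Rmult_le_compat_r. }
    assert (Rec := gmoment_rec (s ^ 2) j).
    set (b := PI ^ S j * gauss (s ^ 2) PI - (- PI) ^ S j * gauss (s ^ 2) PI) in *.
    assert (Hb : Rabs (s ^ S j * b) <= 2 * (K1 * tau)).
    { assert (HPI := PI_RGT_0). assert (HG : 0 < gauss (s ^ 2) PI) by apply exp_pos.
      replace (s ^ S j * b) with (X ^ S j * gauss (s ^ 2) PI - (- X) ^ S j * gauss (s ^ 2) PI).
      - unfold Rminus. eapply Rle_trans; [apply Rabs_triang|].
        rewrite Rabs_Ropp, !Rabs_mult, <- !RPow_abs, Rabs_Ropp, (Rabs_pos_eq X), (Rabs_pos_eq (gauss _ _)) by lra.
        lra.
      - unfold b, X. replace (- (s * PI)) with (s * - PI) by ring. rewrite !Rpow_mult_distr. ring. }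
    (* The sign in the recursion of [hnum] comes from [i^2 = -1]; the Gaussian moments themselves
       have none. *)
    replace (Re (Ci ^ S (S j))) with (- Re (Ci ^ j)).
    2: { unfold Re. cbn [Cpow]. unfold Cmult, Ci. cbn [fst snd]. ring. }
    change (hnum (S (S j))) with (- INR (S j) * hnum j).
    set (d := Re (Ci ^ j)) in *. assert (Hd : Rabs d <= 1) by apply Rabs_Re_Ci_pow.
    replace (s ^ S (S (S j)) * (- d * gmoment (s ^ 2) (S (S j))) - - INR (S j) * hnum j * (s * gmoment (s ^ 2) 0))
      with (- INR (S j) * (s ^ S j * (d * gmoment (s ^ 2) j) - hnum j * (s * gmoment (s ^ 2) 0)) + d * (s ^ S j * b)).
    2: { replace (s ^ S (S (S j)) * (- d * gmoment (s ^ 2) (S (S j)))) with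
           (- d * s ^ S j * (s ^ 2 * gmoment (s ^ 2) (S (S j)))) by (cbn [pow]; ring).
         rewrite Rec. ring. }
    eapply Rle_trans; [apply Rabs_triang|]. rewrite !Rabs_mult, Rabs_Ropp, (Rabs_pos_eq (INR _)) by easy.
    rewrite <- Rabs_mult. assert (Z := Rabs_pos (s ^ S j * b)). assert (Z' := Rabs_pos d). nra.
Qed.

(** On [|x| <= 1 / s] the density factor is at least 1/2. This allows division by the zeroth moment
    without its exact value. *)
Lemma gmoment0_ge (s : R) : 1 <= s -> / 2 <= s * gmoment (s ^ 2) 0.
Proof.
  intros Hs. assert (HP := PI2_3_2). set (f := fun x => x ^ 0 * gauss (s ^ 2) x).
  assert (Hi : / s <= 1). { rewrite <- Rinv_1. apply Rinv_le_contravar; lra. }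
  assert (Hi0 : 0 < / s) by (apply Rinv_0_lt_compat; lra).
  assert (Hf : forall a b, ex_RInt f a b) by (intros; apply ex_RInt_gauss).
  assert (Hf0 : forall x, 0 <= f x). { intros x. unfold f, gauss. cbn -[pow]. rewrite pow_O, Rmult_1_l. left; apply exp_pos. }
  assert (E : gmoment (s ^ 2) 0 = RInt f (- PI) (- / s) + (RInt f (- / s) (/ s) + RInt f (/ s) PI)).
  { unfold gmoment. fold f. 
    change (RInt f (- PI) (- / s) + (RInt f (- / s) (/ s) + RInt f (/ s) PI)) with
      (plus (RInt f (- PI) (- / s)) (plus (RInt f (- / s) (/ s)) (RInt f (/ s) PI))).
    rewrite !(RInt_Chasles (V := R_CompleteNormedModule)) by easy. easy. }
  rewrite E. assert (H1 := RInt_ge_0 f (- PI) (- / s) ltac:(lra) (Hf _ _) (fun x _ => Hf0 x)).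
  assert (H2 := RInt_ge_0 f (/ s) PI ltac:(lra) (Hf _ _) (fun x _ => Hf0 x)).
  assert (H3 : RInt (fun _ => / 2 / 2) (- / s) (/ s) <= RInt f (- / s) (/ s)).
  { apply RInt_le; [lra|apply ex_RInt_const|apply Hf|]. intros x Hx. unfold f. rewrite pow_O, Rmult_1_l. unfold gauss.
    assert (Z : s ^ 2 * x ^ 2 <= 1).
    { rewrite <- Rpow_mult_distr. assert (Z1 : Rabs (s * x) <= 1).
      { rewrite Rabs_mult, (Rabs_pos_eq s) by lra. assert (Z2 : Rabs x <= / s) by (apply Rabs_le; lra).
        apply Rmult_le_reg_l with (/ s); [easy|]. rewrite <- Rmult_assoc, Rinv_l by lra. lra. }
      rewrite <- (pow2_abs (s * x)). assert (Z3 := Rabs_pos (s * x)). nra. }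
    assert (Z1 := exp_ineq1_le (- (s ^ 2 * x ^ 2 / 2))). lra. }
  rewrite RInt_const in H3. change (scal ?a ?b) with (a * b) in H3.
  assert (Ei : s * / s = 1) by (apply Rinv_r; lra).
  apply Rle_trans with (s * ((/ s - - / s) * (/ 2 / 2))); [right; nra|].
  apply Rmult_le_compat_l; lra.
Qed.

Lemma saddle_sqrt_var c B M n tau : saddle c B M n tau ->
  let s := sqrt (variance c M tau) in
  s ^ 2 = variance c M tau /\ / (3 * tau ^ 3) <= s /\ s <= 8 * (INR B + 1) / tau ^ 3.
Proof.
  intros HS s. assert (HV := var_bounds _ _ _ _ _ HS). assert (Ht := sd_pos _ _ _ _ _ HS).
  assert (Ht3 : 0 < tau ^ 3) by now apply pow_lt.
  assert (Ht6 : 0 < tau ^ 6) by now apply pow_lt.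
  assert (Hi6 : 0 < / (6 * tau ^ 6)) by (apply Rinv_0_lt_compat; lra).
  assert (Hs0 : 0 <= s) by apply sqrt_pos.
  assert (Es : s ^ 2 = variance c M tau) by (apply pow2_sqrt; lra).
  assert (Hi3 : 0 < / tau ^ 3) by now apply Rinv_0_lt_compat.
  split; [easy|]. assert (HB := pos_INR B). set (i := / tau ^ 3) in *.
  assert (Ei : / tau ^ 6 = i ^ 2) by (unfold i; field; lra).
  unfold Rdiv in *. rewrite Rinv_mult in *. rewrite Ei in HV. fold i. split.
  - assert ((/ 3 * i) ^ 2 <= s ^ 2) by (rewrite Es; nra). nra.
  - assert (s ^ 2 <= (8 * (INR B + 1) * i) ^ 2).
    { rewrite Es. apply Rle_trans with (1 := proj2 HV). rewrite Rpow_mult_distr.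
      apply Rmult_le_compat_r; nra. }
    assert (0 <= 8 * (INR B + 1) * i) by nra. nra.
Qed.

Lemma bdiff_scal (b b' : nat -> R) (k : R) (n : nat) :
  (forall i, b (n + i)%nat = k * b' i) -> forall j i, bdiff b j (n + i) = k * bdiff b' j i.
Proof.
  intros H j. induction j as [|j IH]; intros i; cbn [bdiff]; [apply H|].
  rewrite plus_n_Sm, !IH. ring.
Qed.

(** [lam] removes the normalising product and the power [r^n], and divides by the Gaussian mass, so
    that [j = 0] has limit 1. The integral error [tau^(3j+4)] meets [s^(j+1)], of order
    [tau^(-3(j+1))], and one factor [tau] survives. *)
Theorem saddle_bdiff (B j : nat) : exists K, 0 < K /\
  forall c M n tau a, saddle c B M n tau -> series_of (parts c M) a ->
  let s := sqrt (variance c M tau) in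
  let lam := s * (2 * PI * prodR (fun m => 1 - exp (- tau ^ 2) ^ m) (parts c M)) * exp (- tau ^ 2) ^ n
             / (s * gmoment (s ^ 2) 0) in
  Rabs (lam * s ^ j * bdiff (fun i => a (n + i)%nat * exp (- tau ^ 2) ^ i) j 0 - hnum j) <= K * tau.
Proof.
  destruct (integral_approx B j) as [K1 [HK1 I1]]. destruct (gmoment_limit B j) as [K2 [HK2 I2]].
  assert (HB := pos_INR B). set (A := (8 * (INR B + 1)) ^ S j). assert (HA : 0 < A) by (apply pow_lt; lra).
  exists (2 * (A * K1 + K2)). split; [nra|].
  intros c M n tau a HS Ha s lam. specialize (I1 c M n tau HS). specialize (I2 c M n tau HS).
  fold s in I2. cbv zeta in I2.
  destruct (saddle_sqrt_var _ _ _ _ _ HS) as [Es [Hs1 Hs2]]. fold s in Es, Hs1, Hs2.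
  assert (Ht := sd_pos _ _ _ _ _ HS). assert (Hsm := sd_small _ _ _ _ _ HS).
  assert (Ht3 : 0 < tau ^ 3) by now apply pow_lt.
  rewrite <- Es in I1. set (r := exp (- tau ^ 2)) in *. set (L := parts c M) in *.
  assert (Hr : 0 < r < 1) by (apply exp_neg_lt_1, pow_lt, Ht).
  assert (HF := bdiff_fourier r L a Hr (parts_pos c M) Ha j n).
  set (I := RInt (fun x => Re (shifted_cf r L n x * (1 - cis (- x)) ^ j)%C) (- PI) PI) in *.
  change (RInt _ _ _) with I in HF.
  assert (Hs0 : 1 <= s).
  { apply Rle_trans with (2 := Hs1). rewrite <- Rinv_1. apply Rinv_le_contravar; [lra|].
    assert (tau <= / 2) by nra. assert (tau ^ 3 <= / 2 * / 8). 
    { replace (tau ^ 3) with (tau * tau ^ 2) by ring. apply Rmult_le_compat; try lra. apply pow_le; lra. } lra. }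
  assert (Hg := gmoment0_ge s Hs0). set (y := s * gmoment (s ^ 2) 0) in *.
  assert (EB : bdiff (fun i => a i * r ^ i) j n = r ^ n * bdiff (fun i => a (n + i)%nat * r ^ i) j 0).
  { rewrite <- (Nat.add_0_r n) at 1. apply bdiff_scal. intros i. rewrite pow_add. ring. }
  assert (El : lam * s ^ j * bdiff (fun i => a (n + i)%nat * r ^ i) j 0 = s ^ S j * I / y).
  { unfold lam. rewrite <- HF, EB. cbn [pow]. field. lra. }
  rewrite El.
  set (g := Re (Ci ^ j) * gmoment (s ^ 2) j) in *.
  assert (T1 : Rabs (s ^ S j * (I - g)) <= A * K1 * tau).
  { rewrite Rabs_mult, (Rabs_pos_eq (s ^ S j)) by (apply pow_le; lra).
    apply Rle_trans with (A / tau ^ (3 * S j) * (K1 * tau ^ (3 * j + 4))).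
    - apply Rmult_le_compat; [apply pow_le; lra|apply Rabs_pos| |easy].
      apply Rle_trans with ((8 * (INR B + 1) / tau ^ 3) ^ S j). apply pow_incr; lra.
      right. unfold A, Rdiv. rewrite Rpow_mult_distr, pow_inv, <- pow_mult. easy.
    - right. replace (3 * j + 4)%nat with (3 * S j + 1)%nat by lia. rewrite pow_add. field. apply pow_nonzero; lra. }
  replace (s ^ S j * I / y - hnum j) with ((s ^ S j * (I - g) + (s ^ S j * g - hnum j * y)) * / y) by (field; lra).
  rewrite Rabs_mult, (Rabs_pos_eq (/ y)) by (left; apply Rinv_0_lt_compat; lra).
  assert (Hy : / y <= 2). { replace 2 with (/ / 2) by (field). apply Rinv_le_contravar; lra. }
  assert (T : Rabs (s ^ S j * (I - g) + (s ^ S j * g - hnum j * y)) <= (A * K1 + K2) * tau).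
  { eapply Rle_trans; [apply Rabs_triang|]. lra. }
  replace (2 * (A * K1 + K2) * tau) with ((A * K1 + K2) * tau * 2) by ring.
  apply Rmult_le_compat; [apply Rabs_pos| |easy|easy]. left; apply Rinv_0_lt_compat; lra.
Qed.

(** * The saddle point *)

Lemma continuity_sumL (f : nat -> R -> R) (L : list nat) (t : R) :
  (forall m, In m L -> continuity_pt (f m) t) -> continuity_pt (fun t => sumL (fun m => f m t) L) t.
Proof.
  induction L as [|m L IH]; intros H; cbn.
  - apply continuity_pt_const. now intros x y.
  - apply (continuity_pt_plus (f m) (fun t => sumL (fun m => f m t) L)). apply H; now left.
    apply IH. intros; apply H; now right.
Qed.

Lemma continuity_mean (c : nat -> nat) (M : nat) (t : R) : 0 < t ->
  continuity_pt (fun t => sumL (mom (exp (- t)) 1) (parts c M)) t.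
Proof.
  intros Ht. apply (continuity_sumL (fun m t => mom (exp (- t)) 1 m)).
  intros m Hm. assert (Hm1 := parts_pos c M m Hm).
  apply continuity_pt_filterlim, (ex_derive_continuous (K := R_AbsRing) (V := R_NormedModule)).
  unfold mom. auto_derive. assert (Z := pow_lt_1_pos (exp (- t)) m (exp_neg_lt_1 t Ht) Hm1).
  lra.
Qed.

(** At [t = 1 / M] each part [m <= M] has [m t <= 1], hence a mean of at least
    [m * (1/3) / (m t) = M / 3]. *)
Lemma mean_ge (c : nat -> nat) (M : nat) : (forall m, (1 <= m)%nat -> (1 <= c m)%nat) -> (1 <= M)%nat ->
  INR M * (INR M / 3) <= sumL (mom (exp (- / INR M)) 1) (parts c M).
Proof.
  intros Hc HM. assert (HM' : 1 <= INR M) by now apply (le_INR 1).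
  assert (Ht : 0 < / INR M) by (apply Rinv_0_lt_compat; lra).
  apply Rle_trans with (psum (mom (exp (- / INR M)) 1) M).
  2: { apply sumL_parts_ge; try easy. intros m. now apply mom_nonneg, exp_neg_lt_1. }
  apply psum_const_le. intros m Hm. unfold mom. rewrite exp_pow, !pow_1.
  assert (Hm' : 1 <= INR m) by (apply (le_INR 1); lia).
  assert (HmM : INR m <= INR M) by (apply le_INR; lia).
  replace (INR m * - / INR M) with (- (INR m * / INR M)) by ring. set (y := INR m * / INR M).
  assert (Hy : 0 < y) by (unfold y; nra).
  assert (Hy1 : y <= 1). { apply Rmult_le_reg_r with (INR M); [lra|]. unfold y. rewrite Rmult_assoc, Rinv_l by lra. lra. }
  destruct (exp_neg_lt_1 y Hy) as [H0 H1]. destruct (exp_neg_bounds y ltac:(lra)) as [H2 _].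
  assert (H3 : / 3 <= exp (- y)). { apply Rle_trans with (1 := exp_m1_ge). apply exp_le; lra. }
  replace (INR M / 3) with (INR m * (/ 3 * / y)) by (unfold y; field; lra).
  apply Rmult_le_compat_l; [lra|]. apply Rmult_le_compat; [lra| |easy|].
  left; now apply Rinv_0_lt_compat. apply Rinv_le_contravar; lra.
Qed.

(** Intermediate values for the mean on [[1 / M, t1]]. At [1 / M] it is at least [M^2 / 3 > n]; at
    [t1] it is at most [16 B / t1^2 < n]. The left end ensures [M t >= 1], the right end
    [n t^2 <= 32 (B + 1)]. *)
Lemma exists_saddle (c : nat -> nat) (B : nat) :
  (forall m, (1 <= m)%nat -> (1 <= c m)%nat) -> (forall m, (c m <= B)%nat) ->
  exists n0, forall n M, (n0 <= n)%nat -> (n <= M)%nat ->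
  exists tau, saddle c B M n tau /\ INR n * tau ^ 4 <= 32 * (INR B + 1).
Proof.
  intros Hc HB. exists (2048 * (B + 1) + 4)%nat. intros n M Hn HM.
  assert (HBp := pos_INR B).
  assert (Hn' : 2048 * (INR B + 1) + 4 <= INR n).
  { apply le_INR in Hn. rewrite plus_INR, mult_INR, plus_INR in Hn. 
    replace (INR 2048) with 2048 in Hn by (rewrite INR_IZR_INZ; reflexivity). cbn in Hn. lra. }
  assert (HM' : INR n <= INR M) by now apply le_INR.
  set (t1 := sqrt (32 * (INR B + 1) / INR n)).
  assert (Hq : 0 < 32 * (INR B + 1) / INR n) by (apply Rdiv_lt_0_compat; lra).
  assert (Et1 : t1 ^ 2 = 32 * (INR B + 1) / INR n) by (apply pow2_sqrt; lra).
  assert (Ht1 : 0 < t1) by now apply sqrt_lt_R0.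
  assert (En : INR n * t1 ^ 2 = 32 * (INR B + 1)) by (rewrite Et1; field; lra).
  assert (Ht8 : t1 <= / 8).
  { assert (t1 ^ 2 <= (/ 8) ^ 2); [|nra]. apply Rmult_le_reg_l with (INR n); [lra|]. rewrite En. lra. }
  assert (HMt : / INR M < t1).
  { assert (Z : 0 < / INR M) by (apply Rinv_0_lt_compat; lra). assert (Zi : INR M * / INR M = 1) by (apply Rinv_r; lra).
    assert ((/ INR M) ^ 2 < t1 ^ 2); [|nra]. apply Rmult_lt_reg_l with (INR n); [lra|]. rewrite En.
    assert (/ INR M <= 1). { rewrite <- Rinv_1. apply Rinv_le_contravar; lra. }
    assert (INR n * / INR M <= 1). { rewrite <- Zi. apply Rmult_le_compat_r; lra. }
    nra. }
  assert (Hpos : 0 < / INR M) by (apply Rinv_0_lt_compat; lra).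
  destruct (IVT_interv (fun t => INR n - sumL (mom (exp (- t)) 1) (parts c M)) (/ INR M) t1) as [t [Ht E]].
  - intros t Ht. apply (continuity_pt_minus (fun _ => INR n)). apply continuity_pt_const. now intros x y.
    apply continuity_mean. lra.
  - easy.
  - assert (Z := mean_ge c M Hc ltac:(lia)). nra.
  - assert (Z := sum_mom_le c B M 1 t1 HB Ht1 ltac:(lia)).
    assert (Z1 : INR B * (4 / t1) ^ 2 < INR n); [|lra].
    replace (INR B * (4 / t1) ^ 2) with (16 * INR B / t1 ^ 2) by (field; lra).
    apply Rmult_lt_reg_r with (t1 ^ 2); [nra|]. unfold Rdiv. rewrite Rmult_assoc, Rinv_l by nra. lra.
  - exists (sqrt t). assert (Es : sqrt t ^ 2 = t) by (apply pow2_sqrt; lra). split.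
    + split; try easy; try rewrite Es; try lra.
      * apply sqrt_lt_R0; lra.
      * assert (Zi : INR M * / INR M = 1) by (apply Rinv_r; lra). rewrite <- Zi. apply Rmult_le_compat_l; lra.
    + replace (sqrt t ^ 4) with ((sqrt t ^ 2) ^ 2) by ring. rewrite Es, <- En. apply Rmult_le_compat_l; [lra|].
      apply pow_incr. lra.
Qed.

Lemma bdiff_ext (b b' : nat -> R) (j n : nat) :
  (forall i, (i <= n + j)%nat -> b i = b' i) -> bdiff b j n = bdiff b' j n.
Proof.
  revert n. induction j as [|j IH]; intros n H; cbn [bdiff]. apply H; lia.
  rewrite (IH n), (IH (S n)); [easy| |]; intros; apply H; lia.
Qed.

Lemma prodR_pos (f : nat -> R) (L : list nat) : (forall m, In m L -> 0 < f m) -> 0 < prodR f L.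
Proof.
  induction L as [|m L IH]; intros H; cbn; [lra|]. apply Rmult_lt_0_compat. apply H; now left.
  apply IH. intros; apply H; now right.
Qed.

Lemma is_lim_seq_of_tau (u tau : nat -> R) (l K D : R) (n0 : nat) : 0 < K -> 0 < D ->
  (forall n, (n0 <= n)%nat -> 0 < tau n /\ INR n * tau n ^ 4 <= D /\ Rabs (u n - l) <= K * tau n) ->
  is_lim_seq u l.
Proof.
  intros HK HD H. apply is_lim_seq_spec. intros eps.
  assert (He := cond_pos eps). set (e := eps / (2 * K)).
  assert (He' : 0 < e) by (apply Rdiv_lt_0_compat; lra).
  assert (He4 : 0 < e ^ 4) by now apply pow_lt.
  destruct (nfloor_ex (D / e ^ 4)) as [N [_ HN]].
  { apply Rlt_le, Rdiv_lt_0_compat; lra. }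
  exists (max n0 (S N)). intros n Hn. destruct (H n ltac:(lia)) as [H1 [H2 H3]].
  apply Rle_lt_trans with (1 := H3).
  assert (H4 : tau n <= e).
  { destruct (Rle_lt_dec (tau n) e) as [Hle|Hgt]; [easy|exfalso].
    assert (H5 : e ^ 4 <= tau n ^ 4) by (apply pow_incr; lra).
    assert (H6 : INR N + 1 <= INR n). { rewrite <- S_INR. apply le_INR. lia. }
    assert (H7 : D < INR n * e ^ 4).
    { apply Rmult_lt_reg_r with (/ e ^ 4). now apply Rinv_0_lt_compat.
      rewrite Rmult_assoc, Rinv_r by lra. unfold Rdiv in HN. lra. }
    assert (INR n * e ^ 4 <= INR n * tau n ^ 4). { apply Rmult_le_compat_l; [apply pos_INR|easy]. }
    lra. }
  apply Rle_lt_trans with (K * e). apply Rmult_le_compat_l; lra.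
  unfold e. replace (K * (eps / (2 * K))) with (eps / 2) by (field; lra). lra.
Qed.

(* [s n] is [1 / sigma]. *)
Theorem hermite_asymptotics (c : nat -> nat) (B J : nat) (a : nat -> R) :
  (forall m, (1 <= m)%nat -> (1 <= c m)%nat) -> (forall m, (c m <= B)%nat) ->
  (forall M, exists f, series_of (parts c M) f /\ forall n, (n <= M)%nat -> f n = a n) ->
  exists (n0 : nat) (r s l : nat -> R),
    (forall n, (n0 <= n)%nat -> 0 < r n < 1 /\ 0 < s n /\ 0 < l n) /\
    is_lim_seq s 0 /\
    forall j, (j <= J)%nat ->
    is_lim_seq (fun n => l n * bdiff (fun i => a (n + i)%nat * r n ^ i) j 0 / s n ^ j) (hnum j).
Proof.
  intros Hc HB Ha. destruct (exists_saddle c B Hc HB) as [n0 Hsd].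
  (* A single constant for all orders up to [J], so that one choice of [tau] for each [n] carries
     all the bounds together. *)
  assert (HK : exists K, 0 < K /\ forall j, (j <= J)%nat ->
    forall c M n tau a, saddle c B M n tau -> series_of (parts c M) a ->
    let s := sqrt (variance c M tau) in
    let lam := s * (2 * PI * prodR (fun m => 1 - exp (- tau ^ 2) ^ m) (parts c M)) * exp (- tau ^ 2) ^ n
             / (s * gmoment (s ^ 2) 0) in
    Rabs (lam * s ^ j * bdiff (fun i => a (n + i)%nat * exp (- tau ^ 2) ^ i) j 0 - hnum j) <= K * tau).
  { clear. induction J as [|J [K [HK IH]]].
    - destruct (saddle_bdiff B 0) as [K [HK H]]. exists K. split; [easy|]. intros j Hj.
      replace j with 0%nat by lia. exact H.
    - destruct (saddle_bdiff B (S J)) as [K' [HK' H]]. exists (K + K'). split; [lra|].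
      intros j Hj c M n tau a HS Ha. assert (Ht := sd_pos _ _ _ _ _ HS). cbv zeta.
      destruct (Nat.eq_dec j (S J)) as [->|Hj'].
      + apply Rle_trans with (1 := H c M n tau a HS Ha). nra.
      + apply Rle_trans with (1 := IH j ltac:(lia) c M n tau a HS Ha). nra. }
  destruct HK as [K [HK HKJ]].
  assert (HBp := pos_INR B).
  assert (HC : forall n, exists p : R * (R * (R * R)), (n0 <= n)%nat ->
    let '(tau, (r, (s, l))) := p in
    0 < tau /\ INR n * tau ^ 4 <= 32 * (INR B + 1) /\ 0 < r < 1 /\ 0 < s <= 3 * tau /\ 0 < l /\
    forall j, (j <= J)%nat -> Rabs (l * bdiff (fun i => a (n + i)%nat * r ^ i) j 0 / s ^ j - hnum j) <= K * tau).
  { intros n. destruct (Nat.le_gt_cases n0 n) as [Hn|Hn]; [|exists (0, (0, (0, 0))); lia].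
    (* Differences up to order [J] at [n] read the coefficients [n] to [n + J], which the truncation
       at [M = n + J] leaves exact. *)
    destruct (Hsd n (n + J)%nat Hn ltac:(lia)) as [tau [HS Htau]].
    destruct (Ha (n + J)%nat) as [f [Hf Hfa]].
    assert (Ht := sd_pos _ _ _ _ _ HS). assert (Hsm := sd_small _ _ _ _ _ HS).
    set (r := exp (- tau ^ 2)). set (s := sqrt (variance c (n + J) tau)).
    destruct (saddle_sqrt_var _ _ _ _ _ HS) as [Es [Hs1 Hs2]]. fold s in Es, Hs1, Hs2.
    assert (Ht3 : 0 < tau ^ 3) by now apply pow_lt.
    assert (Hr : 0 < r < 1) by (apply exp_neg_lt_1, pow_lt, Ht).
    assert (Hi3 : 0 < / (3 * tau ^ 3)) by (apply Rinv_0_lt_compat; lra).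
    assert (Htau3 : tau ^ 3 <= tau).
    { replace (tau ^ 3) with (tau * tau ^ 2) by ring. nra. }
    assert (Hs3 : / s <= 3 * tau ^ 3).
    { rewrite <- (Rinv_inv (3 * tau ^ 3)). now apply Rinv_le_contravar. }
    assert (Hs0 : 1 <= s).
    { apply Rle_trans with (2 := Hs1). rewrite <- Rinv_1. apply Rinv_le_contravar; [lra|].
      assert (tau <= / 2) by nra. assert (tau ^ 3 <= / 2 * / 8). 
      { replace (tau ^ 3) with (tau * tau ^ 2) by ring. apply Rmult_le_compat; try lra. apply pow_le; lra. } lra. }
    assert (Hg := gmoment0_ge s Hs0).
    set (lam := s * (2 * PI * prodR (fun m => 1 - r ^ m) (parts c (n + J))) * r ^ n / (s * gmoment (s ^ 2) 0)).
    exists (tau, (r, (/ s, lam))). intros _. repeat split; try easy.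
    - apply Rinv_0_lt_compat; lra.
    - lra.
    - assert (HP := PI_RGT_0). apply Rdiv_lt_0_compat; [|lra].
      apply Rmult_lt_0_compat; [|now apply pow_lt]. apply Rmult_lt_0_compat; [lra|].
      apply Rmult_lt_0_compat; [lra|]. apply prodR_pos. intros m Hm.
      assert (Z := pow_lt_1_pos r m Hr (parts_pos c _ m Hm)). lra.
    - intros j Hj. specialize (HKJ j Hj c (n + J)%nat n tau f HS Hf). cbv zeta in HKJ.
      fold s r in HKJ. fold lam in HKJ.
      rewrite (bdiff_ext (fun i => a (n + i)%nat * r ^ i) (fun i => f (n + i)%nat * r ^ i)).
      + rewrite pow_inv. unfold Rdiv. rewrite Rinv_inv.
        replace (lam * bdiff (fun i => f (n + i)%nat * r ^ i) j 0 * s ^ j) with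
          (lam * s ^ j * bdiff (fun i => f (n + i)%nat * r ^ i) j 0) by ring. exact HKJ.
      + intros i Hi. rewrite Hfa by lia. easy. }
  apply functional_choice in HC as [p Hp].
  exists n0, (fun n => fst (snd (p n))), (fun n => fst (snd (snd (p n)))), (fun n => snd (snd (snd (p n)))).
  split; [|split].
  - intros n Hn. specialize (Hp n Hn). destruct (p n) as [tau [r [s l]]]. cbn. tauto.
  - apply (is_lim_seq_of_tau _ (fun n => fst (p n)) 0 3 (32 * (INR B + 1)) n0); [lra|lra|].
    intros n Hn. specialize (Hp n Hn). destruct (p n) as [tau [r [s l]]]. cbn.
    destruct Hp as [H1 [H2 [H3 [H4 _]]]]. repeat split; try easy. rewrite Rminus_0_r, Rabs_pos_eq; lra.
  - intros j Hj. apply (is_lim_seq_of_tau _ (fun n => fst (p n)) (hnum j) K (32 * (INR B + 1)) n0); [lra|lra|].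
    intros n Hn. specialize (Hp n Hn). destruct (p n) as [tau [r [s l]]]. cbn [fst snd].
    destruct Hp as [H1 [H2 [H3 [H4 [H5 H6]]]]]. repeat split; try easy. now apply H6.
Qed.

(** * Hermite polynomials *)

(** Hermite polynomials in the probabilists' normalisation, orthogonal for [exp (- y^2 / 2)]. *)
Fixpoint He (d : nat) (y : R) : R :=
  match d with
  | O => 1
  | S d' => y * He d' y - match d' with O => 0 | S e => INR d' * He e y end
  end.

Lemma He_SS (d : nat) (y : R) : He (S (S d)) y = y * He (S d) y - INR (S d) * He d y.
Proof. reflexivity. Qed.

Lemma is_derive_He (d : nat) (y : R) : is_derive (He (S d)) y (INR (S d) * He d y).
Proof.
  revert y. assert (H : (forall y, is_derive (He (S d)) y (INR (S d) * He d y)) /\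
    (forall y, is_derive (He (S (S d))) y (INR (S (S d)) * He (S d) y))); [|easy].
  induction d as [|d [IH1 IH2]].
  - split; intros y; cbn; auto_derive; try easy; ring.
  - split; [easy|]. intros y.
    apply (is_derive_ext (fun y => y * He (S (S d)) y - INR (S (S d)) * He (S d) y)); [easy|].
    evar_last.
    + apply (is_derive_minus (V := R_NormedModule)).
      * apply (is_derive_mult (fun y => y) (He (S (S d)))); [apply (is_derive_id (K := R_AbsRing))|apply IH2|].
        intros; apply Rmult_comm.
      * apply (is_derive_scal (He (S d))). apply IH1.
    + unfold minus, plus, opp, mult, one; cbn -[INR He]. 
      rewrite (He_SS d y), (S_INR (S (S d))). ring.
Qed.

Definition hermite_fun (d : nat) (y : R) : R := He d y * exp (- (/ 2 * y ^ 2)).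

Lemma is_derive_hermite_fun (d : nat) (y : R) : is_derive (hermite_fun d) y (- hermite_fun (S d) y).
Proof.
  assert (He1 : is_derive (fun y => exp (- (/ 2 * y ^ 2))) y (- y * exp (- (/ 2 * y ^ 2)))).
  { auto_derive; [easy|]. cbn [pow]. field. }
  assert (He2 : is_derive (He d) y (match d with O => 0 | S e => INR (S e) * He e y end)).
  { destruct d. apply (is_derive_const (V := R_NormedModule)). apply is_derive_He. }
  unfold hermite_fun. evar_last.
  - apply (is_derive_mult (He d) (fun y => exp (- (/ 2 * y ^ 2)))); [apply He2|apply He1|intros; apply Rmult_comm].
  - unfold plus, mult, zero; cbn -[INR He pow]. destruct d; [cbn [He]|rewrite He_SS]; unfold Rminus; ring.
Qed.

Lemma He_bound (d : nat) : exists C, 0 < C /\ forall y, 1 <= Rabs y -> Rabs (He d y) <= C * Rabs y ^ d.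
Proof.
  assert (H : (exists C, 0 < C /\ forall y, 1 <= Rabs y -> Rabs (He d y) <= C * Rabs y ^ d) /\
     (exists C, 0 < C /\ forall y, 1 <= Rabs y -> Rabs (He (S d) y) <= C * Rabs y ^ (S d))); [|easy].
  induction d as [|d [[C1 [HC1 H1]] [C2 [HC2 H2]]]].
  - split; exists 1; (split; [lra|]); intros y Hy; cbn.
    rewrite Rabs_R1; lra. rewrite !Rmult_1_r, Rminus_0_r; lra.
  - split; [now exists C2|]. exists (C2 + INR (S d) * C1). assert (Hd := pos_INR (S d)). split; [nra|].
    intros y Hy. specialize (H1 y Hy). specialize (H2 y Hy). rewrite He_SS.
    unfold Rminus. eapply Rle_trans; [apply Rabs_triang|]. rewrite Rabs_Ropp, !Rabs_mult, (Rabs_pos_eq (INR _)) by easy.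
    rewrite Rmult_plus_distr_r. apply Rplus_le_compat.
    + replace (C2 * Rabs y ^ S (S d)) with (Rabs y * (C2 * Rabs y ^ S d)) by (cbn [pow]; ring).
      apply Rmult_le_compat_l; lra.
    + rewrite Rmult_assoc. apply Rmult_le_compat_l; [easy|]. apply Rle_trans with (1 := H1).
      apply Rmult_le_compat_l; [lra|]. apply Rle_pow; [easy|lia].
Qed.

Lemma hermite_fun_decay (d : nat) (eps : R) : 0 < eps -> exists b, 0 < b /\ forall y, b <= Rabs y -> Rabs (hermite_fun d y) < eps.
Proof.
  intros Heps. destruct (He_bound d) as [C [HC H1]].
  destruct (pow_exp_le d (/ 2) ltac:(lra)) as [K [HK H2]].
  assert (HCK : 0 < C * K / eps) by (apply Rdiv_lt_0_compat; nra).
  exists (1 + C * K / eps). split; [lra|]. intros y Hy. unfold hermite_fun.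
  rewrite Rabs_mult, (Rabs_pos_eq (exp _)) by (left; apply exp_pos).
  apply Rle_lt_trans with (C * (Rabs y ^ d * exp (- (/ 2 * y ^ 2)))).
  - rewrite <- Rmult_assoc. apply Rmult_le_compat_r; [left; apply exp_pos|]. apply H1. lra.
  - apply Rle_lt_trans with (C * (K / (1 + y ^ 2))). apply Rmult_le_compat_l; [lra|apply H2].
    assert (Hy2 : Rabs y <= y ^ 2) by (rewrite <- (pow2_abs y); nra).
    assert (0 < 1 + y ^ 2) by lra.
    apply Rmult_lt_reg_r with ((1 + y ^ 2) / eps). apply Rdiv_lt_0_compat; lra.
    replace (C * (K / (1 + y ^ 2)) * ((1 + y ^ 2) / eps)) with (C * K / eps) by (field; lra).
    replace (eps * ((1 + y ^ 2) / eps)) with (1 + y ^ 2) by (field; lra). lra.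
Qed.

(* Rolle between consecutive points, and towards both infinities, for [He d y * exp (- y^2 / 2)],
   whose derivative is [- He (S d) y * exp (- y^2 / 2)]. *)
Theorem He_alternates (d : nat) : exists y : nat -> R,
  (forall i, (i < d)%nat -> y i < y (S i)) /\
  (forall i, (i <= d)%nat -> 0 < (-1) ^ (d + i) * He d (y i)).
Proof.
  assert (H : exists y : nat -> R, (forall i, (i < d)%nat -> y i < y (S i)) /\
    (forall i, (i <= d)%nat -> 0 < (-1) ^ (d + i) * hermite_fun d (y i))).
  2: { destruct H as [y [H1 H2]]. exists y. split; [easy|]. intros i Hi. specialize (H2 i Hi).
       unfold hermite_fun in H2. assert (Z := exp_pos (- (/ 2 * y i ^ 2))). rewrite <- Rmult_assoc in H2. nra. }
  induction d as [|d [y [Hy Hs]]].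
  - exists (fun _ => 0). split; [lia|]. intros i Hi. replace i with 0%nat by lia. unfold hermite_fun. cbn.
    assert (Z := exp_pos (- (/ 2 * (0 * (0 * 1))))). lra.
  - assert (Hs0 := Hs 0%nat ltac:(lia)). assert (Hsd := Hs d ltac:(lia)).
    assert (H0 : 0 < Rabs (hermite_fun d (y 0%nat))).
    { apply Rabs_pos_lt. intros E. rewrite E, Rmult_0_r in Hs0. lra. }
    assert (Hd : 0 < Rabs (hermite_fun d (y d))).
    { apply Rabs_pos_lt. intros E. rewrite E, Rmult_0_r in Hsd. lra. }
    destruct (hermite_fun_decay d _ H0) as [b0 [Hb0 B0]]. destruct (hermite_fun_decay d _ Hd) as [b1 [Hb1 B1]].
    (* The two added points lie so far out that [hermite_fun d] is smaller in modulus there than at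
       [y 0] and [y d]. Its first and last increments then follow the same sign pattern as the
       others. *)
    set (z := fun i => match i with O => - (b0 + Rabs (y 0%nat) + 1) | S i' => 
       if Nat.leb i' d then y i' else b1 + Rabs (y d) + 1 end).
    assert (Hz : forall i, (i <= S d)%nat -> z i < z (S i)).
    { intros [|i] Hi; unfold z.
      - cbn [Nat.leb]. assert (Z := Rle_abs (- y 0%nat)). rewrite Rabs_Ropp in Z. lra.
      - destruct (Nat.leb_spec i d); [|lia]. destruct (Nat.leb_spec (S i) d).
        + apply Hy. lia.
        + replace i with d by lia. assert (Z := Rle_abs (y d)). lra. }
    assert (Hg : forall i, (i <= S d)%nat -> 0 < (-1) ^ (d + i) * (hermite_fun d (z (S i)) - hermite_fun d (z i))).
    { intros i Hi. rewrite Rmult_minus_distr_l.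
      assert (U : forall i, (i <= d)%nat -> z (S i) = y i).
      { intros i' Hi'. unfold z. destruct (Nat.leb_spec i' d); [easy|lia]. }
      destruct i as [|i].
      - rewrite (U 0%nat) by lia. assert (Z := B0 (z 0%nat)).
        assert (Z1 : Rabs (hermite_fun d (z 0%nat)) < Rabs (hermite_fun d (y 0%nat))).
        { apply Z. unfold z. rewrite Rabs_Ropp. assert (Z' := Rabs_pos (y 0%nat)). rewrite Rabs_pos_eq; lra. }
        assert (Z2 : forall v, Rabs ((-1) ^ (d + 0) * v) = Rabs v).
        { intros v. rewrite Rabs_mult, pow_1_abs. ring. }
        rewrite <- (Z2 (hermite_fun d (z 0%nat))), <- (Z2 (hermite_fun d (y 0%nat))) in Z1.
        rewrite (Rabs_pos_eq ((-1) ^ (d + 0) * hermite_fun d (y 0%nat))) in Z1 by lra.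
        assert (Z3 := Rle_abs ((-1) ^ (d + 0) * hermite_fun d (z 0%nat))). lra.
      - rewrite (U i) by lia. replace (d + S i)%nat with (S (d + i)) by lia. cbn [pow].
        assert (Hsi := Hs i ltac:(lia)).
        destruct (Nat.le_gt_cases (S i) d) as [Hi'|Hi'].
        + rewrite U by easy. assert (Z := Hs (S i) Hi'). replace (d + S i)%nat with (S (d + i)) in Z by lia.
          cbn [pow] in Z. lra.
        + replace i with d in * by lia. clear Hi Hi'.
          assert (Z1 : Rabs (hermite_fun d (z (S (S d)))) < Rabs (hermite_fun d (y d))).
          { apply B1. unfold z. destruct (Nat.leb_spec (S d) d); [lia|]. assert (Z' := Rabs_pos (y d)).
            rewrite Rabs_pos_eq; lra. }
          assert (Z2 : forall v, Rabs ((-1) ^ (d + d) * v) = Rabs v).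
          { intros v. rewrite Rabs_mult, pow_1_abs. ring. }
          rewrite <- (Z2 (hermite_fun d (z (S (S d))))), <- (Z2 (hermite_fun d (y d))) in Z1.
          rewrite (Rabs_pos_eq ((-1) ^ (d + d) * hermite_fun d (y d))) in Z1 by lra.
          assert (Z3 := Rle_abs ((-1) ^ (d + d) * hermite_fun d (z (S (S d))))). lra. }
    assert (HM : forall i, exists x, (i <= S d)%nat -> z i < x < z (S i) /\ 0 < (-1) ^ (S d + i) * hermite_fun (S d) x).
    { intros i. destruct (Nat.le_gt_cases i (S d)) as [Hi|Hi]; [|exists 0; lia].
      destruct (MVT_cor2 (hermite_fun d) (fun x => - hermite_fun (S d) x) (z i) (z (S i)) (Hz i Hi)) as [x [E Hx]].
      { intros x _. apply is_derive_Reals, is_derive_hermite_fun. }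
      exists x. intros _. split; [easy|]. specialize (Hg i Hi). rewrite E in Hg.
      specialize (Hz i Hi). cbn [Nat.add pow].
      replace ((-1) ^ (d + i) * (- hermite_fun (S d) x * (z (S i) - z i))) with
        ((z (S i) - z i) * (-1 * (-1) ^ (d + i) * hermite_fun (S d) x)) in Hg by ring.
      apply Rmult_lt_reg_l with (z (S i) - z i); lra. }
    apply functional_choice in HM as [x Hx]. exists x. split.
    + intros i Hi. destruct (Hx i ltac:(lia)) as [A1 _]. destruct (Hx (S i) ltac:(lia)) as [A2 _]. lra.
    + intros i Hi. now apply Hx.
Qed.

(** * Positivity from limits and from continuity *)

Lemma is_lim_seq_pos_eventually (u : nat -> R) (l : R) : is_lim_seq u l -> 0 < l ->
  exists N, forall n, (N <= n)%nat -> 0 < u n.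
Proof.
  intros H Hl. apply is_lim_seq_spec in H. destruct (H (mkposreal l Hl)) as [N HN].
  exists N. intros n Hn. specialize (HN n Hn). cbn in HN. apply Rabs_def2 in HN. lra.
Qed.

Lemma continuous_pos_right (f : R -> R) (x : R) : continuous f x -> 0 < f x ->
  exists d, 0 < d /\ forall y, x < y -> y < x + d -> 0 < f y.
Proof.
  intros Hc Hx. assert (Ho : locally (f x) (fun z => 0 < z)).
  { exists (mkposreal _ Hx). intros z Hz. unfold ball in Hz; cbn in Hz. unfold AbsRing_ball, abs, minus, plus, opp in Hz; cbn in Hz.
    apply Rabs_def2 in Hz. lra. }
  destruct (Hc _ Ho) as [d Hd]. exists d. split; [apply cond_pos|]. intros y H1 H2. apply Hd.
  unfold ball; cbn. unfold AbsRing_ball, abs, minus, plus, opp; cbn. apply Rabs_def1; lra.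
Qed.

End Analytic.
Import Analytic.

From HB Require Import structures.
From mathcomp Require Import all_boot all_order all_algebra all_field.
From mathcomp Require Import ring reals Rstruct.
Set Implicit Arguments. Unset Strict Implicit. Unset Printing Implicit Defensive.
Import Order.TTheory GRing.Theory Num.Theory.
Local Open Scope ring_scope.

(** * Sign alternations and real roots *)

Definition self_conj (p : {poly algC}) := map_poly Num.conj p = p.

Definition alternates (p : {poly algC}) (x : nat -> algC) (N : nat) :=
  [/\ forall i, (i <= N)%N -> x i \is Num.real,
      forall i, (i < N)%N -> x i < x i.+1 &
      forall i, (i <= N)%N -> 0 < (-1) ^+ i * p.[x i]].

Lemma self_conj_factor (q d : {poly algC}) :
  d != 0 -> self_conj d -> self_conj (q * d) -> self_conj q.
Proof.
move=> d0; rewrite /self_conj rmorphM /= => ->.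
by move/(mulIf d0).
Qed.

Definition conj_quad (z : algC) : {poly algC} := ('X - z%:P) * ('X - (z^*)%:P).

Lemma self_conj_quad (z : algC) : self_conj (conj_quad z).
Proof.
by rewrite /self_conj /conj_quad rmorphM /= !rmorphB /= !map_polyX !map_polyC /= conjCK mulrC.
Qed.

Lemma conj_quad_gt0 (z x : algC) : x \is Num.real -> z \isn't Num.real -> 0 < (conj_quad z).[x].
Proof.
move=> xr zr; rewrite hornerM !hornerXsubC.
have -> : (x - z) * (x - z^*) = `|x - z| ^+ 2 by rewrite normCK rmorphB /= (CrealP xr).
rewrite exprn_gt0 // normr_gt0 subr_eq0; apply: contraNneq zr => <-; exact: xr.
Qed.

Lemma nonreal_root_factor (p : {poly algC}) (z : algC) :
  self_conj p -> root p z -> z \isn't Num.real ->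
  exists2 q, p = q * conj_quad z & self_conj q.
Proof.
move=> pc pz zr.
have zz : z != z^* by apply: contraNneq zr => e; apply/CrealP.
have pz' : root p z^* by rewrite -pc /root horner_map /= (rootP pz) conjC0.
have /factor_theorem [q1 e1] := pz.
have : root q1 z^*.
  by move: pz'; rewrite e1 rootM root_XsubC [_ == z]eq_sym (negPf zz) orbF.
case/factor_theorem => q2 e2.
have e : p = q2 * conj_quad z.
  by rewrite e1 e2 /conj_quad -!mulrA; congr (_ * _); rewrite mulrC.
exists q2 => //; apply: (@self_conj_factor _ (conj_quad z)); rewrite -?e //.
- by rewrite mulf_neq0 // polyXsubC_eq0.
- exact: self_conj_quad.
Qed.

Lemma alternates_neq0 p x N : alternates p x N -> p != 0.
Proof.
by case=> _ _ /(_ 0%N isT); apply: contraTneq => ->; rewrite horner0 mulr0 ltxx.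
Qed.

Lemma alternates_quad (q : {poly algC}) (z : algC) x N : z \isn't Num.real ->
  alternates (q * conj_quad z) x N -> alternates q x N.
Proof.
move=> zr [xr xlt sg]; split=> // i iN; have := sg i iN.
by rewrite hornerM mulrA pmulr_lgt0 // conj_quad_gt0 // xr.
Qed.

(* Dividing by a real linear factor costs one point: keep [x i] left of the root and [x i.+1] right
   of it. *)
Lemma alternates_linear (q : {poly algC}) (z : algC) x N : z \is Num.real ->
  alternates (q * ('X - z%:P)) x N.+1 ->
  alternates (- q) (fun i => if x i.+1 < z then x i else x i.+1) N.
Proof.
move=> zr [xr xlt sg].
have val i : (i <= N.+1)%N -> 0 < (-1) ^+ i * q.[x i] * (x i - z).
  by move=> iN; have := sg i iN; rewrite hornerM hornerXsubC mulrA.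
split=> i iN.
- by case: ifP => _; apply: xr => //; apply: leqW.
- have iN1 : (i < N.+1)%N by apply: leqW.
  case: ifP => c1; case: ifP => c2.
  + exact: xlt.
  + by apply: lt_trans (xlt i iN1) (xlt _ _).
  + by have := lt_trans (xlt i.+1 iN) c2; rewrite c1.
  + exact: xlt.
- case: ifP => c.
  + have lt : x i - z < 0 by rewrite subr_lt0; apply: lt_trans (xlt i iN) c.
    have := val i (leqW iN); rewrite (nmulr_lgt0 _ lt) => h.
    by rewrite hornerN mulrN oppr_gt0.
  + have v := val i.+1 iN.
    (* Strict positivity in [v] excludes the root itself; as the order of [algC] is partial, the
       comparison below also needs both points to be real. *)
    have ne : x i.+1 != z by apply: contraTneq v => ->; rewrite subrr mulr0 ltxx.
    have gt : 0 < x i.+1 - z.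
      by rewrite subr_gt0 real_ltNge ?xr // le_eqVlt (negPf ne) c.
    by move: v; rewrite pmulr_lgt0 // hornerN exprS mulN1r mulNr mulrN.
Qed.

Lemma size_mul_conj_quad (q : {poly algC}) z : q != 0 -> size (q * conj_quad z) = (size q).+2.
Proof.
move=> q0; rewrite mulrA size_Mmonic ?mulf_neq0 ?polyXsubC_eq0 ?monicXsubC //.
by rewrite size_Mmonic ?monicXsubC // !size_XsubC !addn2.
Qed.

(** Induction on the degree by splitting off roots in place of intermediate values. A real root
    costs one degree and one sample point; a pair of conjugate roots costs two degrees and no point,
    since its quadratic factor is positive on the reals. *)
Lemma alternates_size p x N : self_conj p -> alternates p x N -> (N < size p)%N.
Proof.
have [n] := ubnP (size p); elim: n p x N => // n IH p x N; rewrite ltnS => pn pc alt.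
have p0 := alternates_neq0 alt.
have [/eqP s1|s1] := boolP (size p == 1%N).
  rewrite s1; case: N alt => // N [_ _ sg].
  have e := size1_polyC (eq_leq s1).
  have := sg 1%N isT; have := sg 0%N isT; rewrite e !hornerC expr0 expr1 mul1r mulN1r oppr_gt0.
  by move=> /lt_trans h /h; rewrite ltxx.
have /closed_rootP [z pz] := s1.
have [zr|zr] := boolP (z \is Num.real).
  have /factor_theorem [q e] := pz.
  have q0 : q != 0 by apply: contraNneq p0 => q0; rewrite e q0 mul0r.
  have sz : size p = (size q).+1 by rewrite e size_Mmonic ?monicXsubC // size_XsubC addn2.
  have qc : self_conj q.
    apply: (@self_conj_factor _ ('X - z%:P)); rewrite ?polyXsubC_eq0 -?e //.
    by rewrite /self_conj rmorphB /= map_polyX map_polyC /= (CrealP zr).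
  case: N alt => [|N] alt; first by rewrite sz.
  move: alt; rewrite [in alternates _ _ _]e => /(alternates_linear zr) alt.
  rewrite sz ltnS -[size q]size_polyN; apply: IH alt.
  - by rewrite size_polyN -ltnS -sz.
  - by rewrite /self_conj rmorphN /= qc.
have [q e qc] := nonreal_root_factor pc pz zr.
have q0 : q != 0 by apply: contraNneq p0 => q0; rewrite e q0 mul0r.
rewrite e size_mul_conj_quad //.
apply: ltnW; apply: ltnW; rewrite !ltnS; apply: (IH q x) => //.
  by apply: leq_trans pn; rewrite e size_mul_conj_quad.
by apply: (alternates_quad zr); rewrite -e.
Qed.

(** A nonreal root would leave a quotient of degree two less with the same alternations, against
    [alternates_size]. *)
Lemma alternates_real_roots p x N z : self_conj p -> (size p <= N.+1)%N -> alternates p x N ->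
  root p z -> z \is Num.real.
Proof.
move=> pc sp alt pz; apply: contraLR sp => zr.
have [q e qc] := nonreal_root_factor pc pz zr.
have q0 : q != 0 by apply: contraNneq (alternates_neq0 alt) => q0; rewrite e q0 mul0r.
rewrite -ltnNge e size_mul_conj_quad // !ltnS; apply: ltnW.
by apply: (alternates_size qc (x := x)); apply: (alternates_quad zr); rewrite -e.
Qed.

(** * The generating function as a product over parts *)

(** Up to degree [n] a power series may be replaced by a polynomial; the monoid laws of [fps_mul]
    are inherited from [{poly int}] in this way. *)
Lemma fps_mul_coef (f g : fps) (p q : {poly int}) (n : nat) :
  (forall i, (i <= n)%N -> p`_i = f i) -> (forall i, (i <= n)%N -> q`_i = g i) ->
  fps_mul f g n = (p * q)`_n.
Proof.
move=> pf qg; rewrite coefM; apply: eq_bigr => i _.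
by rewrite pf ?qg // ?leq_subr // -ltnS.
Qed.

Definition fps_poly (f : fps) (n : nat) : {poly int} := \poly_(i < n.+1) f i.

Lemma coef_fps_poly f n i : (i <= n)%N -> (fps_poly f n)`_i = f i.
Proof. by move=> le; rewrite coef_poly ltnS le. Qed.

Lemma fps_mulC : commutative fps_mul.
Proof.
move=> f g; apply: functional_extensionality => n.
by rewrite !(fps_mul_coef (@coef_fps_poly _ n) (@coef_fps_poly _ n)) mulrC.
Qed.

Lemma fps_mulA : associative fps_mul.
Proof.
move=> f g h; apply: functional_extensionality => n.
have E u v i : (i <= n)%N -> (fps_poly u n * fps_poly v n)`_i = fps_mul u v i.
  by move=> le; apply/esym/fps_mul_coef => j ji; apply: coef_fps_poly; apply: leq_trans le.
rewrite (fps_mul_coef (@coef_fps_poly f n) (E g h)).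
by rewrite (fps_mul_coef (E f g) (@coef_fps_poly h n)) mulrA.
Qed.

Lemma fps_mul1 : left_id fps_one fps_mul.
Proof.
move=> f; apply: functional_extensionality => n.
have E i : (i <= n)%N -> (1 : {poly int})`_i = fps_one i by rewrite coef1.
by rewrite (fps_mul_coef E (@coef_fps_poly f n)) mul1r coef_fps_poly.
Qed.

HB.instance Definition _ :=
  Monoid.isComLaw.Build fps fps_one fps_mul fps_mulA fps_mulC fps_mul1.

Lemma one_minus_mul (a : nat) (g : fps) n : (0 < a)%N ->
  fps_mul (one_minus_qpow a) g n = g n - (if (a <= n)%N then g (n - a)%N else 0).
Proof.
move=> a0; rewrite /fps_mul /one_minus_qpow.
under eq_bigr do rewrite mulrBl.
rewrite sumrB; congr (_ - _).
  by rewrite big_ord_recl subn0 mul1r big1 ?addr0 // => i _; rewrite mul0r.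
rewrite -(big_mkord xpredT (fun i => (i == a)%:R * g (n - i)%N)).
transitivity (\sum_(0 <= i < n.+1) (if i == a then g (n - i)%N else 0)).
  by apply: eq_bigr => i _; case: eqP; rewrite ?mul1r ?mul0r.
by rewrite -big_mkcond /= (big_nat1_eq _ (fun i => g (n - i)%N)) ltnS.
Qed.

Lemma one_minus_inv (a : nat) : (0 < a)%N ->
  fps_mul (one_minus_qpow a) (inv_one_minus_qpow a) = fps_one.
Proof.
move=> a0; apply: functional_extensionality => n; rewrite one_minus_mul //.
rewrite /inv_one_minus_qpow /fps_one; case: leqP => an.
  by rewrite dvdn_subl // subrr; case: n an => // /(leq_trans a0).
rewrite subr0; case: n an => [|n] an; first by rewrite dvdn0.
by rewrite gtnNdvd.
Qed.

(** Congruence modulo [q^(M+1)]. *)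
Definition eqm (M : nat) (f g : fps) := forall n, (n <= M)%N -> f n = g n.

Lemma eqm_mul M f f' g g' : eqm M f f' -> eqm M g g' -> eqm M (fps_mul f g) (fps_mul f' g').
Proof.
move=> ef eg n nM; apply: eq_bigr => i _.
have iM : (i <= M)%N by apply: leq_trans nM; rewrite -ltnS.
by rewrite ef // eg // (leq_trans (leq_subr _ _)).
Qed.

Lemma eqm_trans M f g h : eqm M f g -> eqm M g h -> eqm M f h.
Proof. by move=> a b n nM; rewrite a ?b. Qed.

Lemma eqm_one_minus M a : (M < a)%N -> eqm M (one_minus_qpow a) fps_one.
Proof.
move=> Ma n nM; rewrite /one_minus_qpow /fps_one.
by rewrite (ltn_eqF (leq_ltn_trans nM Ma)) subr0.
Qed.

Lemma eqm_inv M a : (M < a)%N -> eqm M (inv_one_minus_qpow a) fps_one.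
Proof.
move=> Ma [|n] nM; rewrite /inv_one_minus_qpow /fps_one; first by rewrite dvdn0.
by rewrite gtnNdvd // (leq_ltn_trans nM Ma).
Qed.

Lemma prod_multiples (w : nat) (X : nat -> fps) N : (0 < w)%N ->
  \big[fps_mul/fps_one]_(1 <= m < N.+1) X (w * m)%N =
  \big[fps_mul/fps_one]_(1 <= m < (w * N).+1 | (w %| m)%N) X m.
Proof.
move=> w0; elim: N => [|N IH]; first by rewrite muln0 !big_geq.
rewrite big_nat_recr //= IH mulnS.
rewrite [RHS](@big_cat_nat _ _ _ (w * N).+1) //=; last by rewrite ltnS leq_addl.
congr (fps_mul _ _).
have -> : (w + w * N = (w * N + w.-1).+1)%N by rewrite -addnS prednK // addnC.
rewrite big_mkcond big_nat_recr /=; last by rewrite ltnS leq_addr.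
rewrite -addnS prednK // dvdn_addr ?dvdn_mulr // dvdnn.
rewrite big_nat_cond big1 ?Monoid.mul1m // => i.
rewrite andbT => /andP [lo hi]; case: ifP => // /dvdnP [j ji]; exfalso.
move: lo hi; rewrite ji (mulnC j) ltn_pmul2l // -mulnSr ltn_pmul2l // ltnS.
by move=> /leq_trans h /h; rewrite ltnn.
Qed.

Lemma eqm_big M (r : seq nat) (P : pred nat) (F G : nat -> fps) :
  (forall i, i \in r -> P i -> eqm M (F i) (G i)) ->
  eqm M (\big[fps_mul/fps_one]_(i <- r | P i) F i) (\big[fps_mul/fps_one]_(i <- r | P i) G i).
Proof.
move=> H; rewrite big_seq_cond [X in eqm _ _ X]big_seq_cond.
by apply: (big_ind2 (eqm M)) => // [*|i /andP[]]; [apply: eqm_mul|apply: H].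
Qed.

(** Indexing by the exponent [w * m] instead of [m] gives a product up to [w * M], whose factors
    beyond [M] are 1 modulo [q^(M+1)]. *)
Lemma prod_multiples_eqm (w M : nat) (X : nat -> fps) : (0 < w)%N ->
  (forall a, (M < a)%N -> eqm M (X a) fps_one) ->
  eqm M (\big[fps_mul/fps_one]_(1 <= m < M.+1) X (w * m)%N)
        (\big[fps_mul/fps_one]_(1 <= m < M.+1) if (w %| m)%N then X m else fps_one).
Proof.
move=> w0 HX; rewrite prod_multiples // -big_mkcond (@big_cat_nat _ _ _ M.+1 1 (w * M).+1) //=; last first.
  by rewrite ltnS leq_pmull.
rewrite -[X in eqm _ _ X]fps_mul1 fps_mulC.
apply: eqm_mul => //; rewrite big_nat_cond.
apply: (@eqm_trans _ _ (\big[fps_mul/fps_one]_(M.+1 <= i < (w * M).+1 | (M < i < (w * M).+1)%N && (w %| i)%N) fps_one)).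
  by apply: eqm_big => i _ /andP [/andP [lo _] _]; apply: HX.
by rewrite big1.
Qed.

(* The [c_m] of the introduction. *)
Definition multiplicity (k m : nat) : nat := if (2 %| m)%N || (2 * k + 1 %| m)%N then 2 else 3.

(** By coprimality [4k + 2] divides [m] exactly when both 2 and [2k + 1] do. The exponent of
    [1 / (1 - q^m)] is 3 if neither divides, [3 - 1] if one does, and [3 + 1 - 2] if both do. *)
Lemma factor_identity (k m : nat) : (0 < m)%N ->
  fps_mul (if (2 %| m)%N then one_minus_qpow m else fps_one)
  (fps_mul (if (2 * k + 1 %| m)%N then one_minus_qpow m else fps_one)
  (fps_mul (inv_one_minus_qpow m) (fps_mul (inv_one_minus_qpow m) (fps_mul (inv_one_minus_qpow m)
  (if (4 * k + 2 %| m)%N then inv_one_minus_qpow m else fps_one))))) =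
  iter (multiplicity k m) (fps_mul (inv_one_minus_qpow m)) fps_one.
Proof.
move=> m0; have E := one_minus_inv m0.
have -> : (4 * k + 2 = 2 * (2 * k + 1))%N by rewrite mulnDr mulnA.
rewrite Gauss_dvd; last by rewrite coprime2n oddD oddM.
rewrite /multiplicity; set O := one_minus_qpow m in E *; set I := inv_one_minus_qpow m in E *.
have E' X : fps_mul O (fps_mul I X) = X by rewrite fps_mulA E fps_mul1.
have C X Y Z : fps_mul X (fps_mul Y Z) = fps_mul Y (fps_mul X Z).
  by rewrite !fps_mulA (fps_mulC X).
have mul1r X : fps_mul X fps_one = X by rewrite fps_mulC fps_mul1.
case: (2 %| m)%N; case: (2 * k + 1 %| m)%N => /=; rewrite ?fps_mul1 ?mul1r ?E' //.
Qed.

Definition fps_parts (L : seq nat) : fps := foldr (fun m f => fps_mul (inv_one_minus_qpow m) f) fps_one L.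

Lemma fps_parts_prod (k M : nat) :
  fps_parts (parts (multiplicity k) M) =
  \big[fps_mul/fps_one]_(1 <= m < M.+1) iter (multiplicity k m) (fps_mul (inv_one_minus_qpow m)) fps_one.
Proof.
elim: M => [|M IH]; first by rewrite big_geq.
rewrite big_nat_recr //= -IH fps_mulC.
elim: (multiplicity k M.+1) => [|j IHj]; first by rewrite fps_mul1.
by rewrite /= IHj fps_mulA.
Qed.

(** [Delta k n] is read off the product cut at [n]. Reindexing identifies that product with the one
    over parts ([key]), and parts of size [N + 1] change nothing up to degree [N] ([mono]), so any
    [M >= n] gives the same coefficient. *)
Lemma Delta_fps_parts (k M n : nat) : (n <= M)%N -> fps_parts (parts (multiplicity k) M) n = Defs.Delta k n.
Proof.
have key N : eqm N (Delta_partial k N) (fps_parts (parts (multiplicity k) N)).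
  rewrite fps_parts_prod.
  have -> : Delta_partial k N =
    fps_mul (\big[fps_mul/fps_one]_(1 <= m < N.+1) one_minus_qpow (2 * m))
    (fps_mul (\big[fps_mul/fps_one]_(1 <= m < N.+1) one_minus_qpow ((2 * k + 1) * m))
    (fps_mul (\big[fps_mul/fps_one]_(1 <= m < N.+1) inv_one_minus_qpow m)
    (fps_mul (\big[fps_mul/fps_one]_(1 <= m < N.+1) inv_one_minus_qpow m)
    (fps_mul (\big[fps_mul/fps_one]_(1 <= m < N.+1) inv_one_minus_qpow m)
       (\big[fps_mul/fps_one]_(1 <= m < N.+1) inv_one_minus_qpow ((4 * k + 2) * m)))))).
    by rewrite -!big_split.
  apply: (@eqm_trans _ _ (\big[fps_mul/fps_one]_(1 <= m < N.+1)
    fps_mul (if (2 %| m)%N then one_minus_qpow m else fps_one)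
    (fps_mul (if (2 * k + 1 %| m)%N then one_minus_qpow m else fps_one)
    (fps_mul (inv_one_minus_qpow m) (fps_mul (inv_one_minus_qpow m) (fps_mul (inv_one_minus_qpow m)
    (if (4 * k + 2 %| m)%N then inv_one_minus_qpow m else fps_one))))))).
    rewrite !big_split.
    do !apply: eqm_mul => //; apply: prod_multiples_eqm; rewrite ?addn_gt0 ?orbT //.
    - by move=> a; apply: eqm_one_minus.
    - by move=> a; apply: eqm_one_minus.
    - by move=> a; apply: eqm_inv.
  apply: eqm_big => m; rewrite mem_index_iota => /andP [m0 _] _.
  by rewrite factor_identity.
have mono N : eqm N (fps_parts (parts (multiplicity k) N.+1)) (fps_parts (parts (multiplicity k) N)).
  rewrite !fps_parts_prod big_nat_recr //= fps_mulC -[X in eqm _ _ X]fps_mul1.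
  apply: eqm_mul => //; elim: (multiplicity k N.+1) => //= j IHj.
  by rewrite -[X in eqm _ _ X]fps_mul1; apply: eqm_mul => //; apply: eqm_inv.
elim: M => [|M IH] nM; first by rewrite /Defs.Delta key //; move: nM; rewrite leqn0 => /eqP ->.
case: (ltngtP n M.+1) nM => // [nM|->] _; last by rewrite /Defs.Delta key.
by rewrite mono ?IH // -ltnS.
Qed.

Lemma fps_parts_rec (m : nat) (L : seq nat) n : (0 < m)%N ->
  fps_parts (m :: L) n = fps_parts L n + (if (m <= n)%N then fps_parts (m :: L) (n - m)%N else 0).
Proof.
move=> m0; have -> : fps_parts L = fps_mul (one_minus_qpow m) (fps_parts (m :: L)).
  by rewrite /= fps_mulA one_minus_inv // fps_mul1.
by rewrite one_minus_mul // subrK.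
Qed.

(** * Umbral identities and conclusion *)

Section Umbral.
Variables (F : comNzRingType) (b : nat -> F).

(** Umbral evaluation: the linear functional sending ['X^i] to [b i]. *)
Definition umb (p : {poly F}) : F := \sum_(i < size p) p`_i * b i.

Lemma umb_wide N (p : {poly F}) : (size p <= N)%N -> umb p = \sum_(i < N) p`_i * b i.
Proof.
move=> le; rewrite /umb (big_ord_widen _ (fun i => p`_i * b i) le) big_mkcond.
by apply: eq_bigr => i _; case: ltnP => // h; rewrite nth_default ?mul0r.
Qed.

Lemma umb_is_linear : scalar umb.
Proof.
move=> a p q; set N := maxn (size p) (size q).
rewrite (@umb_wide N (a *: p + q)); last first.
  by rewrite (leq_trans (size_polyD _ _)) // geq_max leq_maxr (leq_trans (size_scale_leq _ _)) // leq_maxl.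
rewrite (@umb_wide N p) ?leq_maxl // (@umb_wide N q) ?leq_maxr // mulr_sumr -big_split /=.
by apply: eq_bigr => i _; rewrite coefD coefZ mulrDl mulrA.
Qed.

HB.instance Definition _ := GRing.isLinear.Build F {poly F} F _ umb umb_is_linear.

Lemma umbXn n : umb 'X^n = b n.
Proof.
rewrite /umb size_polyXn big_ord_recr /= big1 ?add0r ?coefXn ?eqxx ?mul1r // => i _.
by rewrite coefXn (ltn_eqF (ltn_ord i)) mul0r.
Qed.

Lemma umbZ a p : umb (a *: p) = a * umb p.
Proof. by rewrite linearZ. Qed.

Definition ndiff (j : nat) : F := umb ((1 - 'X) ^+ j).

(** Both sides evaluate [(1 - (1 + w) X)^d]; the right one writes the base as
    [- w + (1 + w) (1 - X)]. *)
Lemma umb_one_sub (d : nat) (w : F) :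
  \sum_(j < d.+1) 'C(d, j)%:R * b j * (- (1 + w)) ^+ j =
  \sum_(j < d.+1) 'C(d, j)%:R * ndiff j * ((1 + w) ^+ j * (- w) ^+ (d - j)).
Proof.
transitivity (umb ((1 - (1 + w) *: 'X) ^+ d)).
  rewrite exprBn raddf_sum /=; apply: eq_bigr => j _.
  rewrite raddfMn /= expr1n mulr1 exprZn -scalerAr umbZ.
  rewrite (_ : (-1) ^+ j * 'X^j = (-1) ^+ j *: 'X^j :> {poly F}); last first.
    by rewrite -mul_polyC rmorphXn rmorphN rmorph1.
  by rewrite umbZ umbXn -mulr_natl [(- (1 + w)) ^+ j]exprNn; ring.
rewrite (_ : 1 - (1 + w) *: 'X = (- w)%:P + (1 + w) *: (1 - 'X)); last first.
  by rewrite scalerBr scalerDl -!mul_polyC polyCN polyCD !mulr1; ring.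
rewrite exprDn raddf_sum /=; apply: eq_bigr => j _.
rewrite raddfMn /= exprZn -polyC_exp mul_polyC !umbZ /ndiff -mulr_natl; ring.
Qed.
End Umbral.

Section Umbral2.
Variables (F : comNzRingType) (b : nat -> F).

(** Two independent copies of the umbra: the variable of the coefficients and the outer variable are
    evaluated separately. *)
Definition umb2 (P : {poly {poly F}}) : F := umb b (map_poly (umb b) P).

Lemma umb2_tensor (p q : {poly F}) : umb2 (map_poly polyC p * q%:P) = umb b p * umb b q.
Proof.
rewrite /umb2 [RHS]mulrC -umbZ; congr (umb b _); apply/polyP => i.
by rewrite coef_map /= coefMC coef_map /= mul_polyC umbZ coefZ mulrC.
Qed.

Lemma umb2_sum (I : finType) (G : I -> {poly {poly F}}) : umb2 (\sum_i G i) = \sum_i umb2 (G i).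
Proof. by rewrite /umb2 !raddf_sum. Qed.

Lemma umb2Mn (P : {poly {poly F}}) n : umb2 (P *+ n) = umb2 P *+ n.
Proof. by rewrite /umb2 !raddfMn. Qed.

Lemma umb2_expB (p q : {poly F}) N :
  umb2 ((map_poly polyC p - q%:P) ^+ N) =
  \sum_(i < N.+1) (-1) ^+ i * 'C(N, i)%:R * umb b (p ^+ (N - i)) * umb b (q ^+ i).
Proof.
rewrite exprBn umb2_sum; apply: eq_bigr => i _; rewrite umb2Mn.
have -> : (-1) ^+ i * map_poly polyC p ^+ (N - i) * q%:P ^+ i =
          map_poly polyC (((-1) ^+ i)%:P * p ^+ (N - i)) * (q ^+ i)%:P :> {poly {poly F}}.
  by rewrite rmorphM !rmorphXn /= !rmorphN1.
rewrite umb2_tensor mul_polyC umbZ -mulr_natl; ring.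
Qed.

Lemma umb_alt_sum (m : nat) :
  \sum_(i < (2 * m).+1) (-1) ^+ i * 'C(2 * m, i)%:R * b (2 * m - i)%N * b i =
  \sum_(i < (2 * m).+1) (-1) ^+ i * 'C(2 * m, i)%:R * ndiff b (2 * m - i) * ndiff b i.
Proof.
transitivity (umb2 ((map_poly polyC 'X - 'X%:P) ^+ (2 * m))).
  by rewrite umb2_expB; apply: eq_bigr => i _; rewrite !umbXn.
(* The two bases differ by a sign, so their squares are compared; this is where the even exponent
   enters. *)
rewrite -[RHS]umb2_expB !exprM; congr (umb2 (_ ^+ m)).
by rewrite rmorphB /= rmorph1 rmorphB /= rmorph1; ring.
Qed.
End Umbral2.

(** * Umbral form of differences and of Hermite polynomials *)

Lemma bdiff_umb (b : nat -> R) j n : bdiff b j n = umb b ((1 - 'X) ^+ j * 'X^n).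
Proof.
elim: j n => [|j IH] n; first by rewrite expr0 mul1r umbXn.
rewrite (_ : bdiff b j.+1 n = bdiff b j n - bdiff b j n.+1) // !IH.
by rewrite -raddfB /=; congr (umb b _); rewrite !exprS; ring.
Qed.

Lemma bdiff_ndiff (b : nat -> R) j : bdiff b j 0 = ndiff b j.
Proof. by rewrite bdiff_umb expr0 mulr1. Qed.

Lemma hnum_SS j : hnum j.+2 = - (j.+1%:R * hnum j).
Proof. by rewrite -mulNr -INRE. Qed.

(** Gaussian integration by parts in umbral form: on monomials it is the recursion of [hnum],
    together with [hnum 1 = 0] for constant [p]. *)
Lemma umb_hnum_X (p : {poly R}) : umb hnum ('X * p) = - umb hnum p^`().
Proof.
rewrite -[p]coefK poly_def; set G := fun i : 'I_(size p) => p`_i *: 'X^i.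
transitivity (\sum_i umb hnum ('X * G i)); first by rewrite mulr_sumr raddf_sum.
transitivity (- \sum_i umb hnum (G i)^`()); last first.
  by congr (- _); rewrite (raddf_sum (@deriv R)) raddf_sum.
rewrite -sumrN /G.
apply: eq_bigr => i _; rewrite -scalerAr umbZ -exprS umbXn derivZ umbZ derivXn.
case: (nat_of_ord i) => [|j]; first by rewrite mulr0n raddf0 mulr0 oppr0.
by rewrite -scaler_nat umbZ umbXn hnum_SS mulrN.
Qed.

(** [He d y] is the umbral value of [(y + X)^d]: one factor [y + X] is split off, and [umb_hnum_X]
    turns its [X] part into the derivative term of the three-term recursion. *)
Lemma He_hnum d (y : R) : He d y = \sum_(j < d.+1) 'C(d, j)%:R * hnum j * y ^+ (d - j).
Proof.
transitivity (umb hnum ((y%:P + 'X) ^+ d)); last first.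
  rewrite exprDn raddf_sum /=; apply: eq_bigr => j _.
  by rewrite -polyC_exp mul_polyC -scaler_nat !umbZ umbXn mulrA mulrAC.
suff [] : He d y = umb hnum ((y%:P + 'X) ^+ d) /\ He d.+1 y = umb hnum ((y%:P + 'X) ^+ d.+1) by [].
have u1 : umb hnum 1 = 1 by rewrite -(expr0 'X) umbXn.
have uX : umb hnum 'X = 0 by rewrite -['X]expr1 umbXn.
elim: d => [|d [IH1 IH2]]; split => //.
- rewrite expr1 raddfD /= -[y%:P]mulr1 mul_polyC umbZ u1 uX addr0.
  by rewrite /= Rminus_0_r.
- rewrite He_SS IH1 IH2 INRE [in RHS]exprS mulrDl raddfD /= mul_polyC umbZ umb_hnum_X.
  by rewrite deriv_exp derivD derivC derivX add0r mul1r -scaler_nat umbZ.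
Qed.

Lemma hnum_sign j : hnum j.*2.+1 = 0 /\ 0 < (-1) ^+ j * hnum j.*2.
Proof.
elim: j => [|j [IH1 IH2]]; first by split; rewrite // expr0 mul1r ltr01.
rewrite doubleS; split; first by rewrite hnum_SS IH1 mulr0 oppr0.
by rewrite hnum_SS exprS mulN1r mulrNN mulrCA mulr_gt0 // ltr0n.
Qed.

(** * Limits of finite sums, products and powers *)

Lemma is_lim_seq_sum N (u : nat -> nat -> R) (l : nat -> R) :
  (forall j, (j < N)%N -> is_lim_seq (u j) (l j)) ->
  is_lim_seq (fun n => \sum_(j < N) u j n) (\sum_(j < N) l j).
Proof.
elim: N => [|N IH] H.
  apply: (is_lim_seq_ext (fun=> 0)) => [n|]; first by rewrite big_ord0.
  by rewrite big_ord0; apply: is_lim_seq_const.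
apply: (is_lim_seq_ext (fun n => Rplus (\sum_(j < N) u j n) (u N n))) => [n|].
  by rewrite big_ord_recr.
rewrite big_ord_recr; apply: is_lim_seq_plus'; last exact: H.
by apply: IH => j jN; apply: H; apply: ltnW.
Qed.

Lemma is_lim_seq_mul (u v : nat -> R) (a c : R) :
  is_lim_seq u a -> is_lim_seq v c -> is_lim_seq (fun n => u n * v n) (a * c).
Proof. by move=> hu hv; apply: is_lim_seq_mult'. Qed.

Lemma is_lim_seq_exp (u : nat -> R) (a : R) k :
  is_lim_seq u a -> is_lim_seq (fun n => u n ^+ k) (a ^+ k).
Proof.
move=> hu; elim: k => [|k IH]; first by apply: (is_lim_seq_const 1).
apply: (is_lim_seq_ext (fun n => u n * u n ^+ k)) => [n|]; first by rewrite exprS.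
by rewrite exprS; apply: is_lim_seq_mul.
Qed.

Lemma eventually_le (P : nat -> nat -> Prop) d :
  (forall i, (i <= d)%N -> exists N, forall n, (N <= n)%N -> P i n) ->
  exists N, forall n, (N <= n)%N -> forall i, (i <= d)%N -> P i n.
Proof.
elim: d => [|d IH] H.
  by have [N HN] := H 0%N isT; exists N => n nN i; rewrite leqn0 => /eqP ->; apply: HN.
have [N1 H1] := IH (fun i id => H i (leqW id)); have [N2 H2] := H d.+1 (leqnn _).
exists (maxn N1 N2) => n; rewrite geq_max => /andP [n1 n2] i.
by rewrite leq_eqVlt => /predU1P [->|]; [apply: H2|apply: H1].
Qed.

Lemma lim_gt0_eventually (u : nat -> R) (l : R) :
  is_lim_seq u l -> 0 < l -> exists N, forall n, (N <= n)%N -> 0 < u n.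
Proof.
move=> hu /RltP l0; have [N HN] := is_lim_seq_pos_eventually _ _ hu l0.
by exists N => n /ssrnat.leP /HN /RltP.
Qed.

Lemma series_of_fps_parts (L : seq nat) : all_pos L -> series_of L (fun n => (fps_parts L n)%:~R : R).
Proof.
elim: L => [|m L IH] HL; first by apply: series_nil.
apply: series_cons (IH _) _ => [i iL|n]; first by apply: HL; right.
have m0 : (0 < m)%N by apply/ssrnat.leP; apply: HL; left.
rewrite fps_parts_rec // rmorphD /=; congr (_ + _).
have -> : Nat.leb m n = (m <= n)%N by apply/idP/ssrnat.leP => /PeanoNat.Nat.leb_le.
by case: ifP.
Qed.

Section Asymptotics.
Variable k : nat.
Let a (n : nat) : R := (Defs.Delta k n)%:~R.

Lemma Delta_asymptotics (J : nat) : exists (n0 : nat) (r s l : nat -> R),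
  [/\ forall n, (n0 <= n)%N -> [/\ 0 < r n, 0 < s n & 0 < l n],
      is_lim_seq s (0 : R) &
      forall j, (j <= J)%N ->
        is_lim_seq (fun n => l n * ndiff (fun i => a (n + i) * r n ^+ i) j / s n ^+ j) (hnum j)].
Proof.
have [||M|n0 [r [s [l [H1 [H2 H3]]]]]] := @hermite_asymptotics (multiplicity k) 3 J a.
- by move=> m _; apply/ssrnat.leP; rewrite /multiplicity; case: ifP.
- by move=> m; apply/ssrnat.leP; rewrite /multiplicity; case: ifP.
- exists (fun n => (fps_parts (parts (multiplicity k) M) n)%:~R); split.
    by apply: series_of_fps_parts; apply: parts_pos.
  by move=> n /ssrnat.leP nM; rewrite Delta_fps_parts.
exists n0, r, s, l; split => //.
  by move=> n /ssrnat.leP /H1 [[/RltP ? _] [/RltP ? /RltP ?]].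
move=> j /ssrnat.leP /H3; apply: is_lim_seq_ext => n.
rewrite bdiff_ndiff RpowE; congr (_ * ndiff _ _ / _).
by apply: FunctionalExtensionality.functional_extensionality => i; rewrite RpowE.
Qed.

(** Rational coefficients let one polynomial be mapped both to [R], where its signs are found, and
    to [algC], where its roots lie. The index is not shifted by one here. *)
Definition jensen_rat (d n : nat) : {poly rat} :=
  \sum_(j < d.+1) ('C(d, j)%:R * (Defs.Delta k (n + j)%N)%:~R) *: 'X^j.

Lemma jensen_rat_map (F : numFieldType) d n : map_poly ratr (jensen_rat d n) =
  \sum_(j < d.+1) ('C(d, j)%:R * (Defs.Delta k (n + j)%N)%:~R) *: 'X^j :> {poly F}.
Proof.
rewrite rmorph_sum /=; apply: eq_bigr => j _.
by rewrite linearZ /= map_polyXn rmorphM /= ratr_nat ratr_int.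
Qed.

(** The two indices in each product add up to [2 n + 2 m], so the tilt [r^i] leaves the sum as the
    single factor [r^(2m)]. Hence [L_m] is a positive multiple of [Q n], whose limit [q] is strictly
    positive. *)
Lemma L_Delta_eventually (m : nat) : exists N, forall n, (N <= n)%N -> 0 <= L_Delta k m n.
Proof.
have [n0 [r [s [l [pos _ lim]]]]] := Delta_asymptotics (2 * m).
pose E j n := l n * ndiff (fun i => a (n + i) * r n ^+ i) j / s n ^+ j.
pose Q n := \sum_(i < (2 * m).+1) ((-1) ^+ m * ((-1) ^+ i * 'C(2 * m, i)%:R)) * (E (2 * m - i)%N n * E i n).
pose q := \sum_(i < (2 * m).+1) ((-1) ^+ m * ((-1) ^+ i * 'C(2 * m, i)%:R)) * (hnum (2 * m - i)%N * hnum i).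
have Qq : is_lim_seq Q q.
  apply: (is_lim_seq_sum (u := fun i n => ((-1) ^+ m * ((-1) ^+ i * 'C(2 * m, i)%:R)) * (E (2 * m - i)%N n * E i n))
    (l := fun i => ((-1) ^+ m * ((-1) ^+ i * 'C(2 * m, i)%:R)) * (hnum (2 * m - i)%N * hnum i))) => i im.
  apply: is_lim_seq_mul; first exact: is_lim_seq_const.
  by apply: is_lim_seq_mul; apply: lim; rewrite ?leq_subr // -ltnS.
(* Odd indices vanish with [hnum]. For [i = 2 e] the sign [(-1)^m] splits into [(-1)^(m - e)] and
   [(-1)^e], one for each factor; the term [i = 0] is strictly positive. *)
have q0 : 0 < q.
  rewrite /q (bigD1 ord0) //= subn0 expr0 bin0 !mulr1; apply: ltr_wpDr.
    apply: sumr_ge0 => -[i /= im] _; rewrite ltnS in im.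
    have := odd_double_half i; move: (i./2) => e; case: (odd i) => /= ei; subst i.
      by rewrite add1n (hnum_sign e).1 !mulr0.
    rewrite add0n mul2n leq_double in im *.
    rewrite -doubleB -[(-1) ^+ e.*2]signr_odd odd_double expr0 mul1r.
    have h1 := (hnum_sign (m - e)).2; have h2 := (hnum_sign e).2.
    rewrite -{1}(subnK im) exprD.
    rewrite (_ : _ * _ = 'C(m.*2, e.*2)%:R *
      (((-1) ^+ (m - e) * hnum (m - e).*2) * ((-1) ^+ e * hnum e.*2))); last by ring.
    by apply: mulr_ge0; [rewrite ler0n|apply: ltW; apply: mulr_gt0].
  by rewrite mul2n (hnum_sign m).2.
have [N HN] := lim_gt0_eventually Qq q0.
exists (maxn n0 N) => n; rewrite geq_max => /andP [/pos [r0 s0 l0] /HN Qn].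
(* The integer behind the rational [L_Delta]: its sign is found in [R] and carried back. *)
pose Z := \sum_(i < (2 * m).+1) ((-1) ^+ (i + m) * 'C(2 * m, i)%:R * Defs.Delta k (n + i) * Defs.Delta k (n + 2 * m - i)) : int.
have -> : L_Delta k m n = 1 / 2 * Z%:~R.
  rewrite /L_Delta /Z rmorph_sum /=; congr (_ * _); apply: eq_bigr => i _.
  by rewrite !rmorphM /= rmorphXn /= rmorphN1 rmorph_nat.
suff : 0 < Z%:~R :> R by rewrite ltr0z => Z0; rewrite mulr_ge0 // ler0z ltW.
pose b i := a (n + i) * r n ^+ i.
have EZ : l n ^+ 2 / s n ^+ (2 * m) * r n ^+ (2 * m) * Z%:~R = Q n.
  rewrite /Z rmorph_sum /=.
  transitivity (l n ^+ 2 / s n ^+ (2 * m) * (-1) ^+ m * \sum_(i < (2 * m).+1) (-1) ^+ i * 'C(2 * m, i)%:R * b (2 * m - i)%N * b i).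
    rewrite !mulr_sumr; apply: eq_bigr => i _.
    have im : (i <= 2 * m)%N by rewrite -ltnS.
    rewrite /b /a -addnBA // !rmorphM /= rmorphXn /= rmorphN1 rmorph_nat exprD -{2}(subnK im) exprD; ring.
  rewrite umb_alt_sum mulr_sumr; apply: eq_bigr => i _.
  have im : (i <= 2 * m)%N by rewrite -ltnS.
  have sne : s n != 0 by rewrite gt_eqF.
  rewrite /E -/b -{1}(subnK im) exprD; field.
  by rewrite !expf_neq0.
have c0 : 0 < l n ^+ 2 / s n ^+ (2 * m) * r n ^+ (2 * m).
  by rewrite mulr_gt0 ?exprn_gt0 // divr_gt0 ?exprn_gt0.
by rewrite -(pmulr_rgt0 _ c0) EZ.
Qed.
Definition jensenR (d n : nat) : {poly R} := map_poly ratr (jensen_rat d n).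

Lemma jensenR_horner d n x :
  (jensenR d n).[x] = \sum_(j < d.+1) 'C(d, j)%:R * a (n + j) * x ^+ j.
Proof.
rewrite /jensenR jensen_rat_map horner_sum; apply: eq_bigr => j _.
by rewrite hornerZ hornerXn.
Qed.

(** This is [umb_one_sub] at [w = - u s]: the powers [(u s)^(d - j)] cancel part of [1 / s^d] and
    leave [1 / s^j], the scaling under which the differences converge. *)
Lemma jensenR_rescale (d n : nat) (r s l u : R) : s != 0 ->
  l / s ^+ d * (jensenR d n).[- (r * (1 - u * s))] =
  \sum_(j < d.+1) 'C(d, j)%:R * ((1 - u * s) ^+ j * u ^+ (d - j)) *
     (l * ndiff (fun i => a (n + i) * r ^+ i) j / s ^+ j).
Proof.
move=> s0; rewrite jensenR_horner.
transitivity (l / s ^+ d * \sum_(j < d.+1) 'C(d, j)%:R * (a (n + j) * r ^+ j) * (- (1 + - (u * s))) ^+ j).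
  congr (_ * _); apply: eq_bigr => j _.
  by rewrite -mulrN exprMn !mulrA.
rewrite (umb_one_sub (fun i => a (n + i) * r ^+ i)) mulr_sumr; apply: eq_bigr => j _.
have jd : (j <= d)%N by rewrite -ltnS.
rewrite opprK exprMn -{1}(subnK jd) exprD; field.
by rewrite !expf_neq0.
Qed.

Lemma jensenR_alternates (d : nat) : exists N, forall n, (N <= n)%N ->
  exists x : nat -> R, (forall i, (i < d)%N -> x i < x i.+1) /\
    forall i, (i <= d)%N -> 0 < (-1) ^+ (d + i) * (jensenR d n).[x i].
Proof.
have [u [ulift usign]] := He_alternates d.
have [n0 [r [s [l [pos s0 lim]]]]] := Delta_asymptotics d.
pose E j n := l n * ndiff (fun i => a (n + i) * r n ^+ i) j / s n ^+ j.
pose Q i n := (-1) ^+ (d + i) *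
  \sum_(j < d.+1) 'C(d, j)%:R * ((1 - u i * s n) ^+ j * u i ^+ (d - j)) * E j n.
have key i : (i <= d)%N -> exists N, forall n, (N <= n)%N -> 0 < Q i n.
  move=> id; apply: (@lim_gt0_eventually (Q i) ((-1) ^+ (d + i) * He d (u i))); last first.
    by have /RltP := usign i (ssrnat.leP id); rewrite RpowE.
  apply: is_lim_seq_mul; first exact: is_lim_seq_const.
  rewrite He_hnum.
  apply: (is_lim_seq_sum (u := fun j n => 'C(d, j)%:R * ((1 - u i * s n) ^+ j * u i ^+ (d - j)) * E j n)
    (l := fun j => 'C(d, j)%:R * hnum j * u i ^+ (d - j))) => j jd.
  have -> : 'C(d, j)%:R * hnum j * u i ^+ (d - j) =
     'C(d, j)%:R * ((1 - u i * 0) ^+ j * u i ^+ (d - j)) * hnum j.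
    by rewrite mulr0 subr0 expr1n mul1r mulrAC.
  apply: is_lim_seq_mul; last by apply: lim; rewrite -ltnS.
  apply: is_lim_seq_mul; first exact: is_lim_seq_const.
  apply: is_lim_seq_mul; last exact: is_lim_seq_const.
  apply: is_lim_seq_exp; apply: is_lim_seq_minus'; first exact: is_lim_seq_const.
  by apply: is_lim_seq_mul => //; exact: is_lim_seq_const.
have [N HN] := eventually_le key.
exists (maxn n0 N) => n; rewrite geq_max => /andP [/pos [r0 sn0 l0] /HN Qn].
exists (fun i => - (r n * (1 - u i * s n))); split=> i id.
  rewrite ltrN2 ltr_pM2l // ltrD2l ltrN2 ltr_pM2r //.
  by apply/RltP/ulift/ssrnat.leP.
have c0 : 0 < l n / s n ^+ d by rewrite divr_gt0 ?exprn_gt0.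
rewrite -(pmulr_rgt0 _ c0) mulrCA jensenR_rescale ?gt_eqF //; exact: Qn.
Qed.

Lemma continuous_horner_R (p : {poly R}) (x : R) : @continuous R_UniformSpace R_UniformSpace (fun y : R => p.[y]) x.
Proof.
elim/poly_ind: p => [|p c IH].
  by apply: (continuous_ext (T := R_UniformSpace) (U := R_UniformSpace) (fun=> (0 : R))) => [y|]; [rewrite horner0|exact: continuous_const].
apply: (continuous_ext (T := R_UniformSpace) (U := R_UniformSpace) (fun y : R => Rplus (Rmult p.[y] y) c)) => [y|]; first by rewrite hornerMXaddC.
apply: (continuous_plus (V := R_NormedModule)); last exact: continuous_const.
by apply: (continuous_mult (K := R_AbsRing)) => //; exact: continuous_id.
Qed.

(** By continuity each point may move slightly to the right without changing the sign; stopping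
    before the next original point preserves the order. *)
Lemma rational_alternates (p : {poly R}) (d e : nat) (x : nat -> R) :
  (forall i, (i < d)%N -> x i < x i.+1) ->
  (forall i, (i <= d)%N -> 0 < (-1) ^+ (e + i) * p.[x i]) ->
  exists q : nat -> rat, (forall i, (i < d)%N -> q i < q i.+1) /\
    forall i, (i <= d)%N -> 0 < (-1) ^+ (e + i) * p.[ratr (q i)].
Proof.
move=> xlt sg.
have near i : exists q : rat, (i <= d)%N ->
    [/\ x i < ratr q, (i < d)%N -> ratr q < x i.+1 & 0 < (-1) ^+ (e + i) * p.[ratr q]].
  have [id|di] := leqP i d; last by exists 0.
  have [] := @continuous_pos_right (fun y => ((-1) ^+ (e + i) *: p).[y]) (x i).
  - exact: continuous_horner_R.
  - by apply/RltP; rewrite hornerZ; apply: sg.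
  move=> dl [/RltP dl0 H].
  pose top := if (i < d)%N then Num.min (x i + dl) (x i.+1) else x i + dl.
  have xtop : x i < top.
    by rewrite /top; case: ifP => c; rewrite ?lt_min ?ltrDl ?dl0 ?xlt.
  have [q] := rat_in_itvoo xtop; rewrite in_itv /= => /andP [q1 q2].
  exists q => _; split => //.
    by move=> c; move: q2; rewrite /top c lt_min => /andP [].
  rewrite -hornerZ; apply/RltP/H; apply/RltP => //.
  by move: q2; rewrite /top; case: ifP => // _; rewrite lt_min => /andP [].
have [q Hq] := IndefiniteDescription.functional_choice _ near.
exists q; split=> i id; last by have [] := Hq i id.
have [_ /(_ id) lt1 _] := Hq i (ltnW id); have [lt2 _ _] := Hq i.+1 id.
by rewrite -(ltr_rat R); apply: lt_trans lt2.
Qed.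

Lemma jensen_real_roots (d : nat) : exists N, forall n, (N <= n)%N ->
  forall z, root (map_poly ratr (jensen_rat d n) : {poly algC}) z -> z \is Num.real.
Proof.
have [N HN] := jensenR_alternates d; exists N => n /HN [x [xlt xs]] z pz.
have [q [qlt qs]] := rational_alternates xlt xs.
(* [alternates] asks for a positive first value, while the Jensen polynomial has sign [(-1)^d] at
   the leftmost point. *)
pose p : {poly rat} := (-1) ^+ d *: jensen_rat d n.
have pc : self_conj (map_poly ratr p).
  rewrite /self_conj -map_poly_comp; apply: eq_map_poly => c /=; exact: fmorph_rat.
apply: (@alternates_real_roots _ (fun i => ratr (q i)) d _ pc).
- rewrite size_map_poly (leq_trans (size_scale_leq _ _)) // /jensen_rat.
  by rewrite -(poly_def _ (fun j => 'C(d, j)%:R * (Defs.Delta k (n + j)%N)%:~R)) size_poly.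
- split=> i id; first by apply: Creal_Crat; apply: Crat_rat.
    by rewrite ltr_rat; apply: qlt.
  have := qs i id; rewrite /jensenR horner_map /= => h.
  (* The values at rational points are rational, so their signs agree in [R] and in [algC]. *)
  have e1 (F : numFieldType) v : (-1) ^+ (d + i) * ratr v = ratr ((-1) ^+ (d + i) * v) :> F.
    by rewrite rmorphM /= rmorphXn /= rmorphN1.
  rewrite horner_map /= /p hornerZ rmorphM /= rmorphXn /= rmorphN1 mulrA -exprD addnC.
  by move: h; rewrite !e1 !ltr0q.
- by rewrite /p linearZ /= rootZ // rmorphXn rmorphN1 signr_eq0.
Qed.
End Asymptotics.

Theorem theorem1p3 (k : nat) (hk : (1 <= k)%N) :
  (forall d : nat, (1 <= d)%N ->
     exists N : nat, forall n : nat, (N <= n)%N ->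
       forall z : algC, root (jensen_poly k d n) z -> z \is Num.real)
  /\
  (forall m : nat, (1 <= m)%N ->
     exists N : nat, forall n : nat, (N <= n)%N ->
       0 <= L_Delta k m n).
Proof.
split=> [d _|m _]; last exact: L_Delta_eventually.
(* [jensen_poly] at [n] starts from the coefficient [n.-1]; the bound [N.+1] rules out [n = 0],
   where the predecessor does not shift. *)
have [N HN] := jensen_real_roots k d; exists N.+1 => -[//|n] nN z.
by move=> pz; apply: (HN n nN); rewrite jensen_rat_map.
Qed.
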